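(* For every closed subset $E\subset\mathbb{R}$, every $p\in(1,\infty]$ and every $m\in\mathbb{N}$ there exists a continuous linear extension operator which maps the trace space $W^m_p(\mathbb{R})|_E$ into $W^m_p(\mathbb{R})$, i.e., a continuous linear map $T:W^m_p(\mathbb{R})|_E\to W^m_p(\mathbb{R})$ with $(Tf)|_E=f$ for every $f\in W^m_p(\mathbb{R})|_E$. Its operator norm is bounded by a constant depending only on $m$.
   Context: Sobolev spaces. $L^m_p(\mathbb{R})$ is the space of all functions $F:\mathbb{R}\to\mathbb{R}$ such that $F^{(m-1)}$ is absolutely continuous on $\mathbb{R}$ and the weak derivative $F^{(m)}$ belongs to $L_p(\mathbb{R})$. $W^m_p(\mathbb{R})$ is the space of all $F\in L^m_p(\mathbb{R})$ whose derivatives of all orders $0,\dots,m$ belong to $L_p(\mathbb{R})$, normed by $\|F\|_{W^m_p(\mathbb{R})}=\sum_{k=0}^m\|F^{(k)}\|_{L_p(\mathbb{R})}$. The trace space is $W^m_p(\mathbb{R})|_E=\{f:E\to\mathbb{R}:\ \exists F\in W^m_p(\mathbb{R}),\ F|_E=f\}$, equipped with the trace norm $\|f\|_{W^m_p(\mathbb{R})|_E}=\inf\{\|F\|_{W^m_p(\mathbb{R})}: F\in W^m_p(\mathbb{R}),\ F|_E=f\}$. *)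

(* Defs.v *)
From HB Require Import structures.
From mathcomp Require Import all_boot all_order all_algebra.
From mathcomp Require Import all_classical all_reals all_analysis.

Set Implicit Arguments.
Unset Strict Implicit.
Unset Printing Implicit Defensive.

Import Order.TTheory GRing.Theory Num.Theory.
Import numFieldNormedType.Exports.

Local Open Scope ring_scope.
Local Open Scope classical_set_scope.

Section sobolev.
Context (R : realType).
Implicit Types (f g F phi : R -> R) (m k : nat) (p : \bar R) (E : set R).

Local Notation mu := (@lebesgue_measure R).

(* This is the global epsilon-delta condition on R, not the local one; the two
   coincide for functions whose weak derivative is in some L_p, 1 <= p. *)
Definition absolutely_continuous f : Prop :=
  forall e : R, 0 < e -> exists2 d : R, 0 < d &
    forall (n : nat) (a b : 'I_n -> R),
      (forall i, a i < b i) ->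
      trivIset [set: 'I_n] (fun i => `]a i, b i[%classic) ->
      \sum_(i < n) (b i - a i) < d ->
      \sum_(i < n) `|f (b i) - f (a i)| < e.

Definition test_function phi : Prop :=
  (forall n x, derivable (phi^`(n)) x 1) /\
  compact (closure [set x | phi x != 0]).

Definition is_weak_derivative f g : Prop :=
  [/\ locally_integrable [set: R] f, locally_integrable [set: R] g &
    forall phi, test_function phi ->
      \int[mu]_x (f x * (phi^`())%classic x) = - \int[mu]_x (g x * phi x)].

(* A weak derivative is unique only up to a.e. equality; this picks one
   representative (and 0 if there is none). *)
Definition weak_derivative f : R -> R :=
  xget (cst 0) [set g | is_weak_derivative f g].

(* F^(k) for k <= m: classical below the top order m, weak at order m. *)
Definition sobolev_derivative m F k : R -> R :=
  if (k < m)%N then F^`(k) else weak_derivative (F^`(m.-1)).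

(* L^m_p(R), W^m_p(R) and their traces are meant for 0 < m. *)
Definition homogeneous_sobolev m p : set (R -> R) :=
  [set F | [/\ forall k x, (k < m.-1)%N -> derivable (F^`(k)) x 1,
               absolutely_continuous (F^`(m.-1)) &
               exists2 g, is_weak_derivative (F^`(m.-1)) g & g \in Lfun mu p]].

Definition sobolev m p : set (R -> R) :=
  [set F | homogeneous_sobolev m p F /\
           forall k, (k <= m)%N -> sobolev_derivative m F k \in Lfun mu p].

Definition sobolev_norm m p F : \bar R :=
  (\sum_(k < m.+1) 'N[mu]_p[EFin \o sobolev_derivative m F k])%E.

Definition restriction E F : E -> R := fun x => F (val x).

Definition trace_space m p E : set (E -> R) :=
  [set f | exists2 F, sobolev m p F & restriction F = f].

Definition trace_norm m p E (f : E -> R) : \bar R :=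
  ereal_inf [set sobolev_norm m p F | F in
               [set F | sobolev m p F /\ restriction F = f]].

(* Below, T stands for a map W^m_p(R)|_E -> W^m_p(R); its values outside
   trace_space m p E are never constrained. *)
Section trace_operator.
Context (m : nat) (p : \bar R) (E : set R) (T : (E -> R) -> (R -> R)).

Definition linear_on_trace : Prop :=
  forall (a : R) (f g : E -> R),
    trace_space m p f -> trace_space m p g ->
    T (a *: f + g) = a *: T f + T g.

Definition extension_operator : Prop :=
  forall f : E -> R, trace_space m p f ->
    sobolev m p (T f) /\ restriction (T f) = f.

Definition continuous_on_trace : Prop :=
  forall f : E -> R, trace_space m p f ->
    forall e : R, 0 < e -> exists2 d : R, 0 < d &
      forall g : E -> R, trace_space m p g ->
        (trace_norm m p (g - f)%R < d%:E)%E ->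
        (sobolev_norm m p (T g - T f)%R < e%:E)%E.

Definition operator_norm : \bar R :=
  ereal_sup [set sobolev_norm m p (T f) | f in
    [set f : E -> R | trace_space m p f /\ (trace_norm m p f <= 1)%E]].

End trace_operator.

End sobolev.

(* Main.v *)
From HB Require Import structures.
From mathcomp Require Import all_boot all_order all_algebra.
From mathcomp Require Import all_classical all_reals all_analysis.
From mathcomp Require Import ess_sup_inf measurable_realfun ring lra zify.
Require Import Defs.

(** Fix a finite set [e] of points of [E]. Add to [e] the integers at distance
    at least 1 from it, let [x] enumerate the result increasingly, and give the
    data the value 0 at the added points. The Newton polynomials of degree less
    than [m] through [m] consecutive nodes are glued by a smooth step placed on
    the largest gap between the nodes where two successive ones differ
    ([interpolant]). The result is smooth, linear in the data, and interpolates
    it. Two successive polynomials differ by the divided difference of order [m]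
    times the span of its nodes times a nodal polynomial, so the derivatives of
    the interpolant are controlled by divided differences
    ([interpolant_jet_lo], [interpolant_jet_hi]).

    If the data come from a Sobolev function [F], a divided difference of order
    [m] is at most the average of [|F^(m)|] over the span of its nodes, up to a
    local integral of the jet of [F] that appears when added points are involved
    ([ddiff_hi_bound]). Replacing a function by its averages on disjoint
    intervals does not increase its L_p norm ([Lnorm_average]). Hence the
    interpolants are bounded in W^m_p by a constant that depends only on [m]
    times the norm of [F]; neither [e] nor [p] enters.

    The extension is the limit of the interpolants along an ultrafilter on the
    finite sets that eventually contains each point ([extension]). Such limits
    are linear, and they interpolate on all of [E]. Because [1 < p], Hoelder's
    inequality makes the derivatives of order less than [m] equicontinuous, so
    they pass to the limit ([limit_jetP]). It also makes the limits of the
    integrals of the [m]-th derivatives an absolutely continuous charge, whose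
    Radon-Nikodym density is the [m]-th weak derivative of the limit; level sets
    bound its L_p norm ([Lnorm_weak_limit]). This treats [p = +oo] together with
    finite [p] and uses no duality of L_p spaces. *)

Set Implicit Arguments.
Unset Strict Implicit.
Unset Printing Implicit Defensive.

Import Order.TTheory GRing.Theory Num.Theory.
Import numFieldNormedType.Exports.

Local Open Scope ring_scope.
Local Open Scope classical_set_scope.

(** * Smooth functions of a real variable *)

Section smooth_functions.
Context (R : realType).
Implicit Types (f g df dg : R -> R).

Record smooth f : Prop :=
  Smooth { smooth_at :> forall n (x : R), derivable (f^`(n)) x 1 }.

(** The derivative of a product or of an inverse is built from the functions
    and their derivatives, so smoothness is propagated one order at a time. *)
Definition derivable_upto N f :=
  forall n (x : R), (n <= N)%N -> derivable (f^`(n)) x 1.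

Lemma derive1nSr f n : f^`(n.+1) = (f^`())^`(n).
Proof. by rewrite /derive1n iterSr. Qed.

Lemma is_derive_derive1 f df : (forall x : R, is_derive x 1 f (df x)) ->
  (forall x : R, derivable f x 1) /\ f^`() = df.
Proof.
move=> h; split=> [x|]; first by case: (h x).
by apply/funext => x; rewrite derive1E; case: (h x).
Qed.

Lemma derivable_is_derive f (x : R) : derivable f x 1 -> is_derive x 1 f (derive1 f x).
Proof. by move=> df; apply: DeriveDef => //; rewrite derive1E. Qed.

Lemma derivable_uptoS N f : derivable_upto N.+1 f <->
  (forall x : R, derivable f x 1) /\ derivable_upto N (f^`()).
Proof.
split=> [h|[h0 h] [|n] x nN]; last 2 first.
- exact: h0.
- by rewrite derive1nSr; apply: h.
split=> [x|n x nN]; first exact: (h 0%N).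
by rewrite -derive1nSr; apply: h.
Qed.

Lemma derivable_upto_le N M f : (M <= N)%N ->
  derivable_upto N f -> derivable_upto M f.
Proof. by move=> MN h n x nM; apply: h; apply: leq_trans MN. Qed.

Lemma smooth_upto f : smooth f <-> forall N, derivable_upto N f.
Proof.
by split=> [h N n x _|h]; [exact: h|split=> n x; exact: (h n)].
Qed.

Lemma smooth_derivable f (x : R) : smooth f -> derivable f x 1.
Proof. by move=> h; exact: (h 0%N x). Qed.

Lemma smooth_derive f : smooth f -> smooth (f^`()).
Proof. by move=> h; split=> n x; rewrite -derive1nSr; exact: h. Qed.

Lemma smooth_derive1n f k : smooth f -> smooth (f^`(k)).
Proof. by move=> h; elim: k => [|k IH]; [exact: h|rewrite derive1nS; exact: smooth_derive]. Qed.

Lemma derivable_continuousT f : (forall x : R, derivable f x 1) -> continuous f.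
Proof. by move=> h x; apply: differentiable_continuous; exact/derivable1_diffP. Qed.

Lemma smooth_continuous f : smooth f -> continuous f.
Proof. by move=> h; apply: derivable_continuousT => x; exact: smooth_derivable. Qed.

Lemma derive1_add f g : (forall x : R, derivable f x 1) ->
  (forall x : R, derivable g x 1) -> (f + g)^`() = derive1 f + derive1 g.
Proof.
move=> hf hg; apply/funext => x.
by rewrite derive1E deriveD// -!derive1E.
Qed.

Lemma derive1_mul f g : (forall x : R, derivable f x 1) ->
  (forall x : R, derivable g x 1) -> (f * g)^`() = derive1 f * g + f * derive1 g.
Proof.
move=> hf hg; apply/funext => x.
rewrite derive1E deriveM// -!derive1E addrC.
by congr (_ + _); rewrite /GRing.scale /= mulrC.
Qed.

Lemma derivable_uptoD N f g : derivable_upto N f -> derivable_upto N g ->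
  derivable_upto N (f + g).
Proof.
elim: N f g => [|N IH] f g hf hg.
  by move=> [|//] x _; apply: derivableD; [exact: (hf 0%N)|exact: (hg 0%N)].
move: hf hg => /derivable_uptoS[f0 f1] /derivable_uptoS[g0 g1].
apply/derivable_uptoS; split=> [x|]; first exact: derivableD.
rewrite derive1_add; [|exact: f0|exact: g0].
by apply: IH; [exact: f1|exact: g1].
Qed.

Lemma derivable_uptoM N f g : derivable_upto N f -> derivable_upto N g ->
  derivable_upto N (f * g).
Proof.
elim: N f g => [|N IH] f g hf hg.
  by move=> [|//] x _; apply: derivableM; [exact: (hf 0%N)|exact: (hg 0%N)].
have hf' := derivable_upto_le (leqnSn N) hf.
have hg' := derivable_upto_le (leqnSn N) hg.
move: hf hg => /derivable_uptoS[f0 f1] /derivable_uptoS[g0 g1].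
apply/derivable_uptoS; split=> [x|]; first exact: derivableM.
rewrite derive1_mul; [|exact: f0|exact: g0].
by apply: derivable_uptoD; apply: IH; [exact: f1|exact: hg'|exact: hf'|exact: g1].
Qed.

Lemma smoothD f g : smooth f -> smooth g -> smooth (f + g).
Proof.
move=> /smooth_upto hf /smooth_upto hg.
by apply/smooth_upto => N; exact: derivable_uptoD.
Qed.

Lemma smoothM f g : smooth f -> smooth g -> smooth (f * g).
Proof.
move=> /smooth_upto hf /smooth_upto hg.
by apply/smooth_upto => N; exact: derivable_uptoM.
Qed.

Lemma derive1n_cst (c : R) n : (cst c : R -> R)^`(n.+1) = cst 0.
Proof.
elim: n => [|n IH]; last by rewrite derive1nS IH; apply/funext => x; rewrite derive1_cst.
by apply/funext => x; rewrite derive1n1 derive1_cst.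
Qed.

Lemma smooth_cst (c : R) : smooth (cst c).
Proof. by split=> -[|n] x; rewrite ?derive1n_cst; exact: derivable_cst. Qed.

Lemma derive1nD f g n : smooth f -> smooth g ->
  (f + g)^`(n) = derive1n n f + derive1n n g.
Proof.
elim: n f g => // n IH f g hf hg.
rewrite !derive1nSr derive1_add; [|by move=> x; exact: smooth_derivable..].
by apply: IH; exact: smooth_derive.
Qed.

Lemma smoothZ (a : R) f : smooth f -> smooth (a *: f).
Proof.
move=> hf; have -> : a *: f = cst a * f by [].
by apply: smoothM => //; exact: smooth_cst.
Qed.

Lemma derive1nZ (a : R) f n : smooth f -> (a *: f)^`(n) = a *: derive1n n f.
Proof.
elim: n f => // n IH f hf; rewrite !derive1nSr -IH; last exact: smooth_derive.
congr (_^`(n)); apply/funext => x.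
by rewrite derive1E deriveZ; [rewrite -derive1E|exact: smooth_derivable].
Qed.

Lemma smoothN f : smooth f -> smooth (- f).
Proof. by rewrite -scaleN1r; exact: smoothZ. Qed.

Lemma derive1nB f g n : smooth f -> smooth g ->
  (f - g)^`(n) = derive1n n f - derive1n n g.
Proof.
move=> hf hg; rewrite derive1nD; [|exact: hf|exact: smoothN].
by rewrite -[in LHS]scaleN1r derive1nZ; [rewrite scaleN1r|exact: hg].
Qed.

Lemma cst0_fun : cst 0 = 0 :> (R -> R).
Proof. by apply/funext. Qed.

Lemma smooth_sum (I : Type) (r : seq I) (P : pred I) (F : I -> R -> R) :
  (forall i, smooth (F i)) -> smooth (\sum_(i <- r | P i) F i).
Proof.
move=> hF; apply: big_ind; first by rewrite -cst0_fun; exact: smooth_cst.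
  by move=> ? ?; exact: smoothD.
by move=> i _; exact: hF.
Qed.

Lemma derive1n_sum (I : Type) (r : seq I) (P : pred I) (F : I -> R -> R) n :
  (forall i, smooth (F i)) ->
  (\sum_(i <- r | P i) F i)^`(n) = \sum_(i <- r | P i) derive1n n (F i).
Proof.
move=> hF.
suff [_ ->] : smooth (\sum_(i <- r | P i) F i) /\
   (\sum_(i <- r | P i) F i)^`(n) = \sum_(i <- r | P i) derive1n n (F i) by [].
apply: (big_rec2 (fun f g : R -> R => smooth f /\ f^`(n) = g)).
  rewrite -cst0_fun; split; first exact: smooth_cst.
  by case: n => [|n]; [|rewrite derive1n_cst].
move=> i g h _ [sf fg]; split; first by apply: smoothD; [exact: hF|exact: sf].
by rewrite derive1nD; [rewrite fg|exact: hF|exact: sf].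
Qed.

Lemma smooth_horner (p : {poly R}) : smooth (horner p).
Proof.
split=> n; elim: n p => [|n IH] p x; first exact: derivable_horner.
by rewrite derive1nSr -derivE; exact: IH.
Qed.

Lemma derive1n_horner (p : {poly R}) n :
  (horner p)^`(n) = horner (derivn n p).
Proof.
elim: n p => [|n IH] p; first by rewrite derivn0.
by rewrite derive1nSr -derivE IH derivSn.
Qed.

Lemma is_derive_inv f (x : R) : (f x != 0) -> derivable f x 1 ->
  is_derive x 1 (fun y => (f y)^-1) (- ((f x)^-1 * (f x)^-1 * derive1 f x)).
Proof.
move=> f0 df; apply: DeriveDef; first exact: derivableV.
by rewrite deriveV// -derive1E /GRing.scale /= -invfM -expr2 mulNr.
Qed.

Lemma smoothV f : (forall x, f x != 0) -> smooth f -> smooth (fun y => (f y)^-1).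
Proof.
move=> f0 /smooth_upto hf; apply/smooth_upto => N.
elim: N => [|N IH].
  by move=> [|//] x _; apply: derivableV => //; exact: (hf 0%N 0%N).
have d0 (x : R) : derivable f x 1 by exact: (hf 0%N 0%N).
have [h0 h1] := is_derive_derive1 (fun x : R => is_derive_inv (f0 x) (d0 x)).
apply/derivable_uptoS; split => //; rewrite h1.
have -> : (fun x => - ((f x)^-1 * (f x)^-1 * derive1 f x)) =
  cst (-1) * ((fun y => (f y)^-1) * (fun y => (f y)^-1) * derive1 f).
  apply/funext => x; change (- ((f x)^-1 * (f x)^-1 * derive1 f x) =
    - 1 * ((f x)^-1 * (f x)^-1 * derive1 f x)).
  by rewrite mulN1r.
apply: derivable_uptoM; first by move=> n x _; exact: smooth_cst.
apply: derivable_uptoM; first exact: derivable_uptoM.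
by have /derivable_uptoS[] := hf N.+1.
Qed.

Lemma is_derive_affine f (a b x : R) : derivable f (a * x + b) 1 ->
  is_derive x 1 (fun x => f (a * x + b)) (a * derive1 f (a * x + b)).
Proof.
move=> df.
have da : is_derive x 1 (fun x => a * x + b) a.
  have -> : (fun x => a * x + b) = a \*: id + cst b by [].
  by apply: is_derive_eq; rewrite addr0 /GRing.scale /= mulr1.
have := @is_derive1_comp R f (fun x => a * x + b) x _ _ (derivable_is_derive df) da.
by rewrite mulrC.
Qed.

Lemma smooth_affine f (a b : R) : smooth f ->
  smooth (fun x => f (a * x + b)) /\
  forall n, (fun x => f (a * x + b))^`(n) = fun x => a ^+ n * derive1n n f (a * x + b).
Proof.
move=> hf.
suff E n : (fun x => f (a * x + b))^`(n) = fun x => a ^+ n * derive1n n f (a * x + b).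
  split=> //; split=> n x; rewrite E.
  have -> : (fun x => a ^+ n * derive1n n f (a * x + b)) =
    (a ^+ n) \*: (fun x => derive1n n f (a * x + b)) by [].
  apply: derivableZ.
  by have [] := is_derive_affine (hf n (a * x + b)).
elim: n => [|n IH]; first by apply/funext => x; rewrite expr0 mul1r.
rewrite derive1nS IH; apply/funext => x.
have -> : (fun x => a ^+ n * derive1n n f (a * x + b)) =
    (a ^+ n) \*: (fun x => derive1n n f (a * x + b)) by [].
have [d1 d2] := is_derive_affine (hf n (a * x + b)).
rewrite derive1E deriveZ; last exact: d1.
by rewrite d2 /GRing.scale /= exprSr mulrA.
Qed.

(** Geometric bounds multiply with the ratios added. This is the binomial
    theorem behind the Leibniz rule, and it avoids the rule itself. *)
Lemma derive1nM_bound f g t (A B rho kap : R) r : smooth f -> smooth g ->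
  (forall k, (k <= r)%N -> `|f^`(k) t| <= A * rho ^+ k) ->
  (forall k, (k <= r)%N -> `|g^`(k) t| <= B * kap ^+ k) ->
  `|(f * g)^`(r) t| <= A * B * (rho + kap) ^+ r.
Proof.
elim: r f g A B => [|r IH] f g A B hf hg bf bg.
  rewrite expr0 mulr1 normrM.
  by move: (bf 0%N isT) (bg 0%N isT); rewrite !expr0 !mulr1 => ? ?; exact: ler_pM.
rewrite derive1nSr derive1_mul; [|by move=> x; exact: smooth_derivable..].
have sf := smooth_derive hf; have sg := smooth_derive hg.
rewrite derive1nD; [|by apply: smoothM..].
rewrite (le_trans (ler_normD _ _))//.
have -> : A * B * (rho + kap) ^+ r.+1 =
  (A * rho) * B * (rho + kap) ^+ r + A * (B * kap) * (rho + kap) ^+ r.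
  by rewrite exprS; ring.
apply: lerD; apply: IH => // k kr.
- by rewrite -derive1nSr -mulrA -exprS bf.
- by rewrite bg// (leq_trans kr).
- by rewrite bf// (leq_trans kr).
- by rewrite -derive1nSr -mulrA -exprS bg.
Qed.

(** Each application of Rolle gives a zero strictly between consecutive
    zeros, so the count drops by one with each derivative. *)
Lemma Rolle_iter f k (x : nat -> R) :
  (forall n (t : R), (n < k)%N -> derivable (f^`(n)) t 1) ->
  (forall i, (i < k)%N -> x i < x i.+1) ->
  (forall i, (i <= k)%N -> f (x i) = 0) ->
  exists2 t, x 0%N <= t <= x k & f^`(k) t = 0.
Proof.
elim: k f x => [|k IH] f x hf hx h0.
  by exists (x 0%N); [rewrite lexx|exact: h0].
have d0 (t : R) : derivable f t 1 by exact: (hf 0%N).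
have cf : continuous f by exact: derivable_continuousT.
have /choice[y hy] : forall i : nat, exists y,
    (i <= k)%N -> (x i < y < x i.+1) /\ f^`() y = 0.
  move=> i; have [ik|ki] := leqP i k; last by exists 0.
  have [||c cab [_ dc]] := Rolle (hx i ik) (fun t _ => d0 t).
  - exact: continuous_subspaceT.
  - by rewrite !h0// (leq_trans ik).
  - exists c => _; split; last by rewrite derive1E.
    by move: cab; rewrite in_itv.
have [|||t /andP[yt ty] ht] := IH (f^`()) y.
- by move=> n t nk; rewrite -derive1nSr; exact: hf.
- move=> i ik; have [/andP[_ a] _] := hy i (ltnW ik).
  by have [/andP[b _] _] := hy i.+1 ik; exact: lt_trans b.
- by move=> i ik; have [_] := hy i ik.
exists t; last by rewrite derive1nSr.
have [/andP[a0 _] _] := hy 0%N isT; have [/andP[_ b0] _] := hy k (leqnn k).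
by rewrite (le_trans (ltW a0) yt) (le_trans ty (ltW b0)).
Qed.

(** This form of differentiability survives pointwise limits when the
    estimate is uniform. *)
Lemma is_derive_approx f (a l : R) :
  (forall e, 0 < e -> exists2 d, 0 < d & forall x, `|x - a| < d ->
     `|f x - f a - (x - a) * l| <= e * `|x - a|) ->
  is_derive a 1 f l.
Proof.
move=> h.
suff H : h^-1 *: ((f \o shift a) h%:A - f a) @[h --> (0:R)^'] --> l.
  apply: DeriveDef; first by apply/cvg_ex; exists l.
  exact: (@cvg_lim _ _ _ _ _ _ _ H).
apply/cvgrPdist_le => e e0; have [d d0 hd] := h _ e0.
exists d => //= y /=; rewrite sub0r normrN => yd y0.
rewrite [_%:A]mulr1; have := hd (y + a); rewrite addrK => /(_ yd) H.
rewrite /GRing.scale /=.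
have -> : l - y^-1 * (f (y + a) - f a) = - (y^-1 * (f (y + a) - f a - y * l)).
  by field.
rewrite normrN normrM normfV mulrC ler_pdivrMr ?normr_gt0//.
Qed.

(** The derivative can be computed from one side only, where the function is
    constant. The flag chooses the side. *)
Lemma derive1_one_sided (s : bool) f (c a x : R) :
  (forall y : R, derivable f y 1) ->
  (forall y, (if s then y <= a else a <= y) -> f y = c) ->
  (if s then x <= a else a <= x) -> f^`() x = 0.
Proof.
move=> df fc xa.
have := df x; rewrite /derivable => /cvg_ex[l hl].
have -> : f^`() x = l by rewrite derive1E; exact: (@cvg_lim _ _ _ _ _ _ _ hl).
case: s fc xa => fc xa.
- have hl' : h^-1 *: ((f \o shift x) h%:A - f x) @[h --> (0:R)^'-] --> l.
    apply: cvg_trans hl; apply: cvg_app => P [e e0 he].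
    by exists e => // y ye y0; apply: he => //; rewrite lt_eqF.
  apply/esym; apply: (cvg_unique _ _ hl') => //.
  apply: (@cvg_trans _ ((0 : R) @[h --> (0:R)^'-])); last exact: cvg_cst.
  apply: near_eq_cvg; near=> h.
  rewrite /= !fc ?subrr ?scaler0// [_%:A]mulr1.
  have : h < 0 by near: h; exact: nbhs_left_lt.
  by move: xa; lra.
- have hl' : h^-1 *: ((f \o shift x) h%:A - f x) @[h --> (0:R)^'+] --> l.
    apply: cvg_trans hl; apply: cvg_app => P [e e0 he].
    by exists e => // y ye y0; apply: he => //; rewrite gt_eqF.
  apply/esym; apply: (cvg_unique _ _ hl') => //.
  apply: (@cvg_trans _ ((0 : R) @[h --> (0:R)^'+])); last exact: cvg_cst.
  apply: near_eq_cvg; near=> h.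
  rewrite /= !fc ?subrr ?scaler0// [_%:A]mulr1.
  have : 0 < h by near: h; exact: nbhs_right_gt.
  by move: xa; lra.
Unshelve. all: by end_near. Qed.

Lemma derive1n_one_sided (s : bool) f (c a : R) n : smooth f ->
  (forall y, (if s then y <= a else a <= y) -> f y = c) ->
  forall x, (if s then x <= a else a <= x) -> f^`(n.+1) x = 0.
Proof.
move=> sf fc; elim: n => [|n IH] x xa; rewrite derive1nS.
  exact: (derive1_one_sided (sf 0%N) fc xa).
exact: (derive1_one_sided (sf n.+1) IH xa).
Qed.

End smooth_functions.

(** * A smooth step *)

Section smooth_step.
Context (R : realType).
Implicit Types (p : {poly R}).

(** The functions [p(1/x) e^(-1/x)], extended by 0, are closed under
    derivation, which yields the smoothness of [e^(-1/x)] by induction over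
    all [p] at once. *)
Definition flat p (x : R) : R :=
  if 0 < x then p.[x^-1] * expR (- x^-1) else 0.

(** A quadratic bound at 0 gives derivative 0 there; it follows from the
    boundedness of [y^n e^(-y)]. *)
Lemma flat_bound p : exists2 C : R, 0 <= C & forall x, `|flat p x| <= C * x ^+ 2.
Proof.
suff [C C0 hC] : exists2 C : R, 0 <= C & forall y, 0 < y ->
    `|p.[y]| * y ^+ 2 * expR (- y) <= C.
  exists C => // x; rewrite /flat; case: ifPn => [x0|_]; last first.
    by rewrite normr0 mulr_ge0// sqr_ge0.
  have x20 : 0 < x ^+ 2 by exact: exprn_gt0.
  rewrite -ler_pdivrMr// normrM (ger0_norm (expR_ge0 _)).
  have := hC _ (_ : 0 < x^-1); rewrite invr_gt0 => /(_ x0).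
  by rewrite exprVn mulrAC.
have pow n : forall y : R, 0 < y -> y ^+ n.+1 * expR (- y) <= n.+1`!%:R.
  move=> y y0; rewrite expRN ler_pdivrMr ?expR_gt0//.
  have := expR_ge1Dxn n (ltW y0).
  have f0 : 0 < n.+1`!%:R :> R by rewrite ltr0n fact_gt0.
  rewrite -ler_pdivrMl// mulrC; apply: le_trans.
  by rewrite lerDr ler01.
elim/poly_ind: p => [|p c [C C0 hC]].
  by exists 0 => // y y0; rewrite horner0 normr0 !mul0r.
suff [D D0 hD] : exists2 D : R, 0 <= D & forall y, 0 < y ->
    `|p.[y] * y| * y ^+ 2 * expR (- y) <= D.
  exists (D + `|c| * 2`!%:R); first by rewrite addr_ge0// mulr_ge0.
  move=> y y0; rewrite hornerMXaddC.
  apply: (@le_trans _ _ ((`|p.[y] * y| + `|c|) * y ^+ 2 * expR (- y))).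
    by rewrite ler_wpM2r ?expR_ge0// ler_wpM2r ?sqr_ge0// ler_normD.
  rewrite !mulrDl; apply: lerD; first exact: hD.
  by rewrite -mulrA ler_wpM2l// pow.
clear C C0 hC; elim/poly_ind: p 2%N => [|p d IH] n.
  by exists 0 => // y y0; rewrite horner0 mul0r normr0 !mul0r.
have [D D0 hD] := IH n.+1.
exists (D + `|d| * n.+1`!%:R); first by rewrite addr_ge0// mulr_ge0.
move=> y y0; rewrite hornerMXaddC.
apply: (@le_trans _ _ ((`|p.[y] * y| * y ^+ n.+1 + `|d| * y ^+ n.+1) * expR (- y))).
  rewrite ler_wpM2r ?expR_ge0// exprS.
  have yn : 0 <= y ^+ n by rewrite exprn_ge0// ltW.
  have -> : `|p.[y] * y| * (y * y ^+ n) + `|d| * (y * y ^+ n) =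
    (`|p.[y] * y| + `|d|) * y * y ^+ n by ring.
  rewrite ler_wpM2r// normrM.
  by rewrite (ger0_norm (ltW y0)) ler_wpM2r ?(ltW y0)// ler_normD.
rewrite mulrDl; apply: lerD; first exact: hD.
by rewrite -mulrA ler_wpM2l// pow.
Qed.

Lemma is_derive_flat p (x : R) :
  is_derive x 1 (flat p) (flat ('X ^+ 2 * (p - deriv p)) x).
Proof.
have [x0|x0|x0] := ltgtP x 0.
- rewrite {2}/flat ltNge (ltW x0)/=.
  apply: (@near_eq_is_derive _ _ _ (cst 0)).
    near=> y; rewrite /flat ltNge; suff -> : y <= 0 by [].
    by apply: ltW; near: y; exact: lt_nbhsl.
- rewrite {2}/flat x0.
  apply: (@near_eq_is_derive _ _ _ ((horner p \o (fun y => y^-1)) *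
     (expR \o (fun y => - y^-1)))).
    near=> y; rewrite /flat; have -> : 0 < y by near: y; exact: lt_nbhsr.
    exact: erefl.
  have dV : is_derive x 1 (fun y : R => y^-1) (- (x^-1 ^+ 2)).
    apply: is_derive_eq; first by apply: is_deriveV; rewrite gt_eqF.
    by rewrite /GRing.scale /= mulr1 exprVn.
  have dP : is_derive x 1 (horner p \o (fun y : R => y^-1))
      ((deriv p).[x^-1] * (- (x^-1 ^+ 2))).
    exact: is_derive1_comp.
  have dE : is_derive x 1 (expR \o (fun y : R => - y^-1))
      (expR (- x^-1) * (x^-1 ^+ 2)).
    apply: (@is_derive1_comp _ _ _ _ (expR (- x^-1)) (x^-1 ^+ 2)).
    have := is_deriveN dV; rewrite opprK; exact.
  suff -> : ('X ^+ 2 * (p - deriv p)).[x^-1] * expR (- x^-1) =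
      (horner p \o (fun y => y^-1)) x *: (expR (- x^-1) * (x^-1 ^+ 2)) +
      (expR \o (fun y : R => - y^-1)) x *: ((deriv p).[x^-1] * (- (x^-1 ^+ 2))).
    exact: (is_deriveM dP dE).
  rewrite /GRing.scale /= hornerM hornerXn hornerD hornerN.
  by move: (p.[_]) ((deriv p).[_]) (expR _) (_^-1 ^+ 2) => a b c e; ring.
- rewrite x0 {2}/flat ltxx.
  have [C C0 hC] := flat_bound p.
  apply: is_derive_approx => e e0.
  have C1 : 0 < C + 1 by rewrite ltr_wpDl.
  (* The quadratic bound leaves a factor [|x|], to be made less than [e]. *)
  exists (e / (C + 1)) => [|x1]; first exact: divr_gt0.
  rewrite {2}/flat ltxx !subr0 mulr0 subr0 => x1e.
  apply: (le_trans (hC _)).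
  rewrite -(ger0_norm (sqr_ge0 x1)) expr2 normrM mulrA ler_wpM2r//.
  apply: (@le_trans _ _ (C * (e / (C + 1)))); first by rewrite ler_wpM2l// ltW.
  by rewrite mulrCA -[X in _ <= X]mulr1 ler_wpM2l ?ltW// ltr_pdivrMr// mul1r ltrDl.
Unshelve. all: by end_near. Qed.

Lemma smooth_flat p : smooth (flat p).
Proof.
split=> n; elim: n p => [|n IH] p x.
  by have [] := is_derive_flat p x.
have [_ E] := is_derive_derive1 (is_derive_flat p).
by rewrite derive1nSr E; exact: IH.
Qed.

Lemma flat1_gt0 (x : R) : 0 < x -> 0 < flat 1 x.
Proof. by move=> x0; rewrite /flat x0 hornerE mul1r expR_gt0. Qed.

Lemma flat1_ge0 (x : R) : 0 <= flat 1 x.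
Proof.
rewrite /flat; case: ifPn => // x0.
by rewrite hornerE mul1r expR_ge0.
Qed.

Definition step (x : R) : R := flat 1 x / (flat 1 x + flat 1 (1 - x)).

Lemma step_den_gt0 (x : R) : 0 < flat 1 x + flat 1 (1 - x).
Proof.
have [x0|x0] := ltP 0 x.
  by apply: ltr_wpDr; [exact: flat1_ge0|exact: flat1_gt0].
by apply: ltr_wpDl; [exact: flat1_ge0|apply: flat1_gt0; lra].
Qed.

Lemma step_le0 (x : R) : x <= 0 -> step x = 0.
Proof. by move=> x0; rewrite /step /flat ltNge x0 mul0r. Qed.

Lemma step_ge1 (x : R) : 1 <= x -> step x = 1.
Proof.
move=> x1; have := step_den_gt0 x; rewrite /step.
have -> : flat 1 (1 - x) = 0 by rewrite /flat ifN// -leNgt; lra.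
by rewrite addr0 => h; rewrite divff// gt_eqF.
Qed.

Lemma smooth_step : smooth step.
Proof.
have -> : step = flat 1 * (fun x => (flat 1 x + flat 1 (1 - x))^-1) by [].
apply: smoothM; first exact: smooth_flat.
apply: smoothV => [x|]; first by rewrite gt_eqF// step_den_gt0.
have -> : (fun x => flat 1 x + flat 1 (1 - x)) =
   flat 1 + (fun x => flat 1 (- 1 * x + 1)).
  by apply/funext => x; congr (_ + flat 1 _); rewrite mulN1r addrC.
apply: smoothD; first exact: smooth_flat.
by have [] := smooth_affine (-1) 1 (@smooth_flat 1).
Qed.

Lemma step_bounded n : exists2 K : R, 0 <= K & forall x, `|step^`(n) x| <= K.
Proof.
have cont : {within `[0, 1 : R], continuous (step^`(n))}.
  apply: continuous_subspaceT; apply: smooth_continuous.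
  by apply: smooth_derive1n; exact: smooth_step.
have [M [_ hM]] := compact_bounded (continuous_compact cont (@segment_compact _ _ _)).
exists (`|M| + 1) => [|x]; first by rewrite addr_ge0.
have b01 y : 0 <= y <= 1 -> `|step^`(n) y| <= `|M| + 1.
  move=> y01; apply: (hM (`|M| + 1)); first by rewrite (le_lt_trans (ler_norm _))// ltrDl.
  by exists y => //=; rewrite in_itv.
have [x0|x0] := leP x 0; last have [x1|x1] := leP 1 x; last 1 first.
- by apply: b01; rewrite !ltW.
- case: n cont hM b01 => [|n] cont hM b01.
    by have := b01 0; rewrite lexx ler01 derive1n0 !step_le0//; apply.
  rewrite (derive1n_one_sided (s := true) n smooth_step step_le0 x0).
  by rewrite normr0 addr_ge0.
- case: n cont hM b01 => [|n] cont hM b01.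
    by have := b01 1; rewrite lexx ler01 derive1n0 !step_ge1//; apply.
  rewrite (derive1n_one_sided (s := false) n smooth_step step_ge1 x1).
  by rewrite normr0 addr_ge0.
Qed.

End smooth_step.

(** * Divided differences and Newton polynomials *)

Section divided_differences.
Context (R : realType).
Variables (x : nat -> R).
Implicit Types (y : nat -> R).

Fixpoint ddiff y k i : R :=
  if k is k'.+1 then (ddiff y k' i.+1 - ddiff y k' i) / (x (i + k'.+1)%N - x i)
  else y i.

Arguments ddiff : simpl never.

Definition nodal i k : {poly R} := \prod_(j < k) ('X - (x (i + j)%N)%:P).

Definition newton y m i : {poly R} := \sum_(k < m) (ddiff y k i)%:P * nodal i k.

Lemma nodal0 i : nodal i 0 = 1.
Proof. by rewrite /nodal big_ord0. Qed.

Lemma nodalSr i k : nodal i k.+1 = nodal i k * ('X - (x (i + k)%N)%:P).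
Proof. by rewrite /nodal big_ord_recr. Qed.

Lemma nodalSl i k : nodal i k.+1 = ('X - (x i)%:P) * nodal i.+1 k.
Proof.
rewrite /nodal big_ord_recl addn0; congr (_ * _).
by apply: eq_bigr => j _; rewrite /= /bump leq0n add1n addnS addSn.
Qed.

Lemma size_nodal i k : size (nodal i k) = k.+1.
Proof. by rewrite /nodal size_prod_XsubC /index_enum -enumT size_enum_ord. Qed.

Lemma size_newton y m i : (size (newton y m i) <= m)%N.
Proof.
apply: (leq_trans (size_sum _ _ _)); apply/bigmax_leqP => k _.
rewrite mul_polyC (leq_trans (size_scale_leq _ _))// size_nodal.
exact: ltn_ord.
Qed.

Lemma nodal_root i k j : (j < k)%N -> (nodal i k).[x (i + j)%N] = 0.
Proof.
by move=> jk; rewrite /nodal horner_prod (bigD1 (Ordinal jk))//= !hornerE subrr mul0r.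
Qed.

Hypothesis xlt : forall i, x i < x i.+1.

Lemma nodes_lt i j : (i < j)%N -> x i < x j.
Proof. exact: (homo_ltn lt_trans). Qed.

Lemma nodes_le i j : (i <= j)%N -> x i <= x j.
Proof. by rewrite leq_eqVlt => /predU1P[->//|/nodes_lt/ltW]. Qed.

(** Unlike the definition, this form needs no division. *)
Lemma ddiffS y k i : (x (i + k.+1)%N - x i) * ddiff y k.+1 i =
  ddiff y k i.+1 - ddiff y k i.
Proof.
rewrite /= mulrC divfK// subr_eq0 gt_eqF// nodes_lt//.
by rewrite addnS ltnS leq_addr.
Qed.

(** Both polynomials interpolate the same values at the common nodes, so the
    nodal polynomial of these nodes divides the difference. *)
Lemma newton_shift y m i : newton y m.+1 i.+1 - newton y m.+1 i =
  ((x (i + m.+1)%N - x i) * ddiff y m.+1 i)%:P * nodal i.+1 m.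
Proof.
elim: m => [|m IH].
  rewrite /newton !big_ord1 !nodal0 !mulr1 -polyCB; congr (_%:P).
  by rewrite ddiffS.
have -> : newton y m.+2 i.+1 - newton y m.+2 i =
  (newton y m.+1 i.+1 - newton y m.+1 i) +
  (ddiff y m.+1 i.+1)%:P * nodal i.+1 m.+1 - (ddiff y m.+1 i)%:P * nodal i m.+1.
  by rewrite /newton ![\sum_(_ < m.+2) _]big_ord_recr /=; ring.
rewrite IH (nodalSl i) (nodalSr i.+1) (ddiffS y m.+1 i) !polyCB polyCM polyCB.
rewrite addSn addnS; move: (ddiff _ _ _)%:P (ddiff _ _ _)%:P => d d'.
by ring.
Qed.

Lemma newton_interp y m i j : (j <= m)%N -> (newton y m.+1 i).[x (i + j)%N] = y (i + j)%N.
Proof.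
elim: j i => [|j IH] i jm.
  rewrite addn0 /newton big_ord_recl nodal0 mulr1 hornerD hornerC /=.
  rewrite horner_sum big1 ?addr0// => k _.
  have := @nodal_root i (bump 0 k) 0 isT; rewrite addn0 hornerM => ->.
  by rewrite mulr0.
have -> : newton y m.+1 i = newton y m.+1 i.+1 -
    ((x (i + m.+1)%N - x i) * ddiff y m.+1 i)%:P * nodal i.+1 m.
  by rewrite -newton_shift opprB addrC subrK.
rewrite hornerD hornerN hornerM addnS -addSn IH; last exact: ltnW.
by rewrite nodal_root// mulr0 subr0.
Qed.

Lemma ddiffD y z k i : ddiff (fun j => y j + z j) k i = ddiff y k i + ddiff z k i.
Proof.
elim: k i => // k IH i; rewrite /ddiff -/ddiff !IH -mulrDl; congr (_ / _); ring.
Qed.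

Lemma ddiffZ (a : R) y k i : ddiff (fun j => a * y j) k i = a * ddiff y k i.
Proof. by elim: k i => // k IH i; rewrite /ddiff -/ddiff !IH mulrA -mulrBr. Qed.

Lemma eq_ddiff y z k i : (forall j, (i <= j <= i + k)%N -> y j = z j) ->
  ddiff y k i = ddiff z k i.
Proof.
elim: k i => [|k IH] i h; first by apply: h; rewrite addn0 leqnn.
rewrite /ddiff -/ddiff; congr ((_ - _) / _); apply: IH => j /andP[a b]; apply: h.
  by rewrite (ltnW a) -addSnnS.
by rewrite a addnS (leq_trans b).
Qed.

Lemma ddiff_0 k i : ddiff (fun=> 0) k i = 0.
Proof. by elim: k i => // k IH i; rewrite /ddiff -/ddiff !IH subrr mul0r. Qed.

End divided_differences.

#[global] Arguments ddiff : simpl never.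

(** * The smooth interpolant and its derivatives *)

Section interpolant.
Context (R : realType).
Variables (x : nat -> R) (m' : nat).
Let m := m'.+1.
Hypothesis xlt : forall i, x i < x i.+1.
Implicit Types (y : nat -> R).

(** The largest of the [m] gaps is at least the mean gap. A step placed on
    it has derivatives of the order of the inverse powers of the whole span,
    however close the other nodes are. *)
Lemma large_gap i : exists q, [/\ (i <= q)%N, (q < i + m)%N &
  x (i + m)%N - x i <= m%:R * (x q.+1 - x q)].
Proof.
suff H k : exists2 q, (i <= q < i + k.+1)%N &
    x (i + k.+1)%N - x i <= k.+1%:R * (x q.+1 - x q).
  by have [q /andP[iq qm] h] := H m'; exists q.
elim: k => [|k [q /andP[iq qm] h]].
  by exists i; rewrite addn1 ?leqnn ?ltnSn// mul1r.
have [hq|hq] := leP (x (i + k.+1).+1 - x (i + k.+1)%N) (x q.+1 - x q).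
  exists q; first by rewrite iq addnS ltnS ltnW.
  rewrite -(natr1 k.+1) mulrDl mul1r addnS.
  have -> : x (i + k.+1).+1 - x i = (x (i + k.+1)%N - x i) + (x (i + k.+1).+1 - x (i + k.+1)%N) by ring.
  exact: lerD.
exists (i + k.+1)%N; first by rewrite leq_addr (addnS i k.+1) ltnS leqnn.
rewrite -(natr1 k.+1) mulrDl mul1r addnS.
have -> : x (i + k.+1).+1 - x i = (x (i + k.+1)%N - x i) + (x (i + k.+1).+1 - x (i + k.+1)%N) by ring.
rewrite lerD2r; apply: (le_trans h); rewrite ler_wpM2l//; exact: ltW.
Qed.

Definition gap_index i := projT1 (cid (large_gap i)).

Definition gap i := x (gap_index i).+1 - x (gap_index i).

(** A smooth step that rises on the selected gap. It is written as a
    composition with an affine map so that its derivatives are explicit. *)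
Definition cutoff i (t : R) := step ((gap i)^-1 * t + (- x (gap_index i) / gap i)).

Lemma gap_indexP i : [/\ (i <= gap_index i)%N, (gap_index i < i + m)%N &
  x (i + m)%N - x i <= m%:R * gap i].
Proof. by rewrite /gap /gap_index; case: cid. Qed.

Lemma gap_gt0 i : 0 < gap i.
Proof. by rewrite subr_gt0. Qed.

Lemma span_gt0 i : 0 < x (i + m)%N - x i.
Proof. by rewrite subr_gt0 nodes_lt// -addSnnS leq_addr. Qed.

Lemma cutoffE i t : cutoff i t = step ((t - x (gap_index i)) / gap i).
Proof. by rewrite /cutoff; congr step; ring. Qed.

Lemma cutoff_lo i t : t <= x i -> cutoff i t = 0.
Proof.
move=> ti; rewrite cutoffE step_le0//; have [iq _ _] := gap_indexP i.
by rewrite ler_pdivrMr ?gap_gt0// mul0r subr_le0 (le_trans ti)// nodes_le.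
Qed.

Lemma cutoff_hi i t : x (i + m)%N <= t -> cutoff i t = 1.
Proof.
move=> ti; rewrite cutoffE step_ge1//; have [_ qi _] := gap_indexP i.
rewrite ler_pdivlMr ?gap_gt0// mul1r /gap lerD2r (le_trans _ ti)//.
exact: nodes_le.
Qed.

Lemma smooth_cutoff i : smooth (cutoff i).
Proof. by have [] := smooth_affine (gap i)^-1 (- x (gap_index i) / gap i) (@smooth_step R). Qed.

Lemma cutoff_jet (K : R) r i t : (forall s, `|(@step R)^`(r) s| <= K) ->
  `|(cutoff i)^`(r) t| <= K * (m%:R / (x (i + m)%N - x i)) ^+ r.
Proof.
move=> hK.
have [_ ->] := smooth_affine (gap i)^-1 (- x (gap_index i) / gap i) (@smooth_step R).
change (`|(gap i)^-1 ^+ r *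
  derive1n r (@step R) ((gap i)^-1 * t + - x (gap_index i) / gap i)| <=
  K * (m%:R / (x (i + m)%N - x i)) ^+ r).
rewrite normrM mulrC normrX.
apply: ler_pM; [exact: normr_ge0|by rewrite exprn_ge0|exact: hK|].
have L0 := span_gt0 i.
rewrite lerXn2r ?nnegrE// ?divr_ge0 ?(ltW L0)//.
rewrite gtr0_norm ?invr_gt0 ?gap_gt0// ler_pdivlMr// ler_pdivrMl ?gap_gt0//.
by have [_ _] := gap_indexP i; rewrite mulrC.
Qed.

(** Each linear factor satisfies a geometric bound with ratio [1 / W], and
    the ratios add up in products. *)
Lemma nodal_jet (W : R) i k t r : 0 < W ->
  (forall j, (j < k)%N -> `|t - x (i + j)%N| <= W) ->
  `|(horner (nodal x i k))^`(r) t| <= W ^+ k * (k%:R / W) ^+ r.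
Proof.
move=> W0; elim: k r => [|k IH] r h.
  rewrite nodal0 expr0 mul1r mul0r; case: r => [|r].
    by rewrite derive1n0 hornerE normr1 expr0.
  by rewrite derive1n_horner derivnC hornerE normr0 exprn_ge0.
have -> : horner (nodal x i k.+1) =
    horner (nodal x i k) * horner ('X - (x (i + k)%N)%:P).
  by apply/funext => s; rewrite nodalSr hornerM.
rewrite exprSr -natr1 mulrDl mul1r.
apply: derive1nM_bound; [exact: smooth_horner|exact: smooth_horner| |].
  by move=> s _; apply: IH => j jk; apply: h; exact: ltnW.
move=> [|[|s]] _; rewrite derive1n_horner.
- by rewrite derivn0 hornerXsubC expr0 mulr1; exact: h.
- by rewrite derivn1 derivXsubC hornerE normr1 expr1 mulfV// gt_eqF.
- rewrite 2!derivSn derivXsubC derivC linear0 horner0 normr0.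
  by rewrite mulr_ge0 ?exprn_ge0 ?invr_ge0// ltW.
Qed.

Definition piece y i : R -> R := horner (newton x y m i.+1 - newton x y m i).

(** Telescoping: where the first steps have reached 1 and the others are
    still 0, the sum is a single Newton polynomial. It starts from 0 because
    the first [m] values vanish. *)
Definition interpolant n y : R -> R := \sum_(i < n) (piece y i * cutoff i).

Lemma pieceE y i : piece y i =
  ((x (i + m)%N - x i) * ddiff x y m i) *: horner (nodal x i.+1 m').
Proof. by apply/funext => t; rewrite /piece newton_shift// hornerM hornerC. Qed.

Lemma smooth_piece y i : smooth (piece y i).
Proof. exact: smooth_horner. Qed.

Lemma smooth_interpolant n y : smooth (interpolant n y).
Proof.
by apply: smooth_sum => i; apply: smoothM; [exact: smooth_piece|exact: smooth_cutoff].
Qed.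

Lemma sum_pieces y a b : (a <= b)%N ->
  \sum_(a <= i < b) piece y i = horner (newton x y m b - newton x y m a).
Proof.
move=> ab; apply/funext => t.
rewrite fct_sumE.
under eq_bigr do rewrite /piece hornerD hornerN.
by rewrite (telescope_sumr (fun i => (newton x y m i).[t]))// hornerD hornerN.
Qed.

Lemma newton_0 y q : (forall j, (q <= j < q + m)%N -> y j = 0) -> newton x y m q = 0.
Proof.
move=> h; apply: big1 => k _; rewrite (@eq_ddiff _ x y (fun=> 0)).
  by rewrite ddiff_0 mul0r.
move=> j /andP[qj jk]; apply: h; rewrite qj/= (leq_ltn_trans jk)//.
by rewrite ltn_add2l.
Qed.

(** At a node the step of every piece that does not vanish there is already
    0 or 1, so the sum telescopes to a Newton polynomial through that node. *)
Lemma interpolantP n y j : (forall j, (j < m)%N -> y j = 0) -> (j <= n)%N ->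
  interpolant n y (x j) = y j.
Proof.
move=> y0 jn; rewrite /interpolant fct_sumE.
have -> : \sum_(i < n) (piece y i * cutoff i) (x j) = \sum_(0 <= i < j) piece y i (x j).
  rewrite -(big_mkord xpredT (fun i => (piece y i * cutoff i) (x j))).
  rewrite (@big_cat_nat _ _ _ j)//= [X in _ + X]big_nat_cond [X in _ + X]big1 ?addr0.
    apply: eq_big_nat => i /andP[_ ij].
    change (piece y i (x j) * cutoff i (x j) = piece y i (x j)).
    have [ji|ji] := leqP (i + m) j; first by rewrite cutoff_hi ?mulr1// nodes_le.
    rewrite pieceE; change ((x (i + m)%N - x i) * ddiff x y m i * (nodal x i.+1 m').[x j] * cutoff i (x j) =
     (x (i + m)%N - x i) * ddiff x y m i * (nodal x i.+1 m').[x j]).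
    have -> : j = (i.+1 + (j - i.+1))%N by rewrite subnKC.
    rewrite nodal_root ?mulr0 ?mul0r//.
    by rewrite ltn_subLR// addSn -addnS.
  move=> i /andP[/andP[ji _] _].
  change (piece y i (x j) * cutoff i (x j) = 0).
  by rewrite cutoff_lo ?mulr0// nodes_le.
have -> : \sum_(0 <= i < j) piece y i (x j) = (\sum_(0 <= i < j) piece y i) (x j).
  by rewrite fct_sumE.
rewrite sum_pieces// (@newton_0 y 0) ?subr0//.
have := @newton_interp _ _ xlt y m' j 0 (leq0n m'); rewrite addn0.
exact.
Qed.

Lemma cutoff_jet_lo i t r : t <= x i -> (cutoff i)^`(r) t = 0.
Proof.
move=> ti; case: r => [|r]; first exact: cutoff_lo.
exact: (derive1n_one_sided (s := true) r (smooth_cutoff i) (@cutoff_lo i) ti).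
Qed.

Lemma cutoff_jet_hi i t r : x (i + m)%N <= t -> (cst 1 - cutoff i)^`(r) t = 0.
Proof.
move=> ti; rewrite derive1nB; [|exact: smooth_cst|exact: smooth_cutoff].
case: r => [|r]; first by change (1 - cutoff i t = 0); rewrite cutoff_hi// subrr.
change (derive1n r.+1 (cst 1 : R -> R) t - derive1n r.+1 (cutoff i) t = 0).
rewrite derive1n_cst; change (0 - derive1n r.+1 (cutoff i) t = 0).
by rewrite (derive1n_one_sided (s := false) r (smooth_cutoff i) (@cutoff_hi i) ti) subrr.
Qed.

Lemma jet_mul0 (f g : R -> R) t r : smooth f -> smooth g ->
  (forall k, g^`(k) t = 0) -> (f * g)^`(r) t = 0.
Proof.
elim: r f g => [|r IH] f g sf sg h.
  by change (f t * g t = 0); have := h 0%N; rewrite derive1n0 => ->; rewrite mulr0.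
rewrite derive1nSr derive1_mul; [|by move=> s; exact: smooth_derivable..].
have sf' := smooth_derive sf; have sg' := smooth_derive sg.
rewrite derive1nD; [|by apply: smoothM..].
change (derive1n r (derive1 f * g) t + derive1n r (f * derive1 g) t = 0).
by rewrite !IH ?addr0// => k; rewrite -derive1nSr.
Qed.

(** To the left of [t] the steps are 1 with all their derivatives, so these
    pieces telescope; to the right they are 0. At most [m] pieces are left
    in between. *)
Lemma interpolant_local n y l t s : x l <= t -> t <= x l.+1 ->
  (forall j, (j < m)%N -> y j = 0) ->
  (interpolant n y)^`(s) t =
    derive1n s (horner (newton x y m (minn n (l.+1 - m)))) t +
    \sum_(minn n (l.+1 - m) <= i < minn n l.+1) derive1n s (piece y i * cutoff i) t.
Proof.
move=> lt tl y0.
pose q := minn n (l.+1 - m); pose p := minn n l.+1.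
have qp : (q <= p)%N by rewrite /q /p leq_min geq_minl/= (leq_trans (geq_minr _ _))// leq_subr.
have pn : (p <= n)%N by rewrite geq_minl.
have sP i : smooth (piece y i * cutoff i).
  by apply: smoothM; [exact: smooth_piece|exact: smooth_cutoff].
rewrite /interpolant derive1n_sum// fct_sumE.
rewrite -(big_mkord xpredT (fun i => derive1n s (piece y i * cutoff i) t)).
rewrite (@big_cat_nat _ _ _ p)//= (@big_cat_nat _ _ _ q _ p)//=.
rewrite [X in _ + X]big_nat_cond [X in _ + X]big1 ?addr0; last first.
  move=> i /andP[/andP[pi ni] _]; apply: jet_mul0; [exact: smooth_piece|exact: smooth_cutoff|].
  move=> k; apply: cutoff_jet_lo; apply: (le_trans tl); apply: nodes_le => //.
  by move: pi; rewrite /p geq_min leqNgt ni.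
congr (_ + _); rewrite -/q.
transitivity (\sum_(0 <= i < q) derive1n s (piece y i) t).
  apply: eq_big_nat => i /andP[_ iq].
  (* Exhibit a second factor all of whose derivatives vanish at [t]. *)
  have -> : piece y i * cutoff i = piece y i - piece y i * (cst 1 - cutoff i).
    apply/funext => u; change (piece y i u * cutoff i u =
      piece y i u - piece y i u * (1 - cutoff i u)); ring.
  have s1 : smooth (cst 1 - cutoff i).
    by apply: smoothD; [exact: smooth_cst|apply: smoothN; exact: smooth_cutoff].
  rewrite derive1nB; [|exact: smooth_piece|by apply: smoothM; [exact: smooth_piece|]].
  change (derive1n s (piece y i) t - derive1n s (piece y i * (cst 1 - cutoff i)) t =
    derive1n s (piece y i) t).
  rewrite -[RHS]subr0; congr (_ - _).
  apply: jet_mul0; [exact: smooth_piece|exact: s1|].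
  move=> k; apply: cutoff_jet_hi; apply: (le_trans _ lt); apply: nodes_le => //.
  move: iq; rewrite /q leq_min => /andP[_]; rewrite ltn_subRL -ltnS addnC.
  by rewrite addnS.
have -> : \sum_(0 <= i < q) derive1n s (piece y i) t =
    (\sum_(0 <= i < q) derive1n s (piece y i)) t by rewrite fct_sumE.
rewrite -derive1n_sum; last by move=> i; exact: smooth_piece.
by rewrite sum_pieces// (@newton_0 y 0) ?subr0.
Qed.

(** All factors live on the scale [L] of the span: the polynomial is of size
    [L^m] times the divided difference, and each derivative costs [1 / L]. *)
Lemma piece_cutoff_jet (K : R) y i t s :
  (forall r u, (r <= m)%N -> `|(@step R)^`(r) u| <= K) ->
  x i <= t -> t <= x (i + m)%N -> (s <= m)%N ->
  `|derive1n s (piece y i * cutoff i) t| <=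
    K * (m' + m)%:R ^+ m * (`|ddiff x y m i| * (x (i + m)%N - x i) ^+ (m - s)).
Proof.
move=> hK it ti sm.
have L0 := span_gt0 i; set L := x (i + m)%N - x i in L0 *.
have K0 : 0 <= K by apply: le_trans (hK 0%N 0 isT); exact: normr_ge0.
have h := @derive1nM_bound R (piece y i) (cutoff i) t (L * `|ddiff x y m i| * L ^+ m') K
   (m'%:R / L) (m%:R / L) s (smooth_piece y i) (smooth_cutoff i).
apply: (le_trans (h _ _)).
- move=> k km; rewrite pieceE derive1nZ; last exact: smooth_horner.
  change (`|L * ddiff x y m i * derive1n k (horner (nodal x i.+1 m')) t| <=
     L * `|ddiff x y m i| * L ^+ m' * (m'%:R / L) ^+ k).
  rewrite normrM normrM (gtr0_norm L0) -[_ * (m'%:R / L) ^+ k]mulrA.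
  apply: ler_wpM2l; first by rewrite mulr_ge0// ltW.
  apply: nodal_jet => // j jm.
  have a1 : x i <= x (i.+1 + j)%N by apply: nodes_le => //; rewrite addSnnS leq_addr.
  have a2 : x (i.+1 + j)%N <= x (i + m)%N.
    by apply: nodes_le => //; rewrite addSnnS leq_add2l ltnW.
  by rewrite ler_norml /L; apply/andP; split; lra.
- by move=> k ks; apply: cutoff_jet => // u; apply: hK; apply: leq_trans sm.
have -> : L * `|ddiff x y m i| * L ^+ m' * K = K * (`|ddiff x y m i| * L ^+ m).
  by rewrite (exprS L m'); ring.
rewrite -mulrDl -natrD expr_div_n -mulrA -mulrA; apply: ler_wpM2l => //.
have -> : L ^+ m = L ^+ (m - s) * L ^+ s by rewrite -exprD subnK.
have -> : `|ddiff x y m i| * (L ^+ (m - s) * L ^+ s) * ((m' + m)%:R ^+ s / L ^+ s) =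
  (m' + m)%:R ^+ s * (`|ddiff x y m i| * L ^+ (m - s)).
  by field; rewrite expf_neq0// gt_eqF.
apply: ler_wpM2r; first by rewrite mulr_ge0// exprn_ge0// ltW.
have : 1 <= (m' + m)%:R :> R by rewrite ler1n addnS.
by move=> h1; exact: ler_weXn2l.
Qed.

Lemma newton_jet (W B : R) y q t s : 1 <= W -> 0 <= B ->
  (forall j, (j < m)%N -> `|t - x (q + j)%N| <= W) ->
  (forall k, (k < m)%N -> `|ddiff x y k q| <= B) ->
  `|derive1n s (horner (newton x y m q)) t| <= m%:R * (W ^+ m * m%:R ^+ s) * B.
Proof.
move=> W1 B0 hW hB.
have W0 : 0 < W by exact: lt_le_trans W1.
have -> : horner (newton x y m q) = \sum_(k < m) (ddiff x y k q *: horner (nodal x q k)).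
  apply/funext => u; rewrite /newton horner_sum fct_sumE.
  by apply: eq_bigr => k _; rewrite hornerM hornerC.
rewrite derive1n_sum; last by move=> k; apply: smoothZ; exact: smooth_horner.
rewrite fct_sumE; apply: (le_trans (ler_norm_sum _ _ _)).
have -> : m%:R * (W ^+ m * m%:R ^+ s) * B = \sum_(k < m) (W ^+ m * m%:R ^+ s * B).
  by rewrite sumr_const card_ord -[RHS]mulr_natl !mulrA.
apply: ler_sum => k _; rewrite derive1nZ; last exact: smooth_horner.
change (`|ddiff x y k q * derive1n s (horner (nodal x q k)) t| <= W ^+ m * m%:R ^+ s * B).
rewrite normrM mulrC; apply: ler_pM => //; last exact: hB.
apply: (@le_trans _ _ (W ^+ k * (k%:R / W) ^+ s)).
  by apply: nodal_jet => // j jk; apply: hW; exact: ltn_trans (ltn_ord k).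
apply: ler_pM; [by rewrite exprn_ge0// ltW|by rewrite exprn_ge0// divr_ge0// ltW| |].
  by apply: ler_weXn2l => //; exact: ltnW (ltn_ord k).
apply: lerXn2r; rewrite ?nnegrE ?divr_ge0 ?(ltW W0)//.
rewrite ler_pdivrMr//; apply: (@le_trans _ _ (m%:R * 1)).
  by rewrite mulr1 ler_nat ltnW.
exact: ler_wpM2l.
Qed.

Section local_bounds.
Variables (W K : R) (n l : nat) (y : nat -> R) (t : R).
Hypothesis W1 : 1 <= W.
Hypothesis hK : forall r u, (r <= m)%N -> `|(@step R)^`(r) u| <= K.
Hypothesis y_lo : forall j, (j < m)%N -> y j = 0.
Hypothesis y_hi : forall j, (n <= j)%N -> y j = 0.
Hypothesis lt : x l <= t.
Hypothesis tl : t <= x l.+1.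
Hypothesis hW : forall i, (i <= l)%N -> (l < i + m)%N -> x (i + m)%N - x i <= W.

Let hsum s : (s <= m)%N ->
  `|derive1n s (interpolant n y) t| <=
    `|derive1n s (horner (newton x y m (minn n (l.+1 - m)))) t| +
    \sum_(l.+1 - m <= i < l.+1)
      (K * (m' + m)%:R ^+ m * (`|ddiff x y m i| * (x (i + m)%N - x i) ^+ (m - s))).
Proof.
move=> sm; rewrite (interpolant_local n s lt tl y_lo).
have K0 : 0 <= K by apply: le_trans (@hK 0%N 0 isT); exact: normr_ge0.
have pos i : 0 <= K * (m' + m)%:R ^+ m * (`|ddiff x y m i| * (x (i + m)%N - x i) ^+ (m - s)).
  by rewrite !mulr_ge0 ?exprn_ge0// ltW// span_gt0.
apply: (le_trans (ler_normD _ _)); rewrite lerD2l.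
have [nl|ln] := ltnP n (l.+1 - m).
  rewrite big_geq; last by rewrite geq_minl.
  by rewrite normr0 sumr_ge0.
apply: (le_trans (ler_norm_sum _ _ _)).
have pl : (minn n l.+1 <= l.+1)%N by rewrite geq_minr.
have qp : (l.+1 - m <= minn n l.+1)%N by rewrite leq_min ln leq_subr.
rewrite [X in _ <= X](@big_cat_nat _ _ _ (minn n l.+1))//=.
apply: ler_wpDr; first by apply: sumr_ge0.
rewrite big_nat_cond [X in _ <= X]big_nat_cond; apply: ler_sum => i.
rewrite andbT leq_min => /andP[qi /andP[_ il]].
apply: piece_cutoff_jet => //.
  by apply: le_trans lt; apply: nodes_le.
apply: (le_trans tl); apply: nodes_le => //.
by move: qi; rewrite leq_subLR addnC.
Qed.

(** For [s < m] one power of the span is left over. It turns the divided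
    difference of order [m] into a difference of two of order [m - 1]. *)
Lemma interpolant_jet_lo (B : R) s : (s < m)%N ->
  (forall k j, (k < m)%N -> (l.+1 - m <= j <= l.+1)%N -> `|ddiff x y k j| <= B) ->
  `|derive1n s (interpolant n y) t| <=
    (m%:R * (W ^+ m * m%:R ^+ m) + m%:R * (K * (m' + m)%:R ^+ m * (2 * W ^+ m))) * B.
Proof.
move=> sm hB; apply: (le_trans (hsum (ltnW sm))).
have W0 : 0 < W by exact: lt_le_trans W1.
have K0 : 0 <= K by apply: le_trans (@hK 0%N 0 isT); exact: normr_ge0.
have B0 : 0 <= B.
  by apply: le_trans (hB 0 l.+1 isT _); rewrite ?normr_ge0// leqnn leq_subr.
rewrite mulrDl; apply: lerD.
- apply: (@le_trans _ _ (m%:R * (W ^+ m * m%:R ^+ s) * B)); last first.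
    rewrite ler_wpM2r// ler_wpM2l// ler_wpM2l ?exprn_ge0 ?(ltW W0)//.
    by apply: ler_weXn2l; [rewrite ler1n|exact: ltnW].
  have [nl|ln] := leqP n (l.+1 - m).
    rewrite newton_0; last first.
      by move=> j /andP[nj _]; exact: y_hi.
    rewrite derive1n_horner linear0 horner0 normr0.
    by rewrite !mulr_ge0 ?exprn_ge0 ?(ltW W0).
  have [lm|ml] := leqP l.+1 m.
    rewrite newton_0; last first.
      by move=> j; move: lm; rewrite -subn_eq0 => /eqP -> /andP[_ jm]; exact: y_lo.
    rewrite derive1n_horner linear0 horner0 normr0.
    by rewrite !mulr_ge0 ?exprn_ge0 ?(ltW W0).
  apply: newton_jet => // [j jm|k km]; last by apply: hB => //; rewrite leqnn leq_subr.
  have e : (l.+1 - m + m)%N = l.+1 by rewrite subnK// ltnW.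
  have LW : x l.+1 - x (l.+1 - m)%N <= W.
    by have := @hW (l.+1 - m)%N; rewrite e; apply; rewrite ?ltnSn// -ltnS ltn_subrL.
  have a1 : x (l.+1 - m)%N <= x (l.+1 - m + j)%N by apply: nodes_le => //; rewrite leq_addr.
  have a2 : x (l.+1 - m + j)%N <= x l.
    by apply: nodes_le => //; rewrite -ltnS -[X in (_ < X)%N]e ltn_add2l.
  move: (x (l.+1 - m)%N) (x (l.+1 - m + j)%N) LW a1 a2 => a b LW ab bl.
  by rewrite ler_norml; apply/andP; split; move: lt tl; lra.
- have -> : m%:R * (K * (m' + m)%:R ^+ m * (2 * W ^+ m)) * B =
      m%:R * (K * (m' + m)%:R ^+ m * (2 * W ^+ m * B)) by ring.
  apply: (@le_trans _ _ (\sum_(l.+1 - m <= i < l.+1) (K * (m' + m)%:R ^+ m * (2 * W ^+ m * B)))).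
    rewrite big_nat_cond [X in _ <= X]big_nat_cond; apply: ler_sum => i.
    rewrite andbT => /andP[qi il]; apply: ler_wpM2l; first by rewrite mulr_ge0// exprn_ge0.
    have L0 := span_gt0 i.
    have LW : x (i + m)%N - x i <= W by apply: hW => //; move: qi; rewrite leq_subLR addnC.
    have -> : (m - s)%N = (m - s.+1).+1 by rewrite subnSK.
    have dE : `|ddiff x y m i| * (x (i + m)%N - x i) = `|ddiff x y m' i.+1 - ddiff x y m' i|.
      rewrite -[X in _ * X](gtr0_norm L0) mulrC -normrM; congr `| _ |.
      exact: (ddiffS xlt).
    rewrite exprS mulrA dE.
    have -> : 2 * W ^+ m * B = (2 * B) * W ^+ m by ring.
    apply: ler_pM => //.
    + by rewrite exprn_ge0// ltW.
    + have -> : 2 * B = B + B by ring.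
      apply: (le_trans (ler_normB _ _)); apply: lerD; apply: hB => //.
        by rewrite (leq_trans qi)// ltnS il.
      by rewrite qi ltnW.
    + apply: (@le_trans _ _ (W ^+ (m - s.+1))).
        by apply: lerXn2r; rewrite ?nnegrE ?(ltW L0) ?(ltW W0).
      by apply: ler_weXn2l => //; rewrite leq_subr.
  rewrite sumr_const_nat -[X in X <= _]mulr_natl ler_wpM2r//.
    by rewrite !mulr_ge0 ?exprn_ge0// ltW.
  by rewrite ler_nat leq_subCl.
Qed.

(** The Newton polynomial has degree less than [m] and disappears. *)
Lemma interpolant_jet_hi :
  `|derive1n m (interpolant n y) t| <=
    K * (m' + m)%:R ^+ m * \sum_(l.+1 - m <= i < l.+1) `|ddiff x y m i|.
Proof.
apply: (le_trans (hsum (leqnn m))).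
rewrite derive1n_horner derivn_poly0; last exact: size_newton.
rewrite horner0 normr0 add0r mulr_sumr; apply: ler_sum => i _.
by rewrite subnn expr0 mulr1.
Qed.

End local_bounds.

(** With [2m] vanishing values at the start, the pieces whose steps act to
    the left of [x m] are zero. Hence every point where the interpolant is
    nonzero has [m] nodes before it. *)
Lemma interpolant_left n y t s : t < x m -> (forall j, (j < (m + m))%N -> y j = 0) ->
  derive1n s (interpolant n y) t = 0.
Proof.
move=> tx y0; rewrite /interpolant derive1n_sum; last first.
  by move=> i; apply: smoothM; [exact: smooth_piece|exact: smooth_cutoff].
rewrite fct_sumE big1// => i _; have [im|mi] := ltnP i m.
  have -> : piece y i = cst 0.
    apply/funext => u; rewrite pieceE (@eq_ddiff _ x y (fun=> 0)).
      by rewrite ddiff_0 mulr0 scale0r.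
    move=> j /andP[_ ji]; apply: y0; apply: (leq_ltn_trans ji).
    by rewrite ltn_add2r.
  have -> : cst 0 * cutoff i = cst 0.
    by apply/funext => u; change (0 * cutoff i u = 0); rewrite mul0r.
  by case: s => [|s]; rewrite ?derive1n_cst.
apply: jet_mul0; [exact: smooth_piece|exact: smooth_cutoff|].
move=> k; apply: cutoff_jet_lo; apply: (le_trans (ltW tx)); exact: nodes_le.
Qed.

End interpolant.

Lemma step_uniform_bound (R : realType) (m : nat) : exists2 K : R, 0 <= K &
  forall r u, (r <= m)%N -> `|(@step R)^`(r) u| <= K.
Proof.
elim: m => [|m [K K0 hK]].
  by have [K K0 hK] := step_bounded R 0; exists K => // -[|r] u.
have [K' K'0 hK'] := step_bounded R m.+1.
exists (K + K') => [|r u]; first exact: addr_ge0.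
rewrite leq_eqVlt => /predU1P[->|rm]; first by rewrite (le_trans (hK' u))// lerDr.
by rewrite (le_trans (hK r u rm))// lerDl.
Qed.

(** * Averages and L_p norms *)

Section averages.
Context d (T : measurableType d) (R : realType).
Variable mu : {measure set T -> \bar R}.
Implicit Types (f g h : T -> R) (A : set T).
Local Open Scope ereal_scope.

Lemma measurable_normr_powR (p : R) D f : measurable_fun D f ->
  measurable_fun D (fun x => (`|f x| `^ p)%:E : \bar R).
Proof.
move=> mf; apply/measurable_EFinP.
apply: (@measurableT_comp _ _ _ _ _ _ (fun y : R => y `^ p)%R).
  exact: measurable_powR.
exact: measurableT_comp.
Qed.

Lemma integral_le_hoelder (p : R) f A : (1 < p)%R -> measurable A ->
  measurable_fun setT f ->
  \int[mu]_(x in A) `|f x|%:E <=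
    (\int[mu]_(x in A) (`|f x| `^ p)%:E) `^ p^-1 * (mu A) `^ (1 - p^-1).
Proof.
move=> p1 mA mf.
have p0 : (0 < p)%R by rewrite (lt_trans ltr01).
have q0 : (0 < (1 - p^-1)^-1)%R by rewrite invr_gt0 subr_gt0 invf_lt1.
have mfA : measurable_fun setT (f \_ A).
  by apply/measurable_restrict => //; rewrite setTI; exact: measurable_funTS.
have m1A : measurable_fun setT ((cst 1%R : T -> R) \_ A).
  by apply/measurable_restrict => //; rewrite setTI; exact: measurable_cst.
have := @hoelder _ _ _ mu (f \_ A) ((cst 1%R : T -> R) \_ A) p ((1 - p^-1)^-1)%R mfA m1A p0 q0.
rewrite invrK subrKC => /(_ erefl).
rewrite Lnorm1 unlock invrK.
have -> : \int[mu]_x `|(EFin \o ((f \_ A) \* ((cst 1%R : T -> R) \_ A))%R) x| =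
    \int[mu]_(x in A) `|f x|%:E.
  rewrite [RHS]integral_mkcond; apply: eq_integral => x _.
  by rewrite /= !patchE; case: ifPn => _; rewrite ?mulr1 ?mulr0 ?normr0.
have -> : \int[mu]_x (`|(EFin \o f \_ A) x| `^ p) = \int[mu]_(x in A) (`|f x| `^ p)%:E.
  rewrite [RHS]integral_mkcond; apply: eq_integral => x _.
  by rewrite /= !patchE; case: ifPn => _//; rewrite normr0 powR0// gt_eqF.
suff -> : \int[mu]_x (`|(EFin \o (cst 1%R : T -> R) \_ A) x| `^ (1 - p^-1)^-1) = mu A by [].
rewrite -[RHS]mul1e -integral_cst// [RHS]integral_mkcond; apply: eq_integral => x _.
rewrite /= !patchE; case: ifPn => _; first by rewrite normr1 powR1.
by rewrite normr0 powR0// gt_eqF.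
Qed.

Lemma integral_ge0_powR (p : R) f A : 0 <= \int[mu]_(x in A) (`|f x| `^ p)%:E.
Proof. by apply: integral_ge0 => x _; rewrite lee_fin powR_ge0. Qed.

(** Jensen for the power function, deduced from the Hoelder inequality. *)
Lemma average_powR_le (p a : R) f A : (1 < p)%R -> measurable A ->
  mu A < +oo -> measurable_fun setT f -> (0 <= a)%R ->
  a%:E * mu A <= \int[mu]_(x in A) `|f x|%:E ->
  (a `^ p)%:E * mu A <= \int[mu]_(x in A) (`|f x| `^ p)%:E.
Proof.
move=> p1 mA Aoo mf a0 ha.
have p0 : (0 < p)%R by rewrite (lt_trans ltr01).
have := le_trans ha (integral_le_hoelder p1 mA mf).
have [A0|A0] := eqVneq (mu A) 0.
  by rewrite A0 !mule0 => _; exact: integral_ge0_powR.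
have [m mE m0] : exists2 m : R, mu A = m%:E & (0 < m)%R.
  have fA : mu A \is a fin_num by rewrite ge0_fin_numE.
  exists (fine (mu A)); first by rewrite fineK.
  by rewrite fine_gt0// lt0e A0 measure_ge0/= Aoo.
rewrite mE; have := integral_ge0_powR p f A.
case: (\int[mu]_(x in A) (`|f x| `^ p)%:E) => [r||]; [|by move=> *; rewrite leey|by []].
rewrite lee_fin => r0; rewrite !poweR_EFin -!EFinM !lee_fin => H.
have m1 : (m `^ (1 - p^-1) = m / m `^ p^-1)%R.
  rewrite powRB ?powRr1 ?ltW//; last by rewrite (gt_eqF m0) implybT.
have H2 : (a * m `^ p^-1 <= r `^ p^-1)%R.
  have mp : (0 < m `^ p^-1)%R by exact: powR_gt0.
  by move: H; rewrite m1 mulrA ler_pdivlMr// mulrAC ler_pM2r.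
have := @ge0_ler_powR R p (ltW p0) _ _ _ _ H2.
rewrite !nnegrE mulr_ge0 ?powR_ge0// => /(_ isT isT).
rewrite powRM ?powR_ge0// -!powRrM mulVf; last by rewrite gt_eqF.
by rewrite (powRr1 (ltW m0)) (powRr1 r0).
Qed.

Lemma Lnorm_powR (p : R) f : (0 < p)%R ->
  'N[mu]_p%:E[EFin \o f] = (\int[mu]_x (`|f x| `^ p)%:E) `^ p^-1.
Proof. by move=> p0; rewrite unlock. Qed.

Lemma le_Lnorm_powR (p : R) f (M : \bar R) : (0 < p)%R -> 0 <= M ->
  \int[mu]_x (`|f x| `^ p)%:E <= M `^ p -> 'N[mu]_p%:E[EFin \o f] <= M.
Proof.
move=> p0 M0 h; rewrite Lnorm_powR//.
have -> : M = (M `^ p) `^ p^-1 by rewrite -poweRrM mulfV ?gt_eqF// poweRe1.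
apply: gt0_ler_poweR => //; first by rewrite invr_ge0 ltW.
  by rewrite in_itv/= integral_ge0_powR leey.
by rewrite in_itv/= poweR_ge0 leey.
Qed.

Lemma Lnorm_powR_le (p : R) f (M : \bar R) : (0 < p)%R -> 0 <= M ->
  'N[mu]_p%:E[EFin \o f] <= M -> \int[mu]_x (`|f x| `^ p)%:E <= M `^ p.
Proof.
move=> p0 M0 h.
have -> : \int[mu]_x (`|f x| `^ p)%:E = ('N[mu]_p%:E[EFin \o f]) `^ p.
  rewrite Lnorm_powR// -poweRrM mulVf ?gt_eqF// poweRe1//; exact: integral_ge0_powR.
apply: gt0_ler_poweR => //; first by rewrite ltW.
  by rewrite in_itv/= Lnorm_ge0 leey.
by rewrite in_itv/= M0 leey.
Qed.

Lemma Lnormy_ae f (M : \bar R) : 0 <= M ->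
  'N[mu]_+oo[EFin \o f] <= M <-> \forall x \ae mu, `|f x|%:E <= M.
Proof.
move=> M0; rewrite unlock; case: ifPn => mT.
  by split => [/ess_supP|h]; [|apply/ess_supP].
split => // _.
have mT0 : mu setT = 0.
  by apply/eqP; rewrite eq_le measure_ge0 andbT leNgt.
exists setT; split => //.
Qed.

Lemma le_Lnorm_ae p f g : 1 <= p ->
  measurable_fun setT f -> measurable_fun setT g ->
  (\forall x \ae mu, (`|f x| <= `|g x|)%R) ->
  'N[mu]_p[EFin \o f] <= 'N[mu]_p[EFin \o g].
Proof.
case: p => [p||]// p1 mf mg fg.
  have p0 : (0 < p)%R by rewrite (lt_le_trans ltr01).
  apply: le_Lnorm_powR; rewrite ?Lnorm_ge0//.
  apply: (@le_trans _ _ (\int[mu]_x (`|g x| `^ p)%:E)); last first.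
    by apply: Lnorm_powR_le => //; exact: Lnorm_ge0.
  apply: ae_ge0_le_integral => //.
  - exact: measurable_normr_powR.
  - exact: measurable_normr_powR.
  - apply: filterS fg => x h _; rewrite lee_fin.
    by apply: ge0_ler_powR; rewrite ?nnegrE// ltW.
apply/Lnormy_ae; first exact: Lnorm_ge0.
have /Lnormy_ae := lexx ('N[mu]_+oo[EFin \o g]) => /(_ (Lnorm_ge0 _ _ _)).
by apply: filterS2 fg => x h; apply: le_trans; rewrite lee_fin.
Qed.

Lemma le_Lnorm p f g : 1 <= p ->
  measurable_fun setT f -> measurable_fun setT g ->
  (forall x, (`|f x| <= `|g x|)%R) ->
  'N[mu]_p[EFin \o f] <= 'N[mu]_p[EFin \o g].
Proof. by move=> p1 mf mg fg; apply: le_Lnorm_ae => //; exact: nearW. Qed.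

(** The exponent is [1 - 1/p], or 1 for [p = +oo]. It is positive because [1
    < p], which is the source of all equicontinuity below. *)
Lemma integral_Lnorm_le (p : \bar R) : 1 < p -> exists2 r : R, (0 < r)%R &
  forall f A, measurable A -> measurable_fun setT f ->
    \int[mu]_(x in A) `|f x|%:E <= 'N[mu]_p[EFin \o f] * (mu A) `^ r.
Proof.
case: p => [p||]//; last first.
  move=> _; exists 1%R => // f A mA mf.
  rewrite poweRe1// -integral_cst//.
  apply: ae_ge0_le_integral => //.
  - by apply/measurable_EFinP; apply: measurableT_comp => //; exact: measurable_funTS.
  - by move=> x _; exact: Lnorm_ge0.
  - have /Lnormy_ae := lexx ('N[mu]_+oo[EFin \o f]) => /(_ (Lnorm_ge0 _ _ _)).
    by apply: filterS => x h _.
rewrite lte_fin => p1; have p0 : (0 < p)%R by rewrite (lt_trans ltr01).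
exists (1 - p^-1)%R; first by rewrite subr_gt0 invf_lt1.
move=> f A mA mf; apply: (le_trans (integral_le_hoelder p1 mA mf)).
rewrite lee_wpmul2r ?poweR_ge0//.
rewrite Lnorm_powR//; apply: gt0_ler_poweR.
- by rewrite invr_ge0 ltW.
- by rewrite in_itv/= integral_ge0_powR leey.
- by rewrite in_itv/= integral_ge0_powR leey.
by apply: ge0_subset_integral => //; exact: measurable_normr_powR.
Qed.

(** By Jensen on each set. The sets [J i] where [h] is bounded by the averages
    may differ from the sets [I i] of averaging, if their measure is not larger:
    the average over one cell is then used as a bound on another. *)
Lemma Lnorm_average (p : \bar R) (I J : nat -> set T) (a : nat -> R) g h :
  1 < p -> (forall i, measurable (I i)) -> (forall i, measurable (J i)) ->
  trivIset setT I -> trivIset setT J ->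
  (forall i, mu (J i) <= mu (I i)) -> (forall i, mu (I i) < +oo) ->
  measurable_fun setT g -> measurable_fun setT h ->
  (forall i, (0 <= a i)%R) ->
  (forall i, (a i)%:E * mu (I i) <= \int[mu]_(x in I i) `|g x|%:E) ->
  (forall i x, J i x -> (`|h x| <= a i)%R) ->
  (forall x, (forall i, ~ J i x) -> h x = 0%R) ->
  'N[mu]_p[EFin \o h] <= 'N[mu]_p[EFin \o g].
Proof.
case: p => [p||]// p1 mI mJ tI tJ JI Ioo mg mh a0 ha hJ h0; last first.
  apply/Lnormy_ae; first exact: Lnorm_ge0.
  have /Lnormy_ae := lexx ('N[mu]_+oo[EFin \o g]) => /(_ (Lnorm_ge0 _ _ _)) gM.
  set M := 'N[mu]_+oo[_] in gM *.
  have M0 : 0 <= M by exact: Lnorm_ge0.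
  have aM i : mu (I i) != 0 -> (a i)%:E <= M.
    move=> I0; have : (a i)%:E * mu (I i) <= M * mu (I i).
      apply: (le_trans (ha i)); rewrite -integral_cst//.
      apply: ae_ge0_le_integral => //.
      - by apply/measurable_EFinP; apply: measurableT_comp => //; exact: measurable_funTS.
      - by apply: filterS gM => x h' _.
    rewrite lee_pmul2r//; last by rewrite lt0e I0 measure_ge0.
    by rewrite ge0_fin_numE.
  (* Where [I i] is null the average is meaningless, but then [J i] is null
     too. *)
  pose N := \bigcup_i (if mu (I i) == 0 then J i else set0).
  have N0 : mu.-negligible N.
    apply: negligible_bigcup => i; case: ifPn => [/eqP I0|_]; last exact: negligible_set0.
    apply/negligibleP => //; apply/eqP; rewrite eq_le measure_ge0 andbT.
    by rewrite -I0; exact: JI.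
  apply: (negligibleS _ N0) => x /=; apply: contra_notP => Nx.
  have [[i Jx]|] := pselect (exists i, J i x); last first.
    by move=> /forallNP nJ; rewrite h0// normr0.
  apply: (@le_trans _ _ (a i)%:E); first by rewrite lee_fin; exact: hJ.
  apply: aM; apply: contra_notN Nx => /eqP I0.
  by exists i => //; rewrite I0 eqxx.
have p0 : (0 < p)%R by rewrite (lt_trans ltr01).
apply: le_Lnorm_powR; rewrite ?Lnorm_ge0//.
apply: (@le_trans _ _ (\int[mu]_x (`|g x| `^ p)%:E)); last first.
  by apply: Lnorm_powR_le => //; exact: Lnorm_ge0.
have -> : \int[mu]_x (`|h x| `^ p)%:E = \int[mu]_(x in \bigcup_i J i) (`|h x| `^ p)%:E.
  rewrite [RHS]integral_mkcond; apply: eq_integral => x _; rewrite patchE.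
  case: ifPn => // /negP; rewrite inE => nJ.
  rewrite h0 ?normr0 ?powR0 ?gt_eqF// => i Jx; apply: nJ; by exists i.
apply: (@le_trans _ _ (\int[mu]_(x in \bigcup_i I i) (`|g x| `^ p)%:E)); last first.
  apply: ge0_subset_integral => //; first exact: bigcup_measurable.
  exact: measurable_normr_powR.
have bigE (F : nat -> set T) (u : T -> R) : (forall i, measurable (F i)) ->
    trivIset setT F -> measurable_fun setT u ->
    \int[mu]_(x in \bigcup_i F i) (`|u x| `^ p)%:E =
    \sum_(0 <= i <oo) \int[mu]_(x in F i) (`|u x| `^ p)%:E.
  move=> mF tF mu'; apply: ge0_integral_bigcup => //.
  by apply: measurable_normr_powR; exact: measurable_funTS.
rewrite (bigE _ _ mJ tJ mh) (bigE _ _ mI tI mg).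
apply: lee_nneseries => [i _ _|i _]; first exact: integral_ge0_powR.
apply: (@le_trans _ _ ((a i `^ p)%:E * mu (I i))); last exact: average_powR_le.
apply: (@le_trans _ _ ((a i `^ p)%:E * mu (J i))); last first.
  by rewrite lee_wpmul2l// lee_fin powR_ge0.
rewrite -integral_cst//; apply: ge0_le_integral => //.
- by apply: measurable_normr_powR; exact: measurable_funTS.
- move=> x Jx; rewrite lee_fin; apply: ge0_ler_powR; rewrite ?nnegrE//; first exact: ltW.
  exact: hJ.
Qed.

End averages.

(** * Local integrals and weak derivatives *)

Section increments.
Context (R : realType).

(** Cut [a, b] into [n] equal parts and sum: the increments of [G] telescope
    and the factor [1 / n] remains. *)
Lemma constant_of_increments (f G : R -> R) (C a b : R) : a <= b -> 0 <= C ->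
  (forall x y, a <= x -> x <= y -> y <= b ->
     `|f y - f x| <= C * (y - x) * (G y - G x)) ->
  f b = f a.
Proof.
move=> ab C0 h.
apply/eqP; rewrite -subr_eq0 -normr_le0; apply/ler_addgt0Pr => e e0; rewrite add0r.
have Gab x y : a <= x -> x <= y -> y <= b -> 0 <= C * (y - x) * (G y - G x).
  by move=> *; apply: le_trans (h x y _ _ _); rewrite ?normr_ge0.
(* So many parts that [C (b - a) (G b - G a) / n] is less than [e]. *)
pose n := (Num.truncn (C * (b - a) * (G b - G a) / e)).+1.
have n0 : 0 < n%:R :> R by rewrite ltr0n.
pose s j := a + (b - a) / n%:R * j%:R.
have sS j : s j.+1 - s j = (b - a) / n%:R.
  by rewrite /s -natr1 mulrDr mulr1; ring.
have step0 : 0 <= (b - a) / n%:R by rewrite divr_ge0 ?subr_ge0// ltW.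
have sge j : a <= s j by rewrite lerDl mulr_ge0.
have sle j : (j <= n)%N -> s j <= b.
  move=> jn; rewrite /s -lerBrDl -mulrA ler_piMr ?subr_ge0//.
  by rewrite mulrC ler_pdivrMr// mul1r ler_nat.
have ssle j : s j <= s j.+1 by rewrite -subr_ge0 sS.
have H j : (j <= n)%N -> `|f (s j) - f (s 0%N)| <= C * ((b - a) / n%:R) * (G (s j) - G (s 0%N)).
  elim: j => [_|j IH jn]; first by rewrite !subrr normr0 mulr0.
  have -> : f (s j.+1) - f (s 0%N) = (f (s j.+1) - f (s j)) + (f (s j) - f (s 0%N)) by ring.
  apply: (le_trans (ler_normD _ _)).
  have -> : C * ((b - a) / n%:R) * (G (s j.+1) - G (s 0%N)) =
    C * (s j.+1 - s j) * (G (s j.+1) - G (s j)) +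
    C * ((b - a) / n%:R) * (G (s j) - G (s 0%N)) by rewrite sS; ring.
  by apply: lerD; [apply: h => //; exact: sle|apply: IH; exact: ltnW].
have := H n (leqnn n).
have -> : s 0%N = a by rewrite /s mulr0 addr0.
have -> : s n = b by rewrite /s divfK ?gt_eqF// subrKC.
move=> /le_trans; apply.
have := truncnS_gt (C * (b - a) * (G b - G a) / e); rewrite -/n ltr_pdivrMr// => T.
rewrite mulrA mulrAC ler_pdivrMr// ltW//.
by rewrite (mulrC e).
Qed.

End increments.

Section local_integrals.
Context (R : realType).
Implicit Types (f g u v : R -> R) (a b c : R).
Local Notation mu := (@lebesgue_measure R).
Local Notation locint := (locally_integrable [set: R]).

Lemma locint_integrable f a b : locint f -> mu.-integrable `[a, b] (EFin \o f).
Proof.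
move=> [mf _ h]; apply/integrableP; split.
  by apply/measurable_EFinP; exact: measurable_funTS.
by apply: h => //; exact: segment_compact.
Qed.

Lemma continuous_locint f : continuous f -> locint f.
Proof.
move=> cf; split; [exact: continuous_measurable_fun|exact: openT|move=> K _ cK].
have /integrableP[] := continuous_compact_integrable cK (continuous_subspaceT cf).
by [].
Qed.

Lemma locint_norm f : locint f -> locint (fun x => `|f x|).
Proof.
move=> [mf oT h]; split => //; first exact: measurableT_comp.
by move=> K KT cK; under eq_integral do rewrite normr_id; exact: h.
Qed.

Lemma locintM f g : locint f -> continuous g -> locint (fun x => f x * g x).
Proof.
move=> [mf oT h] cg; have mg := continuous_measurable_fun cg.
split => //; first exact: measurable_funM.
move=> K KT cK.
have [M [_ hM]] := compact_bounded (continuous_compact (continuous_subspaceT cg : {within K, continuous g}) cK).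
have mK : measurable K by exact: compact_measurable.
apply: (@le_lt_trans _ _ (\int[mu]_(x in K) (((`|M| + 1)%:E) * `|f x|%:E))%E).
  apply: ge0_le_integral => //.
  - by apply/measurable_EFinP; apply: measurableT_comp => //; apply: measurable_funM; exact: measurable_funTS.
  - by apply/measurable_EFinP; apply: measurable_funM => //; apply: measurableT_comp => //; exact: measurable_funTS.
  move=> x Kx; rewrite -EFinM lee_fin normrM mulrC ler_wpM2r//.
  apply: (hM (`|M| + 1)); first by rewrite (le_lt_trans (ler_norm _))// ltrDl.
  by exists x.
rewrite ge0_integralZl//.
- by apply: lte_mul_pinfty => //; exact: h.
- by apply/measurable_EFinP; apply: measurableT_comp => //; exact: measurable_funTS.
Qed.

Lemma Rintegral_split f a b c : locint f -> a <= c -> c <= b ->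
  \int[mu]_(x in `[a, b]) f x =
  \int[mu]_(x in `[a, c]) f x + \int[mu]_(x in `[c, b]) f x.
Proof.
move=> lf ac cb.
have := @Rintegral_itvB R f (BLeft a) (BRight b) c (locint_integrable a b lf).
rewrite !bnd_simp => /(_ ac cb) /eqP; rewrite subr_eq => /eqP ->.
rewrite addrC; congr (_ + _); rewrite Rintegral_itv_obnd_cbnd//.
apply: (integrableS _ _ _ (locint_integrable c b lf)) => //.
by apply: subset_itvr; rewrite bnd_simp.
Qed.

Lemma Rintegral_itvD f g a b : locint f -> locint g ->
  \int[mu]_(x in `[a, b]) (f x + g x) =
  \int[mu]_(x in `[a, b]) f x + \int[mu]_(x in `[a, b]) g x.
Proof. by move=> lf lg; apply: RintegralD => //; exact: locint_integrable. Qed.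

Lemma FTC2_derive1 f a b : (forall x : R, derivable f x 1) ->
  continuous (f^`()) -> a <= b -> \int[mu]_(x in `[a, b]) f^`()%classic x = f b - f a.
Proof.
move=> df cdf; rewrite le_eqVlt => /predU1P[->|ab].
  by rewrite set_itv1 Rintegral_set1 subrr.
have cf : continuous f by exact: derivable_continuousT.
have lr : derivable_oo_LRcontinuous f a b.
  split => [x _||]; first exact: df.
    by apply: cvg_at_right_filter; exact: cf.
  by apply: cvg_at_left_filter; exact: cf.
by rewrite /Rintegral (continuous_FTC2 ab (continuous_subspaceT cdf) lr (fun x _ => erefl)).
Qed.

Lemma Rintegral_itv1 f a : \int[mu]_(x in `[a, a]) f x = 0.
Proof. by rewrite set_itv1 Rintegral_set1. Qed.

Lemma le_norm_integral f a b : locint f ->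
  `|\int[mu]_(x in `[a, b]) f x| <= \int[mu]_(x in `[a, b]) `|f x|.
Proof. by move=> lf; apply: le_normr_Rintegral => //; exact: locint_integrable. Qed.

Lemma le_integral_cst f a b (C : R) : locint f -> a <= b ->
  (forall x, a <= x <= b -> `|f x| <= C) ->
  \int[mu]_(x in `[a, b]) `|f x| <= C * (b - a).
Proof.
move=> lf ab h.
have -> : C * (b - a) = \int[mu]_(x in `[a, b]) C.
  rewrite Rintegral_cst//= lebesgue_measure_itv/= lte_fin.
  case: ifPn => // ab'; have -> : a = b by apply/eqP; rewrite eq_le ab leNgt.
  by rewrite subrr.
apply: le_Rintegral => //.
- by apply: locint_integrable; exact: locint_norm.
- by apply: locint_integrable; apply: continuous_locint => x; exact: cvg_cst.
Qed.

Lemma integral_small f a b e : locint f -> 0 < e ->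
  exists2 d, 0 < d & forall x y, a <= x -> x <= y -> y <= b -> y - x < d ->
    \int[mu]_(t in `[x, y]) `|f t| < e.
Proof.
move=> lf e0.
have ifr : mu.-integrable setT (EFin \o (f \_ `[a, b])).
  have := locint_integrable a b lf; rewrite integrable_mkcond//=.
  by congr (_.-integrable _ _); apply/funext => x /=; rewrite !patchE; case: ifP.
have [d [d0 hd]] := integral_normr_continuous ifr e0.
exists d => // x y ax xy yb yxd.
have := hd `[x, y]%classic (measurable_itv _).
rewrite /= lebesgue_measure_itv/= lte_fin.
have -> : ((if (x < y)%R then (y%:E + (- x)%:E)%E else 0%R) < d%:E)%E.
  by case: ifPn => _; rewrite -?EFinD lte_fin.
move=> /(_ isT); congr (_ < e); apply: eq_Rintegral => t.
rewrite inE/= in_itv/= => /andP[xt ty]; rewrite patchE mem_set//=.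
by rewrite in_itv/= (le_trans ax)//= (le_trans ty).
Qed.

Lemma primitive_continuous g v : locint g ->
  (forall a b, a <= b -> v b - v a = \int[mu]_(x in `[a, b]) g x) ->
  continuous v.
Proof.
move=> lg hv x; apply/cvgrPdist_lt => e e0.
have [d d0 hd] := integral_small (x - 1) (x + 1) lg e0.
have m0 : 0 < Num.min d 1 by rewrite lt_min d0 ltr01.
exists (Num.min d 1) => // y /=; rewrite lt_min => /andP[yd y1].
have [xy|yx] := leP x y.
  rewrite distrC hv//; apply: (le_lt_trans (le_norm_integral _ _ lg)).
  move: yd y1; rewrite distrC ger0_norm ?subr_ge0// => yd y1.
  by apply: hd => //; lra.
rewrite hv ?(ltW yx)//; apply: (le_lt_trans (le_norm_integral _ _ lg)).
move: yd y1; rewrite ger0_norm ?subr_ge0 ?(ltW yx)// => yd y1.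
by apply: hd => //; lra.
Qed.

Lemma test_function_smooth (phi : R -> R) : test_function phi -> smooth phi.
Proof. by case=> h _; split. Qed.

Lemma test_function_support (phi : R -> R) : test_function phi ->
  exists2 M : R, 0 < M & forall x, M <= `|x| -> phi x = 0 /\ phi^`() x = 0.
Proof.
move=> [sphi /compact_bounded[M [_ hM]]].
have h0 x : `|M| + 1 <= `|x| -> phi x = 0.
  move=> Mx; apply/eqP; apply/negPn/negP => px.
  have := hM (`|M| + 1 / 2); rewrite (le_lt_trans (ler_norm _)) ?ltrDl//.
  move=> /(_ isT x (subset_closure _)) => /(_ px)/=.
  by move: Mx; lra.
have M0 : 0 < `|M| + 1 by rewrite ltr_wpDl.
exists (`|M| + 1) => // x Mx; split; first exact: h0.
have d (y : R) : derivable phi y 1 by exact: (sphi 0%N).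
have [x0|x0] := leP 0 x.
  apply: (derive1_one_sided (s := false) (a := `|M| + 1) d (c := 0)) => [y yM|].
    by apply: h0; rewrite (le_trans yM)// ler_norm.
  by rewrite -(ger0_norm x0).
apply: (derive1_one_sided (s := true) (a := - (`|M| + 1)) d (c := 0)) => [y yM|].
  apply: h0; rewrite (@ler0_norm _ y); first by rewrite lerNr.
  by rewrite (le_trans yM)// oppr_le0 ltW.
by move: Mx; rewrite (@ltr0_norm _ x)//; lra.
Qed.

Lemma Rintegral_support f (M : R) : locint f ->
  (forall x, M <= `|x| -> f x = 0) -> \int[mu]_x f x = \int[mu]_(x in `[- M, M]) f x.
Proof.
move=> lf h; rewrite [RHS]Rintegral_mkcond; apply: eq_Rintegral => x _.
rewrite patchE; case: ifPn => //; rewrite notin_setE/= in_itv/= => /negP.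
by rewrite -ler_norml -ltNge => /ltW; exact: h.
Qed.

Lemma smooth_lipschitz_itv phi a b : smooth phi -> exists2 K : R, 0 <= K &
  forall x y, a <= x <= b -> a <= y <= b ->
    `|phi x - phi y| <= K * `|x - y| /\ `|phi^`() x| <= K.
Proof.
move=> sphi.
have cd : continuous (phi^`()) by apply: smooth_continuous; exact: smooth_derive.
have [K K0 hK] : exists2 K : R, 0 <= K & forall x, a <= x <= b -> `|phi^`() x| <= K.
  have cK : {within `[a, b], continuous (phi^`())} by exact: continuous_subspaceT.
  have [M [_ hM]] := compact_bounded (continuous_compact cK (@segment_compact _ _ _)).
  exists (`|M| + 1) => [|x xab]; first by rewrite addr_ge0.
  apply: (hM (`|M| + 1)); first by rewrite (le_lt_trans (ler_norm _))// ltrDl.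
  by exists x => //=; rewrite in_itv.
exists K => // x y xab yab; split; last exact: hK.
have cphi := smooth_continuous sphi.
wlog xy : x y xab yab / x <= y.
  by move=> H; have [/H|/ltW/H] := leP x y; [exact|rewrite distrC (distrC x); exact].
have [c] := @MVT_segment R phi (phi^`()) x y xy (fun t _ => derivable_is_derive (sphi 0%N t))
  (continuous_subspaceT cphi).
rewrite in_itv/= => /andP[xc cy] E.
rewrite distrC E normrM (distrC x) ler_wpM2r// hK//.
by move: xab yab => /andP[ax _] /andP[_ yb]; rewrite (le_trans ax xc) (le_trans cy yb).
Qed.

(** Integration by parts without Fubini. The function [v phi - int (g phi +
    v phi')] has increments bounded by [C (y - x) int |g|], hence is
    constant, and [phi] vanishes at both ends. *)
Lemma primitive_weak_derivative g v : locint g ->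
  (forall a b, a <= b -> v b - v a = \int[mu]_(x in `[a, b]) g x) ->
  is_weak_derivative v g.
Proof.
move=> lg hv; have cv := primitive_continuous lg hv.
split=> //; first exact: continuous_locint.
move=> phi tphi; have sphi := test_function_smooth tphi.
have [M M0 hM] := test_function_support tphi.
have cphi := smooth_continuous sphi.
have cdphi : continuous (phi^`()) by apply: smooth_continuous; exact: smooth_derive.
have l1 : locint (fun x => v x * phi^`()%classic x) by apply: locintM => //; exact: continuous_locint.
have l2 : locint (fun x => g x * phi x) by exact: locintM.
have l12 : locint (fun x => g x * phi x + v x * phi^`()%classic x).
  exact: (locally_integrableD l2 l1).
rewrite (Rintegral_support (M := M)) => //; last first.
  by move=> x /hM[_ ->]; rewrite mulr0.
rewrite (Rintegral_support (M := M) l2); last first.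
  by move=> x /hM[-> _]; rewrite mulr0.
apply/eqP; rewrite -subr_eq0 opprK addrC; apply/eqP.
rewrite -RintegralD//; [|exact: locint_integrable..].
have [K K0 hK] := smooth_lipschitz_itv (- M) M sphi.
pose H x := v x * phi x - \int[mu]_(t in `[- M, x]) (g t * phi t + v t * phi^`()%classic t).
pose G x := \int[mu]_(t in `[- M, x]) `|g t|.
have MM : - M <= M by lra.
have lng := locint_norm lg.
have := @constant_of_increments R H G (2 * K) (- M) M MM.
rewrite mulr_ge0// => /(_ isT) HH.
have : H M = H (- M).
  apply: HH => x y Mx xy yM.
  have My : - M <= y by lra.
  have xM : x <= M by lra.
  rewrite /H /G (Rintegral_split l12 Mx xy) (Rintegral_split lng Mx xy).
  set A := \int[mu]_(t in `[- M, x]) _; set B := \int[mu]_(t in `[- M, x]) _.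
  set I := \int[mu]_(t in `[x, y]) _; set J := \int[mu]_(t in `[x, y]) _.
  have -> : B + J - B = J by ring.
  have lt1 : locint (fun t => g t * (phi t - phi y)).
    by apply: locintM => // t; apply: cvgB; [exact: cphi|exact: cvg_cst].
  have lt2 : locint (fun t => (v t - v x) * phi^`()%classic t).
    apply: locintM => //; apply: continuous_locint => t; apply: cvgB; [exact: cv|exact: cvg_cst].
  have J0 : 0 <= J by apply: Rintegral_ge0.
  have IE : I = \int[mu]_(t in `[x, y]) (g t * (phi t - phi y)) +
                \int[mu]_(t in `[x, y]) ((v t - v x) * phi^`()%classic t) +
                (v y * phi y - v x * phi x).
    have iphi : \int[mu]_(t in `[x, y]) phi^`()%classic t = phi y - phi x.
      by apply: FTC2_derive1; [exact: (sphi 0%N)|exact: cdphi|exact: xy].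
    have -> : v y * phi y - v x * phi x = (v y - v x) * phi y + v x * (phi y - phi x) by ring.
    rewrite (hv _ _ xy) -iphi -RintegralZr//; last exact: locint_integrable.
    rewrite -RintegralZl//; last by apply: locint_integrable; exact: continuous_locint.
    have c1 : locint (fun t => g t * phi y) by apply: locintM => // t; exact: cvg_cst.
    have c2 : locint (fun t => v x * phi^`()%classic t).
      by apply: locintM => //; apply: continuous_locint => t; exact: cvg_cst.
    rewrite -(Rintegral_itvD _ _ lt1 lt2) -(Rintegral_itvD _ _ c1 c2).
    rewrite -(Rintegral_itvD _ _ (locally_integrableD lt1 lt2) (locally_integrableD c1 c2)).
    by apply: eq_Rintegral => t _; rewrite /=; ring.
  have -> : v y * phi y - (A + I) - (v x * phi x - A) =
     - (\int[mu]_(t in `[x, y]) (g t * (phi t - phi y)) +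
        \int[mu]_(t in `[x, y]) ((v t - v x) * phi^`()%classic t)).
    by rewrite IE; ring.
  rewrite normrN; apply: (le_trans (ler_normD _ _)).
  have -> : 2 * K * (y - x) * J = K * (y - x) * J + (J * K) * (y - x) by ring.
  apply: lerD; apply: (le_trans (le_norm_integral _ _ _)) => //.
  - rewrite -RintegralZl//; last exact: locint_integrable.
    apply: le_Rintegral => //.
    + by apply: locint_integrable; exact: locint_norm.
    + apply: locint_integrable; under eq_fun do rewrite mulrC.
      by apply: locintM => // t; exact: cvg_cst.
    move=> t; rewrite /= in_itv/= => /andP[xt ty].
    rewrite normrM mulrC ler_wpM2r//.
    have [||h _] := hK t y; [lra|lra|].
    by apply: (le_trans h); rewrite ler_wpM2l// distrC ger0_norm; lra.
  - apply: le_integral_cst => // t /andP[xt ty].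
    rewrite normrM ler_pM//; last by have [||_ ->] := hK t t; lra.
    rewrite hv//; apply: (le_trans (le_norm_integral _ _ lg)).
    rewrite /J (Rintegral_split lng xt ty) lerDl.
    by apply: Rintegral_ge0.
have phiM (s : R) : `|s| = M -> phi s = 0 by move=> sM; have [|->] := hM s; rewrite ?sM.
rewrite /H !phiM ?normrN ?ger0_norm ?(ltW M0)// !mulr0 !sub0r.
rewrite Rintegral_itv1 oppr0 => /eqP; rewrite oppr_eq0 => /eqP <-.
by apply: eq_Rintegral.
Qed.

(** Test with the difference of two steps near [a] and [b]: its derivative
    is a pair of bumps of mass 1 and -1, so the averages of [u] near the two
    points agree. *)
Lemma weak_derivative0_constant u : continuous u ->
  (forall phi, test_function phi -> \int[mu]_x (u x * phi^`()%classic x) = 0) ->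
  forall a b, a < b -> u a = u b.
Proof.
move=> cu hu a b ab.
have [K K0 hK] := step_bounded R 1.
apply/eqP; rewrite -subr_eq0 -normr_le0; apply/ler_addgt0Pr => e e0; rewrite add0r.
(* Each average is within [K e'] of the value at its end, and a last [e']
   remains to spare. *)
pose e' := e / (2 * K + 1).
have K1 : 0 < 2 * K + 1 by rewrite ltr_wpDl// mulr_ge0.
have e'0 : 0 < e' by rewrite divr_gt0.
have nearu c : exists2 d, 0 < d & forall x, c <= x <= c + d -> `|u x - u c| <= e'.
  have /cvgrPdist_le /(_ _ e'0)[d /= d0 hd] := cu c.
  exists (d / 2) => [|x /andP[cx xd]]; first by rewrite divr_gt0.
  rewrite distrC; apply: hd => /=.
  by rewrite distrC ger0_norm ?subr_ge0//; lra.
have [d1 d10 h1] := nearu a; have [d2 d20 h2] := nearu b.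
pose d := Num.min d1 d2.
have d0 : 0 < d by rewrite lt_min d10.
pose s c x := step (d^-1 * x + (- c / d)).
have sE c x : d^-1 * x + (- c / d) = (x - c) / d by ring.
have ss c : smooth (s c) by have [] := smooth_affine d^-1 (- c / d) (@smooth_step R).
have s'E c x : (s c)^`() x = d^-1 * (derive1 (@step R)) ((x - c) / d).
  have [_ /(_ 1%N)] := smooth_affine d^-1 (- c / d) (@smooth_step R).
  by rewrite derive1n1 /s => ->; rewrite expr1 sE derive1n1.
have slo c x : x <= c -> s c x = 0.
  by move=> xc; rewrite /s sE step_le0// ler_pdivrMr// mul0r subr_le0.
have shi c x : c + d <= x -> s c x = 1.
  by move=> xc; rewrite /s sE step_ge1// ler_pdivlMr// mul1r; lra.
have s'0 c x : x <= c \/ c + d <= x -> (s c)^`() x = 0.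
  move=> [h|h].
    by apply: (derive1_one_sided (s := true) _ (slo c) h) => y; exact: (ss c 0%N).
  by apply: (derive1_one_sided (s := false) _ (shi c) h) => y; exact: (ss c 0%N).
have cs' c : continuous ((s c)^`()) by apply: smooth_continuous; exact: smooth_derive.
have luS c : locint (fun x => u x * (s c)^`()%classic x).
  by apply: locintM => //; exact: continuous_locint.
have avg c : (forall x, c <= x <= c + d -> `|u x - u c| <= e') ->
    `|\int[mu]_(x in `[c, (c + d)]) (u x * (s c)^`()%classic x) - u c| <= e' * K.
  move=> hc.
  have cd : c <= c + d by rewrite lerDl ltW.
  have i1 : \int[mu]_(x in `[c, (c + d)]) (s c)^`()%classic x = 1.
    rewrite FTC2_derive1; [|exact: (ss c 0%N)|exact: cs'|exact: cd].
    by rewrite shi// slo// subr0.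
  have l1 : locint (fun x => (u x - u c) * (s c)^`()%classic x).
    apply: locintM => //; apply: continuous_locint => x; apply: cvgB; [exact: cu|exact: cvg_cst].
  have l2 : locint (fun x => u c * (s c)^`()%classic x).
    by apply: locintM => //; apply: continuous_locint => x; exact: cvg_cst.
  have -> : \int[mu]_(x in `[c, (c + d)]) (u x * (s c)^`()%classic x) - u c =
      \int[mu]_(x in `[c, (c + d)]) ((u x - u c) * (s c)^`()%classic x).
    have -> : \int[mu]_(x in `[c, (c + d)]) (u x * (s c)^`()%classic x) =
       \int[mu]_(x in `[c, (c + d)]) ((u x - u c) * (s c)^`()%classic x + u c * (s c)^`()%classic x).
      by apply: eq_Rintegral => x _; ring.
    rewrite Rintegral_itvD// RintegralZl//; last first.
      by apply: locint_integrable; exact: continuous_locint.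
    by rewrite i1 mulr1 addrK.
  apply: (le_trans (le_norm_integral _ _ l1)).
  have -> : e' * K = (e' * (K / d)) * (c + d - c) by field; rewrite gt_eqF.
  apply: le_integral_cst => // x xc.
  rewrite normrM ler_pM//; first exact: hc.
  rewrite s'E normrM mulrC (@gtr0_norm _ d^-1) ?invr_gt0//.
  rewrite ler_wpM2r ?invr_ge0 ?(ltW d0)//.
  by have := hK ((x - c) / d); rewrite derive1n1.
have dd1 : d <= d1 by rewrite ge_min lexx.
have dd2 : d <= d2 by rewrite ge_min lexx orbT.
have avga : `|\int[mu]_(x in `[a, (a + d)]) (u x * (s a)^`()%classic x) - u a| <= e' * K.
  apply: avg => x /andP[ax xd]; apply: h1; rewrite ax; apply: (le_trans xd).
  by rewrite lerD2l.
have avgb : `|\int[mu]_(x in `[b, (b + d)]) (u x * (s b)^`()%classic x) - u b| <= e' * K.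
  apply: avg => x /andP[ax xd]; apply: h2; rewrite ax; apply: (le_trans xd).
  by rewrite lerD2l.
clear avg.
pose phi : R -> R := s a - s b.
have sphi : smooth phi by apply: smoothD => //; exact: smoothN.
pose M := `|a| + `|b| + d.
have M0 : 0 <= M by rewrite !addr_ge0// ltW.
have far c x : `|c| + d <= M -> M <= `|x| -> (0 <= x /\ c + d <= x) \/ (x < 0 /\ x <= c).
  move=> cM Mx; have [x0|x0] := leP 0 x.
    left; split => //; move: Mx; rewrite ger0_norm//; apply: le_trans; apply: le_trans cM.
    by rewrite lerD2r ler_norm.
  right; split => //; move: Mx; rewrite ltr0_norm// => Mx.
  have := ler_norm (- c); rewrite normrN => cc.
  by move: cM; lra.
have aM : `|a| + d <= M by rewrite /M; have := normr_ge0 b; lra.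
have bM : `|b| + d <= M by rewrite /M; have := normr_ge0 a; lra.
have phi0 x : M <= `|x| -> phi x = 0.
  move=> Mx; rewrite /phi !fctE.
  case: (far a x aM Mx) => -[xs xa]; case: (far b x bM Mx) => -[xs' xb].
  - by rewrite !shi// subrr.
  - by move: xs; rewrite leNgt xs'.
  - by move: xs'; rewrite leNgt xs.
  - by rewrite !slo// subrr.
have tphi : test_function phi.
  split; first exact: sphi.
  apply: (@subclosed_compact _ _ `[- M, M]%classic).
  - exact: closed_closure.
  - exact: segment_compact.
  - rewrite [X in _ `<=` X](closure_id _).1; last exact: interval_closed.
    apply: closure_subset => x /=; rewrite in_itv/= -ler_norml => px.
    rewrite leNgt; apply: contra px => /ltW Mx.
    by rewrite phi0.
have := hu _ tphi.
have phi' x : phi^`() x = (s a)^`()%classic x - (s b)^`()%classic x.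
  by have := derive1nB 1 (ss a) (ss b); rewrite !derive1n1 => ->.
have supp c : mu.-integrable setT (EFin \o (fun x => u x * (s c)^`()%classic x)) /\
    \int[mu]_x (u x * (s c)^`()%classic x) =
    \int[mu]_(x in `[c, (c + d)]) (u x * (s c)^`()%classic x).
  have E : (fun x => u x * (s c)^`()%classic x) =
      (fun x => u x * (s c)^`()%classic x) \_ `[c, (c + d)].
    apply/funext => x; rewrite patchE; case: ifPn => //.
    rewrite notin_setE/= in_itv/= => /negP; rewrite negb_and -!ltNge => /orP h.
    by rewrite s'0 ?mulr0//; case: h => /ltW; [left|right].
  split; last by rewrite [RHS]Rintegral_mkcond -E.
  rewrite E; have := locint_integrable c (c + d) (luS c).
  rewrite integrable_mkcond//=; congr (_.-integrable _ _); apply/funext => x /=.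
  by rewrite !patchE; case: ifP.
have [ia Ea] := supp a; have [ib Eb] := supp b.
have -> : \int[mu]_x (u x * phi^`()%classic x) =
   \int[mu]_x (u x * (s a)^`()%classic x) - \int[mu]_x (u x * (s b)^`()%classic x).
  rewrite -(RintegralB measurableT ia ib); apply: eq_Rintegral => x _.
  by rewrite phi' mulrBr.
rewrite Ea Eb => /eqP; rewrite subr_eq0 => /eqP eab.
move: avga avgb; rewrite eab.
move: (\int[mu]_(x in _) _) => I avga avgb.
clear eab Ea Eb ia ib supp phi'.
have -> : u a - u b = - (I - u a) + (I - u b) by ring.
apply: (le_trans (ler_normD _ _)); rewrite normrN.
apply: (le_trans (lerD avga avgb)).
have e'E : e' * (2 * K + 1) = e by rewrite divfK// gt_eqF.
have -> : e = e' * K + e' * K + e' by rewrite -e'E; ring.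
by rewrite lerDl ltW.
Qed.

(** The difference of [v] and a primitive of [g] is continuous with weak
    derivative 0. *)
Lemma weak_derivative_primitive g v : continuous v -> is_weak_derivative v g ->
  forall a b, a <= b -> v b - v a = \int[mu]_(x in `[a, b]) g x.
Proof.
move=> cv [lv lg hvg] a b ab.
(* One of the two intervals is empty or a point, so this is the signed
   primitive. *)
pose V x := \int[mu]_(t in `[a, x]) g t - \int[mu]_(t in `[x, a]) g t.
have V1 x : a <= x -> V x = \int[mu]_(t in `[a, x]) g t.
  rewrite /V le_eqVlt => /predU1P[->|ax]; first by rewrite Rintegral_itv1 subr0.
  by rewrite [X in _ - X](_ : _ = 0) ?subr0// set_itv_ge ?bnd_simp -?ltNge// Rintegral_set0.
have V2 x : x <= a -> V x = - \int[mu]_(t in `[x, a]) g t.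
  rewrite /V le_eqVlt => /predU1P[->|ax]; first by rewrite Rintegral_itv1 sub0r.
  by rewrite [X in X - _](_ : _ = 0) ?sub0r// set_itv_ge ?bnd_simp -?ltNge// Rintegral_set0.
have hV x y : x <= y -> V y - V x = \int[mu]_(t in `[x, y]) g t.
  move=> xy; have [ax|xa] := leP a x.
    by rewrite !V1 ?(le_trans ax xy)// (Rintegral_split lg ax xy); ring.
  have [ay|ya] := leP a y.
    by rewrite V1// V2 ?(ltW xa)// (Rintegral_split lg (ltW xa) ay); ring.
  by rewrite !V2 ?(ltW xa) ?(ltW ya)// (Rintegral_split lg xy (ltW ya)); ring.
have cV := primitive_continuous lg hV.
have [_ _ wV] := primitive_weak_derivative lg hV.
rewrite -hV//; move: ab; rewrite le_eqVlt => /predU1P[->|ab]; first by rewrite !subrr.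
have cu : continuous (v - V) by move=> x; apply: cvgB; [exact: cv|exact: cV].
have := @weak_derivative0_constant (v - V) cu _ a b ab.
suff H : forall phi, test_function phi -> \int[mu]_x ((v - V) x * phi^`()%classic x) = 0.
  by move=> /(_ H); rewrite !fctE => h; lra.
move=> phi tphi.
have [M M0 hM] := test_function_support tphi.
have sphi := test_function_smooth tphi.
have cdphi : continuous (phi^`()) by apply: smooth_continuous; exact: smooth_derive.
have lu (w : R -> R) : continuous w -> locint (fun x => w x * phi^`()%classic x).
  by move=> cw; apply: locintM; [exact: continuous_locint|exact: cdphi].
have z w x : M <= `|x| -> w x * phi^`()%classic x = 0 by move=> /hM[_ ->]; rewrite mulr0.
have := hvg _ tphi; rewrite -(wV _ tphi).
rewrite !(Rintegral_support (M := M)); [|exact: lu|exact: z|exact: lu|exact: z|exact: lu|exact: z].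
move=> E; apply/eqP; rewrite -(subrr (\int[mu]_(x in `[- M, M]) (v x * phi^`()%classic x))).
rewrite {2}E -RintegralB//; [|exact: (locint_integrable _ _ (lu _ cv))|exact: (locint_integrable _ _ (lu _ cV))].
by apply/eqP; apply: eq_Rintegral => x _; rewrite mulrBl.
Qed.

Lemma FTC1_ae g a : locint g ->
  \forall x \ae mu, a < x -> derive1 (fun y => \int[mu]_(t in `[a, y]) g t) x = g x.
Proof.
move=> lg; have := @FTC1 R g (BLeft a) (fun y => locint_integrable _ y lg) lg.
rewrite /=; apply: (@filterS _ _ (ae_filter_ringOfSetsType mu)) => x h ax.
by have [] := h ax.
Qed.

(** By Lebesgue differentiation both functions are almost everywhere the
    derivative of the same primitive. *)
Lemma primitive_ae_unique g1 g2 : locint g1 -> locint g2 ->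
  (forall a b, a <= b -> \int[mu]_(x in `[a, b]) g1 x = \int[mu]_(x in `[a, b]) g2 x) ->
  \forall x \ae mu, g1 x = g2 x.
Proof.
move=> l1 l2 E.
have H (n : nat) : \forall x \ae mu, - n%:R < x -> g1 x = g2 x.
  have h1 := FTC1_ae (- n%:R) l1; have h2 := FTC1_ae (- n%:R) l2.
  have EF : (fun y => \int[mu]_(t in `[- n%:R, y]) g1 t) =
            (fun y => \int[mu]_(t in `[- n%:R, y]) g2 t).
    apply/funext => y; have [ny|yn] := leP (- n%:R) y; first exact: E.
    by rewrite set_itv_ge ?Rintegral_set0// bnd_simp -ltNge.
  rewrite EF in h1; apply: (@filterS2 _ _ (ae_filter_ringOfSetsType mu) _ _ _ _ h1 h2) => x {}h1 {}h2 nx.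
  by rewrite -h1// -h2.
have := ae_foralln H; apply: filterS => x h.
apply: (h (Num.truncn `|x|).+1).
rewrite ltrNl; apply: (le_lt_trans (ler_norm _)); rewrite normrN.
exact: truncnS_gt.
Qed.

End local_integrals.

(** * Divided differences of Sobolev functions *)

Section mean_values.
Context (R : realType).
Implicit Types (F : R -> R) (x : nat -> R).

Lemma derive1nD_upto (f g : R -> R) k :
  (forall n (t : R), (n < k)%N -> derivable (f^`(n)) t 1) -> smooth g ->
  (f + g)^`(k) = derive1n k f + derive1n k g.
Proof.
elim: k f g => [//|k IH] f g hf sg.
rewrite !derive1nSr derive1_add; [|by move=> t; exact: (hf 0%N t isT)|exact: (sg 0%N)].
apply: IH; last exact: smooth_derive.
by move=> n t nk; rewrite -derive1nSr; exact: hf.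
Qed.

Lemma derivn_newton x (y : nat -> R) k i :
  derivn k (newton x y k.+1 i) = (k`!%:R * ddiff x y k i)%:P.
Proof.
have sz : (size (derivn k (newton x y k.+1 i)) <= 1)%N.
  apply/leq_sizeP => j j1; rewrite coef_derivn nth_default ?mul0rn//.
  by rewrite (leq_trans (size_newton _ _ _ _))// -addn1 leq_add2l.
rewrite (size1_polyC sz); congr (_%:P).
rewrite coef_derivn addn0 ffactnn /newton coef_sum big_ord_recr /=.
rewrite big1 ?add0r => [|j _].
  rewrite coefCM; have -> : (nodal x i k)`_k = 1.
    have : lead_coef (nodal x i k) = 1.
      by apply/eqP; rewrite -monicE; exact: monic_prod_XsubC.
    by rewrite lead_coefE size_nodal.
  by rewrite mulr1 mulr_natl.
by rewrite coefCM nth_default ?mulr0// size_nodal.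
Qed.

(** Apply the iterated Rolle theorem to the difference with the
    interpolating polynomial. *)
Lemma ddiff_mean_value F k x i :
  (forall n (t : R), (n < k)%N -> derivable (F^`(n)) t 1) ->
  (forall i, x i < x i.+1) ->
  exists2 xi, x i <= xi <= x (i + k)%N &
    F^`(k) xi = k`!%:R * ddiff x (fun j => F (x j)) k i.
Proof.
move=> hF xlt.
pose p := newton x (fun j => F (x j)) k.+1 i.
have sp : smooth (horner (- p)) by exact: smooth_horner.
have [|||t] := @Rolle_iter _ (F + horner (- p)) k (fun j => x (i + j)%N).
- move=> n t nk; rewrite derive1nD_upto//; last first.
    by move=> n' t' nn; apply: hF; exact: ltn_trans nk.
  by apply: derivableD; [exact: hF|exact: sp].
- by move=> j _; rewrite addnS.
- move=> j jk; change (F (x (i + j)%N) + (- p).[x (i + j)%N] = 0).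
  by rewrite hornerN newton_interp// subrr.
rewrite addn0 => txk; rewrite derive1nD_upto// => h; exists t => //.
move: h; change (derive1n k F t + derive1n k (horner (- p)) t = 0 ->
  derive1n k F t = k`!%:R * ddiff x (fun j => F (x j)) k i).
rewrite derive1n_horner derivnN hornerN derivn_newton hornerC => /eqP.
by rewrite subr_eq0 => /eqP.
Qed.

End mean_values.

Section sobolev_jets.
Context (R : realType).
Local Notation mu := (@lebesgue_measure R).
Local Notation locint := (locally_integrable [set: R]).
Implicit Types (x : nat -> R) (f : nat -> R -> R).

(** The family of derivatives of a Sobolev function, the top one being an
    arbitrary representative of the weak derivative. *)
Record sobolev_jet m' f : Prop := SobolevJet {
  jet_derivable : forall k (t : R), (k < m')%N -> derivable ((f 0%N)^`(k)) t 1;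
  jet_derive : forall k, (k <= m')%N -> (f 0%N)^`(k) = f k;
  jet_locint : forall k, (k <= m'.+1)%N -> locint (f k);
  jet_primitive : forall k a b, (k <= m')%N -> a <= b ->
    f k b - f k a = \int[mu]_(t in `[a, b]) f k.+1 t }.

Lemma divr_fact_le (a B : R) k : `|a| <= B -> `|a / k`!%:R| <= B.
Proof.
move=> aB; rewrite normrM normfV (ger0_norm (ler0n _ _)) ler_pdivrMr ?ltr0n ?fact_gt0//.
apply: (le_trans aB); rewrite ler_peMr ?ler1n ?fact_gt0//.
exact: le_trans (normr_ge0 _) aB.
Qed.

Section nodes.
Variables (m' : nat) (f : nat -> R -> R) (x : nat -> R) (b : nat -> bool).
Hypothesis jf : sobolev_jet m' f.
Hypothesis xlt : forall i, x i < x i.+1.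
Hypothesis sep : forall i j, (i < j)%N -> b i != b j -> 1 <= x j - x i.
Let m := m'.+1.
Let y j := if b j then f 0%N (x j) else 0.

Let dichotomy k i : (forall j, (i <= j <= i + k)%N -> b j = b i) \/
  1 <= x (i + k)%N - x i.
Proof.
have [h|/existsNP[j /not_implyP[/andP[ij jk] bj]]] :=
  pselect (forall j, (i <= j <= i + k)%N -> b j = b i); [by left|right].
have ij' : (i < j)%N.
  by rewrite ltn_neqAle ij andbT; apply: contra_notN bj => /eqP ->.
apply: (@le_trans _ _ (x j - x i)).
  by apply: sep => //; rewrite eq_sym; exact/eqP.
by rewrite lerD2r nodes_le.
Qed.

Let ddiff_step k i : 1 <= x (i + k.+1)%N - x i ->
  `|ddiff x y k.+1 i| <= `|ddiff x y k i.+1| + `|ddiff x y k i|.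
Proof.
move=> L1; have L0 : 0 < x (i + k.+1)%N - x i by exact: lt_le_trans L1.
apply: (le_trans _ (ler_normB _ _)).
rewrite -(ddiffS xlt) [X in _ <= X]normrM (gtr0_norm L0).
by rewrite ler_peMl.
Qed.

(** If the nodes are of one kind, the mean value theorem applies or all
    values vanish. If not, the span is at least 1 and the recursion for
    divided differences loses only a factor 2. *)
Lemma ddiff_lo_bound k i (B : R) : (k <= m')%N ->
  (forall s t, (s <= k)%N -> x i <= t <= x (i + k)%N -> `|f s t| <= B) ->
  `|ddiff x y k i| <= 2 ^+ k * B.
Proof.
move=> km hB.
have B0 : 0 <= B.
  apply: (le_trans (normr_ge0 (f 0%N (x i)))); apply: hB => //.
  by rewrite lexx nodes_le// leq_addr.
elim: k i km hB => [|k IH] i km hB.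
  rewrite expr0 mul1r /ddiff /y; case: ifP => _; last by rewrite normr0.
  by apply: hB => //; rewrite addn0 lexx.
have twoB : B <= 2 ^+ k.+1 * B.
  by rewrite ler_peMl// exprn_ege1// ler1n.
have [h|h] := dichotomy k.+1 i.
  have [bi|/negbTE bi] := boolP (b i).
    rewrite (@eq_ddiff _ x y (fun j => f 0%N (x j))); last first.
      by move=> j hj; rewrite /y h// bi.
    have [t tx ft] := @ddiff_mean_value _ (f 0%N) k.+1 x i
       (fun n t nk => jet_derivable jf (leq_trans nk km)) xlt.
    apply: le_trans twoB.
    have -> : ddiff x (fun j => f 0%N (x j)) k.+1 i = f k.+1 t / (k.+1)`!%:R.
      by rewrite -(jet_derive jf km) ft mulrC mulKf// pnatr_eq0 -lt0n fact_gt0.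
    by apply: divr_fact_le; exact: hB.
  rewrite (@eq_ddiff _ x y (fun=> 0)); last first.
    by move=> j hj; rewrite /y h// bi.
  by rewrite ddiff_0 normr0 (le_trans B0).
apply: (le_trans (ddiff_step h)).
have -> : 2 ^+ k.+1 * B = 2 ^+ k * B + 2 ^+ k * B by rewrite exprS; ring.
apply: lerD; apply: IH; rewrite ?(ltnW km)// => s t sk /andP[it ti]; apply: hB;
  rewrite ?(leq_trans sk)//.
  by rewrite (le_trans _ it) ?(ltW (xlt i))// -addSnnS ti.
by rewrite it (le_trans ti)// nodes_le// leq_add2l.
Qed.

(** If all nodes carry values of [f 0], the mean value theorem in order [m']
    bounds the divided difference of order [m] by an increment of [f m']
    within the span over the length of the span, hence by an average of [f
    m]. *)
Lemma ddiff_hi_bound i (B : R) :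
  (forall s t, (s <= m')%N -> x i <= t <= x (i + m)%N -> `|f s t| <= B) ->
  `|ddiff x y m i| <= (x (i + m)%N - x i)^-1 *
     \int[mu]_(t in `[x i, x (i + m)%N]) `|f m t| + 2 ^+ m * B.
Proof.
move=> hB.
have L0 : 0 < x (i + m)%N - x i by rewrite subr_gt0 nodes_lt// -addSnnS leq_addr.
have B0 : 0 <= B.
  apply: (le_trans (normr_ge0 (f 0%N (x i)))); apply: hB => //.
  by rewrite lexx ltW// -subr_gt0.
have lw : locint (f m) by exact: (jet_locint jf).
have I0 : 0 <= \int[mu]_(t in `[x i, x (i + m)%N]) `|f m t| by exact: Rintegral_ge0.
have B2 : 0 <= 2 ^+ m * B by rewrite mulr_ge0// exprn_ge0.
have LI0 : 0 <= (x (i + m)%N - x i)^-1 * \int[mu]_(t in `[x i, x (i + m)%N]) `|f m t|.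
  by rewrite mulr_ge0// invr_ge0 ltW.
have [h|h] := dichotomy m i; last first.
  apply: ler_wpDl => //.
  apply: (le_trans (ddiff_step h)).
  have -> : 2 ^+ m * B = 2 ^+ m' * B + 2 ^+ m' * B by rewrite exprS; ring.
  apply: lerD; apply: ddiff_lo_bound => // s t sk /andP[it ti]; apply: hB => //.
    by rewrite (le_trans _ it) ?(ltW (xlt i))// -addSnnS ti.
  by rewrite it (le_trans ti)// nodes_le// leq_add2l.
have [bi|/negbTE bi] := boolP (b i); last first.
  rewrite (@eq_ddiff _ x y (fun=> 0)) => [|j hj]; last by rewrite /y h// bi.
  by rewrite ddiff_0 normr0 addr_ge0.
apply: ler_wpDr => //.
rewrite (@eq_ddiff _ x y (fun j => f 0%N (x j))) => [|j hj]; last by rewrite /y h// bi.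
set z := fun j => f 0%N (x j).
have mv j : exists2 t, x j <= t <= x (j + m')%N & ddiff x z m' j = f m' t / (m')`!%:R.
  have [t tx ft] := @ddiff_mean_value _ (f 0%N) m' x j
       (fun n t nk => jet_derivable jf nk) xlt.
  by exists t => //; rewrite -(jet_derive jf (leqnn m')) ft mulrC mulKf.
have [t1 /andP[a1 b1] E1] := mv i.+1; have [t2 /andP[a2 b2] E2] := mv i.
have -> : ddiff x z m i = (x (i + m)%N - x i)^-1 * ((f m' t1 - f m' t2) / (m')`!%:R).
  have := ddiffS xlt z m' i; rewrite E1 E2 -mulrBl => <-.
  by rewrite mulKf// gt_eqF.
rewrite normrM gtr0_norm ?invr_gt0// ler_wpM2l ?invr_ge0 ?(ltW L0)//.
apply: divr_fact_le.
have T s t : x i <= s -> s <= t -> t <= x (i + m)%N ->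
    `|f m' t - f m' s| <= \int[mu]_(t in `[x i, x (i + m)%N]) `|f m t|.
  move=> is_ st ti; rewrite (jet_primitive jf)//.
  apply: (le_trans (le_norm_integral _ _ lw)).
  have ln := locint_norm lw.
  rewrite (Rintegral_split ln is_ (le_trans st ti)) (Rintegral_split ln st ti).
  by rewrite addrCA lerDl addr_ge0//; exact: Rintegral_ge0.
have i1 : x i <= t1 by rewrite (le_trans _ a1)// ltW.
have i2 : t1 <= x (i + m)%N by rewrite /m -addSnnS.
have i3 : t2 <= x (i + m)%N by rewrite (le_trans b2)// nodes_le// leq_add2l.
have [t12|t21] := leP t1 t2; last by apply: T => //; exact: ltW.
by rewrite distrC; apply: T.
Qed.

End nodes.

Variables (m' : nat) (f : nat -> R -> R).
Hypothesis jf : sobolev_jet m' f.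
Let m := m'.+1.

(** A single integrable function that controls all derivatives locally. *)
Definition jet_sum (t : R) := \sum_(s < m.+1) `|f s t|.

Lemma locint_sum (I : Type) (r : seq I) (P : pred I) (g : I -> R -> R) :
  (forall i, P i -> locint (g i)) -> locint (fun t => \sum_(i <- r | P i) g i t).
Proof.
move=> h; elim: r => [|i r IH].
  by under eq_fun do rewrite big_nil; apply: continuous_locint => t; exact: cvg_cst.
have [Pi|Pi] := boolP (P i); last by under eq_fun do rewrite big_cons (negbTE Pi).
by under eq_fun do rewrite big_cons Pi; apply: (locally_integrableD _ IH); exact: h.
Qed.

Lemma locint_jet_sum : locint jet_sum.
Proof.
apply: locint_sum => s _; apply: locint_norm; apply: (jet_locint jf).
by rewrite -ltnS.
Qed.

Lemma jet_sum_ge0 t : 0 <= jet_sum t.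
Proof. exact: sumr_ge0. Qed.

(** On a unit interval a function is at most its mean plus the integral of
    its derivative. *)
Lemma jet_sup_bound s (c t : R) : (s <= m')%N -> c <= t <= c + 1 ->
  `|f s t| <= \int[mu]_(u in `[c, (c + 1)]) jet_sum u.
Proof.
move=> sm /andP[ct tc].
have ls : locint (f s) by apply: (jet_locint jf); exact: leqW.
have lS : locint (f s.+1) by apply: (jet_locint jf).
set I := \int[mu]_(u in `[c, (c + 1)]) `|f s.+1 u|.
have d u v : c <= u -> u <= v -> v <= c + 1 -> `|f s v - f s u| <= I.
  move=> cu uv vc; rewrite (jet_primitive jf)//.
  apply: (le_trans (le_norm_integral _ _ lS)).
  have ln := locint_norm lS.
  rewrite /I (Rintegral_split ln cu (le_trans uv vc)) (Rintegral_split ln uv vc).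
  by rewrite addrCA lerDl addr_ge0//; exact: Rintegral_ge0.
have c1 : c <= c + 1 by rewrite lerDl.
have lc (k : R) : locint (cst k) by apply: continuous_locint => u; exact: cvg_cst.
have len (k : R) : \int[mu]_(u in `[c, (c + 1)]) k = k.
  rewrite Rintegral_cst//= lebesgue_measure_itv/= lte_fin ltrDl ltr01 -EFinD/=.
  by rewrite addrAC subrr add0r mulr1.
rewrite -[X in X <= _]len.
apply: (@le_trans _ _ (\int[mu]_(u in `[c, (c + 1)]) (`|f s u| + I))).
  apply: le_Rintegral => //.
  - by apply: locint_integrable; exact: lc.
  - apply: locint_integrable; apply: (locally_integrableD (locint_norm ls)); exact: lc.
  move=> u; rewrite /= in_itv/= => /andP[cu uc].
  have -> : f s t = f s u + (f s t - f s u) by ring.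
  apply: (le_trans (ler_normD _ _)); rewrite lerD2l.
  have [ut|tu] := leP u t; first exact: d.
  by rewrite distrC; apply: d => //; exact: ltW.
rewrite Rintegral_itvD; [|exact: locint_norm|exact: lc].
rewrite len /I -Rintegral_itvD; [|exact: locint_norm|exact: locint_norm].
apply: le_Rintegral => //.
- by apply: locint_integrable; apply: locally_integrableD; exact: locint_norm.
- by apply: locint_integrable; exact: locint_jet_sum.
move=> u _; rewrite /jet_sum.
have sm1 : (s < m.+1)%N by rewrite ltnS leqW.
have sm2 : (s.+1 < m.+1)%N by [].
rewrite (bigD1 (Ordinal sm1))//= lerD2l (bigD1 (Ordinal sm2))/=; last first.
  by rewrite -val_eqE /= gtn_eqF.
by rewrite lerDl sumr_ge0.
Qed.

(** The integral over the unit cell at offset [r] from the cell of [t]. It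
    is constant on cells, so averaging bounds its L_p norm. *)
Definition cell_integral (r : int) (t : R) : R :=
  \int[mu]_(u in `[(Num.floor t + r)%:~R, (Num.floor t + r)%:~R + 1]) jet_sum u.

Definition window_integral (N : nat) (t : R) : R :=
  \sum_(r < (N + N).+1) cell_integral (r%:Z - N%:Z) t.

Lemma cell_integral_ge0 r t : 0 <= cell_integral r t.
Proof. by apply: Rintegral_ge0 => u _; exact: jet_sum_ge0. Qed.

Lemma window_integral_ge0 N t : 0 <= window_integral N t.
Proof. by apply: sumr_ge0 => r _; exact: cell_integral_ge0. Qed.

Lemma jet_window_bound s N (t u : R) : (s <= m')%N -> `|u - t| <= N%:R ->
  `|f s u| <= window_integral N t.
Proof.
move=> sm ut.
have fu := floor_itv u; have ft := floor_itv t.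
have [k kE kN] : exists2 k : nat, Num.floor u = Num.floor t + (k%:Z - N%:Z) &
    (k < (N + N).+1)%N.
  have : (Num.floor t - N%:Z <= Num.floor u)%R.
    rewrite floor_ge_int intrB; move: ut ft; rewrite ler_norml => /andP[a1 a2] /andP[a3 a4].
    by rewrite -pmulrn; lra.
  have : (Num.floor u <= Num.floor t + N%:Z)%R.
    rewrite -ltzD1 -(ltr_int R) !intrD -pmulrn.
    move: ut fu ft; rewrite ler_norml !intrD => /andP[a1 a2] /andP[a3 a4] /andP[a5 a6].
    by lra.
  move=> h1 h2; exists `|(Num.floor u - Num.floor t + N%:Z)%R|%N; last by lia.
  by rewrite gez0_abs; lia.
rewrite /window_integral (bigD1 (Ordinal kN))//=; apply: ler_wpDr.
  by apply: sumr_ge0 => r _; exact: cell_integral_ge0.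
rewrite /cell_integral -kE; apply: jet_sup_bound => //.
by move: fu; rewrite intrD => /andP[-> /ltW].
Qed.

End sobolev_jets.

(** * L_p bounds for local averages of a jet *)

Section countable_averages.
Context d (T : measurableType d) (R : realType) (C : countType).
Variable mu : {measure set T -> \bar R}.

Lemma measurable_fun_step (J : C -> set T) (a : C -> R) (h : T -> R) :
  (forall c, measurable (J c)) -> (forall t, exists c, J c t) ->
  (forall c t, J c t -> h t = a c) -> measurable_fun setT h.
Proof.
move=> mJ cov hJ _ Y mY; rewrite setTI.
have -> : h @^-1` Y = \bigcup_(c in [set: C]) (if `[< Y (a c) >] then J c else set0).
  apply/seteqP; split=> [t Yt|t [c _]].
    have [c Jc] := cov t; exists c => //; case: asboolP => //.
    by rewrite -(hJ c t Jc).
  by case: asboolP => // Yc Jc; rewrite /preimage/= (hJ c t Jc).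
apply: countable_bigcupT_measurable; first exact: countableP.
by move=> c; case: asboolP.
Qed.

Lemma Lnorm_average_countable (p : \bar R) (I J : C -> set T) (a : C -> R) (g h : T -> R) :
  (1 < p)%E -> (forall i, measurable (I i)) -> (forall i, measurable (J i)) ->
  trivIset setT I -> trivIset setT J ->
  (forall i, (mu (J i) <= mu (I i))%E) -> (forall i, (mu (I i) < +oo)%E) ->
  measurable_fun setT g -> measurable_fun setT h ->
  (forall i, 0 <= a i) ->
  (forall i, ((a i)%:E * mu (I i) <= \int[mu]_(x in I i) `|g x|%:E)%E) ->
  (forall i x, J i x -> `|h x| <= a i) ->
  (forall x, (forall i, ~ J i x) -> h x = 0) ->
  ('N[mu]_p[EFin \o h] <= 'N[mu]_p[EFin \o g])%E.
Proof.
move=> p1 mI mJ tI tJ JI Ioo mg mh a0 ha hJ h0.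
(* Transport the countable family to [nat], with the empty set at unused
   codes. *)
pose E (F : C -> set T) n := oapp F set0 (@pickle_inv C n).
have mE F : (forall i, measurable (F i)) -> forall n, measurable (E F n).
  by move=> mF n; rewrite /E; case: (pickle_inv n) => [c|]/=; [exact: mF|exact: measurable0].
have tE F : trivIset setT F -> trivIset setT (E F).
  move=> /trivIsetP tF; apply/trivIsetP => i j _ _ ij; rewrite /E.
  have := pickle_invK (T := C) i; have := pickle_invK (T := C) j.
  case: pickle_inv => [c|] /=; last by rewrite setI0.
  case: pickle_inv => [c'|] /=; last by rewrite set0I.
  move=> cj ci; apply: tF => //; apply: contra_neq ij => cc.
  by rewrite -ci -cj cc.
apply: (@Lnorm_average _ _ _ mu p (E I) (E J) (fun n => oapp a 0 (@pickle_inv C n))) => //.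
- exact: mE.
- exact: mE.
- exact: tE.
- exact: tE.
- by move=> i; rewrite /E; case: pickle_inv => //=; rewrite !measure0.
- by move=> i; rewrite /E; case: pickle_inv => //=; rewrite measure0.
- by move=> i; case: pickle_inv.
- by move=> i; rewrite /E; case: pickle_inv => //=; rewrite measure0 mule0 integral_set0.
- by move=> i x; rewrite /E; case: pickle_inv => //= c; exact: hJ.
- move=> x nJ; apply: h0 => c Jc; apply: (nJ (pickle c)).
  by rewrite /E pickleK_inv.
Qed.

End countable_averages.

Section Lnorm_algebra.
Context d (T : measurableType d) (R : realType).
Variable mu : {measure set T -> \bar R}.
Implicit Types (f g : T -> R).

Lemma Lnorm_sum_le (p : \bar R) (I : Type) (r : seq I) (g : I -> T -> R) :
  (1 <= p)%E -> (forall i, measurable_fun setT (g i)) ->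
  ('N[mu]_p[EFin \o (fun t => (\sum_(i <- r) g i t)%R)] <= \sum_(i <- r) 'N[mu]_p[EFin \o g i])%E.
Proof.
move=> p1 mg; elim: r => [|i r IH].
  rewrite big_nil; have -> : EFin \o (fun t => \sum_(i <- [::]) g i t) = cst 0%E.
    by apply/funext => t; rewrite /= big_nil.
  by rewrite Lnorm0// gt_eqF// (lt_le_trans _ p1).
rewrite big_cons; apply: le_trans (leeD (lexx _) IH).
have -> : (fun t => \sum_(j <- i :: r) g j t) = (g i \+ (fun t => \sum_(j <- r) g j t)).
  by apply/funext => t; rewrite /= big_cons.
apply: eminkowski => //; exact: measurable_sum.
Qed.

Lemma LnormZ_le (p : \bar R) (c : R) f : (1 <= p)%E -> 0 <= c -> measurable_fun setT f ->
  ('N[mu]_p[EFin \o (fun t => (c * f t)%R)] <= c%:E * 'N[mu]_p[EFin \o f])%E.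
Proof.
move=> p1; rewrite le_eqVlt => /predU1P[<-|c0] mf.
  rewrite mul0e; have -> : EFin \o (fun t => 0 * f t) = cst 0%E.
    by apply/funext => t; rewrite /= mul0r.
  by rewrite Lnorm0// gt_eqF// (lt_le_trans _ p1).
case: p p1 => [p||]// p1.
  have p0 : 0 < p by rewrite (lt_le_trans ltr01).
  have cN : (0 <= c%:E * 'N[mu]_p%:E[EFin \o f])%E.
    by apply: mule_ge0; [rewrite lee_fin ltW|exact: Lnorm_ge0].
  apply: (le_Lnorm_powR p0 cN).
  rewrite poweRM; [|by rewrite lee_fin ltW|exact: Lnorm_ge0].
  rewrite poweR_EFin.
  have -> : (\int[mu]_x ((`|c * f x| `^ p)%R)%:E = \int[mu]_x ((c `^ p)%:E * (`|f x| `^ p)%:E))%E.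
    apply: eq_integral => x _; rewrite -EFinM normrM (gtr0_norm c0) powRM//.
    exact: ltW.
  rewrite ge0_integralZl//.
  - apply: lee_wpmul2l; first by rewrite lee_fin powR_ge0.
    by apply: Lnorm_powR_le => //; exact: Lnorm_ge0.
  - exact: measurable_normr_powR.
  - by rewrite lee_fin powR_ge0.
apply/Lnormy_ae.
  by apply: mule_ge0; [rewrite lee_fin ltW|exact: Lnorm_ge0].
have /Lnormy_ae := lexx ('N[mu]_+oo[EFin \o f])%E => /(_ (Lnorm_ge0 _ _ _)).
apply: filterS => x h; rewrite normrM (gtr0_norm c0) EFinM.
by apply: lee_wpmul2l => //; rewrite lee_fin ltW.
Qed.

End Lnorm_algebra.

Section jet_norms.
Context (R : realType).
Local Notation mu := (@lebesgue_measure R).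
Local Notation locint := (locally_integrable [set: R]).
Variables (m' : nat) (f : nat -> R -> R) (p : \bar R).
Hypothesis jf : sobolev_jet m' f.
Hypothesis p1 : (1 < p)%E.
Let m := m'.+1.
Local Notation "'N[ g ]" := (Lnorm mu p (EFin \o g)) (at level 0).

Definition jet_norm := (\sum_(s < m.+1) 'N[mu]_p[EFin \o f s])%E.

Let p1' : (1 <= p)%E. Proof. exact: ltW. Qed.

Lemma measurable_jet s : (s <= m)%N -> measurable_fun setT (f s).
Proof. by move=> sm; have [] := jet_locint jf sm. Qed.

Lemma measurable_jet_sum : measurable_fun setT (jet_sum m' f).
Proof. by have [] := locint_jet_sum jf. Qed.

Lemma Lnorm_jet_sum : ('N[mu]_p[EFin \o jet_sum m' f] <= jet_norm)%E.
Proof.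
pose g (s : 'I_m.+1) t := `|f s t|.
have mg s : measurable_fun setT (g s).
  by apply: measurableT_comp => //; apply: measurable_jet; rewrite -ltnS.
apply: (le_trans (@Lnorm_sum_le _ _ _ mu p _ (index_enum _) g p1' mg)).
apply: lee_sum => s _; apply: le_Lnorm; [exact: p1'|exact: mg| |].
  by apply: measurable_jet; rewrite -ltnS.
by move=> t; rewrite normr_id.
Qed.

Lemma Rintegral_itvco (g : R -> R) a b : locint g ->
  (\int[mu]_(t in `[a, b]) `|g t|)%:E = (\int[mu]_(t in `[a, b[) `|g t|%:E)%E.
Proof.
move=> lg; have lng := locint_norm lg.
have ig := locint_integrable a b lng.
rewrite /Rintegral fineK; last exact: integrable_fin_num.
rewrite (@integral_itv_bndo_bndc R (BLeft a) b (fun t => `|g t|%:E))//.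
by apply/measurable_EFinP; case: lng => mg _ _; exact: measurable_funTS.
Qed.

Let cell (r j : int) : set R := `[(j + r)%:~R, (j + r)%:~R + 1[%classic.

Let cellE r j t : cell r j t = (j = Num.floor t - r).
Proof.
rewrite /cell/= in_itv/=; apply/propext; split => [h|->].
  have := @floor_def R t (j + r); rewrite [(j + r + 1)%:~R]intrD => /(_ h) ->.
  by rewrite addrK.
have := floor_itv t; rewrite subrK [(_ + 1)%:~R]intrD; exact.
Qed.

Let trivIset_cell r : trivIset setT (cell r).
Proof.
apply/trivIsetP => i j _ _ ij; apply/seteqP; split=> // t []; rewrite !cellE => ti tj.
by move: ij; rewrite ti tj eqxx.
Qed.

Let mu_cell r j : mu (cell r j) = 1%E.
Proof.
rewrite /cell lebesgue_measure_itv/= lte_fin ltrDl ltr01 -EFinD/=.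
by rewrite addrAC subrr add0r.
Qed.

Lemma measurable_cell_integral r : measurable_fun setT (cell_integral m' f r).
Proof.
apply: (@measurable_fun_step _ _ _ int (cell 0)
  (fun j => \int[mu]_(u in `[(j + r)%:~R, (j + r)%:~R + 1]) jet_sum m' f u)).
- by move=> j; exact: measurable_itv.
- by move=> t; exists (Num.floor t); rewrite cellE subr0.
- by move=> j t; rewrite cellE subr0 => ->.
Qed.

Lemma Lnorm_cell_integral r : ('N[mu]_p[EFin \o cell_integral m' f r] <= jet_norm)%E.
Proof.
apply: le_trans Lnorm_jet_sum.
pose a (j : int) := \int[mu]_(u in `[(j + r)%:~R, (j + r)%:~R + 1]) `|jet_sum m' f u|.
have aE j : a j = \int[mu]_(u in `[(j + r)%:~R, (j + r)%:~R + 1]) jet_sum m' f u.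
  by apply: eq_Rintegral => u _; rewrite ger0_norm//; exact: jet_sum_ge0.
apply: (@Lnorm_average_countable _ _ _ int mu p (cell r) (cell 0) a) => //.
- by move=> j; exact: measurable_itv.
- by move=> j; exact: measurable_itv.
- by move=> j /=; rewrite !mu_cell.
- by move=> j /=; rewrite mu_cell ltry.
- exact: measurable_jet_sum.
- exact: measurable_cell_integral.
- by move=> j; apply: Rintegral_ge0.
- move=> j /=; rewrite mu_cell mule1 /a Rintegral_itvco//; exact: (locint_jet_sum jf).
- move=> j t; rewrite cellE subr0 => ->.
  by rewrite ger0_norm ?aE//; exact: cell_integral_ge0.
- by move=> t /(_ (Num.floor t)); rewrite cellE subr0.
Qed.

Lemma measurable_window N : measurable_fun setT (window_integral m' f N).
Proof. by apply: measurable_sum => r; exact: measurable_cell_integral. Qed.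

Lemma Lnorm_window N :
  ('N[mu]_p[EFin \o window_integral m' f N] <= ((N + N).+1)%:R%:E * jet_norm)%E.
Proof.
pose g (r : 'I_(N + N).+1) := cell_integral m' f (r%:Z - N%:Z).
apply: (le_trans (@Lnorm_sum_le _ _ _ mu p _ (index_enum _) g p1' _)).
  by move=> r; exact: measurable_cell_integral.
apply: (@le_trans _ _ (\sum_(r < (N + N).+1) jet_norm)%E).
  by apply: lee_sum => r _; exact: Lnorm_cell_integral.
have jet_norm_ge0 : (0 <= jet_norm)%E by apply: sume_ge0 => s _; exact: Lnorm_ge0.
elim: (N + N).+1 => [|k IH]; first by rewrite big_ord0 mul0e.
rewrite big_ord_recr -natr1 EFinD ge0_muleDl ?lee_fin// mul1e.
exact: leeD.
Qed.

Variable x : nat -> R.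
Hypothesis xlt : forall i, x i < x i.+1.

Definition span_average i :=
  (x (i + m)%N - x i)^-1 * \int[mu]_(t in `[x i, x (i + m)%N]) `|f m t|.

Let span i : set R := `[x i, x (i + m)%N[%classic.

(** The spans of [m + 1] consecutive nodes overlap, but those whose indices
    are congruent modulo [m] are disjoint. So averages over all spans are
    summed class by class. *)
Definition class_average n r (t : R) : R :=
  \sum_(k < n) span_average (r + m * k) * \1_(span (r + m * k)) t.

Lemma span_average_ge0 i : 0 <= span_average i.
Proof.
rewrite mulr_ge0 ?invr_ge0 ?subr_ge0 ?nodes_le ?leq_addr//.
exact: Rintegral_ge0.
Qed.

Lemma class_average_ge0 n r t : 0 <= class_average n r t.
Proof. by apply: sumr_ge0 => k _; rewrite mulr_ge0// span_average_ge0. Qed.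

(** The span that starts at [i] occurs in the class of [i] modulo [m], at
    position [i / m]. *)
Lemma class_average_ge n i t : (i < n)%N -> x i <= t -> t < x (i + m)%N ->
  span_average i <= class_average n (i %% m) t.
Proof.
move=> in_ xt tx.
have kn : (i %/ m < n)%N by rewrite (leq_ltn_trans _ in_)// leq_div.
rewrite /class_average (bigD1 (Ordinal kn))//=.
have -> : (i %% m + m * (i %/ m))%N = i by rewrite mulnC addnC -divn_eq.
rewrite indicE mem_set ?mulr1; last by rewrite /span/= in_itv/= xt tx.
apply: ler_wpDr => //.
by apply: sumr_ge0 => k _; rewrite mulr_ge0// span_average_ge0.
Qed.

Lemma measurable_class_average n r : measurable_fun setT (class_average n r).
Proof.
apply: measurable_sum => k; apply: measurable_funM; first exact: measurable_cst.
by apply: measurable_indic; exact: measurable_itv.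
Qed.

Lemma Lnorm_class_average n r : ('N[mu]_p[EFin \o class_average n r] <= jet_norm)%E.
Proof.
apply: (@le_trans _ _ ('N[mu]_p[EFin \o f m])%E); last first.
  rewrite /jet_norm (bigD1 ord_max)//=; apply: leeDl.
  by apply: sume_ge0 => s _; exact: Lnorm_ge0.
(* Consecutive members of the class share at most an end point, which is
   excluded on the right. *)
pose J k := if (k < n)%N then span (r + m * k)%N else set0.
have tJ : trivIset setT J.
  apply/trivIsetP => i j _ _; wlog ij : i j / (i < j)%N.
    move=> H ne; have [h|h|h] := ltngtP i j; first exact: H.
      by rewrite setIC; apply: H => //; rewrite eq_sym.
    by rewrite h eqxx in ne.
  move=> _; rewrite /J; case: ifP => _; last by rewrite set0I.
  case: ifP => _; last by rewrite setI0.
  apply/seteqP; split => // t []; rewrite /span/= !in_itv/= => /andP[_ t1] /andP[t2 _].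
  have : x (r + m * i + m)%N <= x (r + m * j)%N.
    by apply: nodes_le => //; rewrite -addnA leq_add2l -mulnSr leq_mul2l ij orbT.
  by move=> h; have := lt_le_trans t1 (le_trans h t2); rewrite ltxx.
have L0 i : 0 < x (i + m)%N - x i by rewrite subr_gt0 nodes_lt// -addSnnS leq_addr.
have muspan i : mu (span i) = (x (i + m)%N - x i)%:E.
  by rewrite /span lebesgue_measure_itv/= lte_fin -subr_gt0 L0 -EFinD.
apply: (@Lnorm_average _ _ _ mu p J J (fun k => span_average (r + m * k)%N)) => //.
- by move=> k; rewrite /J; case: ifP => // _; exact: measurable_itv.
- by move=> k; rewrite /J; case: ifP => // _; exact: measurable_itv.
- move=> k; rewrite /J; case: ifP => _; last by rewrite measure0 ltry.
  by rewrite /= muspan ltry.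
- exact: measurable_jet.
- exact: measurable_class_average.
- by move=> k; exact: span_average_ge0.
- move=> k; rewrite /J; case: ifP => _; last by rewrite measure0 mule0 integral_set0.
  rewrite /= muspan -EFinM /span_average mulrAC mulVf ?gt_eqF// mul1r.
  by rewrite Rintegral_itvco//; exact: (jet_locint jf).
- move=> k t Jt; rewrite ger0_norm; last exact: class_average_ge0.
  have kn : (k < n)%N by move: Jt; rewrite /J; case: ifP.
  rewrite /class_average (bigD1 (Ordinal kn))//= big1 ?addr0.
    by rewrite ler_piMr ?span_average_ge0// indicE; case: (_ \in _).
  move=> j jk; rewrite indicE memNset ?mulr0// => sj.
  have /trivIsetP/(_ k j I I) := tJ.
  have kj : (k == j :> nat) = false by apply/negbTE; rewrite eq_sym.
  rewrite kj => /(_ isT)/seteqP[/(_ t) + _]; apply; split => //.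
  by rewrite /J ltn_ord.
- move=> t nJ; apply: big1 => k _; rewrite indicE memNset ?mulr0// => sk.
  by apply: (nJ k); rewrite /J ltn_ord.
Qed.

End jet_norms.

(** * Sobolev bounds for the interpolant *)

Section interpolant_sobolev.
Context (R : realType).
Local Notation mu := (@lebesgue_measure R).
Variables (m' : nat).
Let m := m'.+1.

(** The nodes marked by [b] are the points where data are prescribed. The
    gaps keep every span below [3m]; the separation makes the spans of mixed
    nodes at least 1. *)
Record node_system (x : nat -> R) (b : nat -> bool) (n : nat) : Prop := NodeSystem {
  node_lt : forall i, x i < x i.+1;
  node_gap : forall i, x i.+1 - x i <= 3;
  node_unbounded : forall t, exists i, t < x i;
  node_sep : forall i j, (i < j)%N -> b i != b j -> 1 <= x j - x i;
  node_first : forall i, (i < m + m)%N -> b i = false;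
  node_last : forall i, (n <= i)%N -> b i = false }.

Definition node_values (x : nat -> R) (b : nat -> bool) (F : R -> R) j :=
  if b j then F (x j) else 0.

Let W : R := (3 * m)%:R.
Let N : nat := (6 * m)%N.

(** The constants of the two parts of [interpolant_jet_lo] for spans of
    length at most [3m], times the loss [2^m] of [ddiff_lo_bound]. *)
Definition interpolant_const (K : R) : R :=
  (m%:R * (W ^+ m * m%:R ^+ m) + m%:R * (K * (m' + m)%:R ^+ m * (2 * W ^+ m))) * 2 ^+ m.

Section bounds.
Variables (x : nat -> R) (b : nat -> bool) (n : nat) (f : nat -> R -> R) (K : R).
Hypothesis ns : node_system x b n.
Hypothesis jf : sobolev_jet m' f.
Hypothesis hK : forall r u, (r <= m)%N -> `|(@step R)^`(r) u| <= K.
Let xlt := node_lt ns.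
Let y := node_values x b (f 0%N).
Let u := interpolant x m' n y.

Let span_le i j : (i <= j)%N -> x j - x i <= (3 * (j - i))%:R.
Proof.
move=> /subnKC <-; rewrite addKn; elim: (j - i)%N => [|k IH].
  by rewrite addn0 subrr muln0.
have := node_gap ns (i + k); rewrite addnS mulnS natrD; move: IH; lra.
Qed.

Let y_lo j : (j < m + m)%N -> y j = 0.
Proof. by move=> jm; rewrite /y /node_values (node_first ns). Qed.

Let y_hi j : (n <= j)%N -> y j = 0.
Proof. by move=> jn; rewrite /y /node_values (node_last ns). Qed.

Let K0 : 0 <= K.
Proof. by apply: le_trans (@hK 0%N 0 isT); exact: normr_ge0. Qed.

Let find_cell t : x m <= t -> exists l, [/\ x l <= t, t < x l.+1 & (m <= l)%N].
Proof.
move=> mt; have [i ti] := node_unbounded ns t.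
have ex : exists i, t < x i by exists i.
case: (ex_minnP ex) => -[|l] tl lmin.
  have : x 0%N <= x m by apply: nodes_le.
  by move=> h; have := lt_le_trans tl (le_trans h mt); rewrite ltxx.
have xl : x l <= t.
  by rewrite leNgt; apply/negP => /lmin; rewrite ltnn.
exists l; split => //; rewrite leqNgt; apply/negP => lm.
have : x l.+1 <= x m by apply: nodes_le.
by move=> h; have := lt_le_trans tl (le_trans h mt); rewrite ltxx.
Qed.

Let W1 : 1 <= W.
Proof. by rewrite /W ler1n. Qed.

Let spanW i : x (i + m)%N - x i <= W.
Proof. by have := span_le (leq_addr m i); rewrite addKn. Qed.

Section at_point.
Variables (l : nat) (t : R).
Hypothesis lt : x l <= t.
Hypothesis tl : t < x l.+1.
Hypothesis ml : (m <= l)%N.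

Let near_nodes j v : (l.+1 - m <= j)%N -> (j <= l.+1)%N ->
  x j <= v <= x (j + m)%N -> `|v - t| <= N%:R.
Proof.
move=> j1 j2 /andP[jv vj].
have h1 : x l.+1 - x (l.+1 - m)%N <= W.
  by have := spanW (l.+1 - m); rewrite subnK// leqW.
have h2 : x (l.+1 - m)%N <= x j by apply: nodes_le.
have h3 : x (j + m)%N <= x (l.+1 + m)%N by apply: nodes_le => //; rewrite leq_add2r.
have h4 := spanW l.+1.
have h5 : x l <= x l.+1 by exact: ltW.
have h6 : x l.+1 - x l <= 3 := node_gap ns l.
have N2 : N%:R = W + W by rewrite /N /W -natrD; congr (_%:R); rewrite -mulnDl.
have W3 : 3 <= W by rewrite /W ler_nat leq_pmulr.
rewrite ler_norml N2; apply/andP; split.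
  by move: lt tl; lra.
by move: lt tl; lra.
Qed.

Let B := window_integral m' f N t.

Let B0 : 0 <= B. Proof. exact: window_integral_ge0. Qed.

Let fB j s v : (l.+1 - m <= j)%N -> (j <= l.+1)%N -> (s <= m')%N ->
  x j <= v <= x (j + m)%N -> `|f s v| <= B.
Proof. by move=> j1 j2 sm h; apply: (jet_window_bound jf sm); exact: near_nodes h. Qed.

Lemma interpolant_lo_at s : (s < m)%N ->
  `|derive1n s u t| <= interpolant_const K * B.
Proof.
move=> sm; rewrite /interpolant_const -mulrA.
apply: (interpolant_jet_lo xlt W1 hK _ y_hi lt (ltW tl)) => //.
- by move=> j jm; apply: y_lo; rewrite ltn_addl.
- move=> k j km /andP[j1 j2]; apply: (@le_trans _ _ (2 ^+ k * B)); last first.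
    by rewrite ler_wpM2r//; apply: ler_weXn2l; [rewrite ler1n|exact: ltnW].
  apply: (ddiff_lo_bound jf xlt (node_sep ns)) => // s' v sk /andP[jv vk].
  apply: (fB j1 j2); first by rewrite (leq_trans sk).
  rewrite jv (le_trans vk)//; apply: nodes_le => //.
  by rewrite leq_add2l ltnW.
Qed.

Lemma interpolant_hi_at :
  `|derive1n m u t| <= K * (m' + m)%:R ^+ m *
    (m%:R * (2 ^+ m * B + \sum_(r < m) class_average m' f x n r t)).
Proof.
have ylo j : (j < m)%N -> y j = 0 by move=> jm; apply: y_lo; rewrite ltn_addl.
apply: (le_trans (interpolant_jet_hi xlt n hK ylo lt (ltW tl))).
apply: ler_wpM2l; first by rewrite mulr_ge0// exprn_ge0.
have S0 : 0 <= \sum_(r < m) class_average m' f x n r t.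
  by apply: sumr_ge0 => r _; exact: class_average_ge0.
apply: (@le_trans _ _ (\sum_(l.+1 - m <= i < l.+1) (2 ^+ m * B + \sum_(r < m) class_average m' f x n r t))).
  rewrite big_nat_cond [X in _ <= X]big_nat_cond; apply: ler_sum => i.
  rewrite andbT => /andP[qi il].
  have [ni|in_] := leqP n i.
    rewrite (@eq_ddiff _ x y (fun=> 0)) => [|j /andP[ij _]]; last by apply: y_hi; exact: leq_trans ij.
    by rewrite ddiff_0 normr0 addr_ge0// mulr_ge0// exprn_ge0.
  rewrite addrC.
  apply: (le_trans (@ddiff_hi_bound _ _ _ _ _ jf xlt (node_sep ns) i B _)).
    by move=> s v sm h; apply: (fB qi (ltnW il) sm h).
  rewrite lerD2r.
  have im : (i %% m < m)%N by rewrite ltn_mod.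
  rewrite (bigD1 (Ordinal im))//=; apply: ler_wpDr.
    by apply: sumr_ge0 => r _; exact: class_average_ge0.
  apply: (class_average_ge f xlt in_).
    by apply: le_trans lt; apply: nodes_le.
  apply: (lt_le_trans tl); apply: nodes_le => //.
  by move: qi; rewrite leq_subLR addnC.
rewrite sumr_const_nat -[X in X <= _]mulr_natl ler_wpM2r//.
  by rewrite addr_ge0// mulr_ge0// exprn_ge0.
by rewrite ler_nat leq_subCl.
Qed.

End at_point.

Lemma interpolant_lo s t : (s < m)%N ->
  `|derive1n s u t| <= interpolant_const K * window_integral m' f N t.
Proof.
move=> sm; have [mt|tm] := leP (x m) t.
  by have [l [lt tl ml]] := find_cell mt; exact: (interpolant_lo_at lt tl ml sm).
rewrite (interpolant_left xlt n s tm y_lo).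
rewrite normr0 mulr_ge0//; last exact: window_integral_ge0.
by rewrite !(mulr_ge0, addr_ge0, exprn_ge0)// (le_trans ler01).
Qed.

Lemma interpolant_hi t :
  `|derive1n m u t| <= K * (m' + m)%:R ^+ m *
    (m%:R * (2 ^+ m * window_integral m' f N t + \sum_(r < m) class_average m' f x n r t)).
Proof.
have [mt|tm] := leP (x m) t.
  by have [l [lt tl ml]] := find_cell mt; exact: (interpolant_hi_at lt tl ml).
rewrite (interpolant_left xlt n m tm y_lo).
rewrite normr0 !(mulr_ge0, addr_ge0, exprn_ge0)//; first exact: window_integral_ge0.
by apply: sumr_ge0 => r _; exact: class_average_ge0.
Qed.

Variable p : \bar R.
Hypothesis p1 : (1 < p)%E.

Definition top_const : R :=
  K * (m' + m)%:R ^+ m * m%:R * (2 ^+ m * ((N + N).+1)%:R + m%:R).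

(** The m-th derivative is bounded by the integral of the jet over a window
    and by averages of [f m] over spans. Averaging does not increase L_p
    norms. *)
Lemma Lnorm_interpolant_hi :
  ('N[mu]_p[EFin \o (derive1n m u)] <= top_const%:E * jet_norm m' f p)%E.
Proof.
have p1' : (1 <= p)%E by exact: ltW.
pose A := window_integral m' f N.
pose S t := \sum_(r < m) class_average m' f x n r t.
have mA : measurable_fun setT A by exact: measurable_window.
have mS : measurable_fun setT S by apply: measurable_sum => r; exact: measurable_class_average.
have m2A : measurable_fun setT (fun t => 2 ^+ m * A t).
  by apply: measurable_funM => //; exact: measurable_cst.
have c0 : 0 <= K * (m' + m)%:R ^+ m * m%:R by rewrite !mulr_ge0 ?exprn_ge0.
have S0 t : 0 <= S t by apply: sumr_ge0 => r _; exact: class_average_ge0.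
have A0 t : 0 <= A t by exact: window_integral_ge0.
have mu_ : measurable_fun setT (derive1n m u).
  apply: continuous_measurable_fun; apply: smooth_continuous; apply: smooth_derive1n.
  exact: smooth_interpolant.
have msum : measurable_fun setT (fun t => 2 ^+ m * A t + S t) by exact: measurable_funD.
apply: (@le_trans _ _ 'N[mu]_p[EFin \o (fun t => (K * (m' + m)%:R ^+ m * m%:R * (2 ^+ m * A t + S t))%R)]%E).
  apply: le_Lnorm => //.
    by apply: measurable_funM => //; exact: measurable_cst.
  move=> t; apply: (le_trans (interpolant_hi t)).
  rewrite mulrA -/m ger0_norm//.
  by rewrite mulr_ge0// addr_ge0// mulr_ge0// exprn_ge0.
apply: (le_trans (LnormZ_le mu p1' c0 msum)).
rewrite [top_const%:E]EFinM -[leRHS]muleA.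
apply: lee_wpmul2l; first by rewrite lee_fin.
apply: (le_trans (@eminkowski _ _ _ mu (fun t => 2 ^+ m * A t) S p m2A mS p1')).
have J0 : (0 <= jet_norm m' f p)%E by apply: sume_ge0 => s _; exact: Lnorm_ge0.
rewrite EFinD ge0_muleDl; last 2 first.
- by rewrite lee_fin mulr_ge0// exprn_ge0.
- by rewrite lee_fin.
apply: leeD.
  apply: (le_trans (LnormZ_le mu p1' (exprn_ge0 m (ler0n R 2)) mA)).
  rewrite EFinM -muleA; apply: lee_wpmul2l; first by rewrite lee_fin exprn_ge0.
  exact: Lnorm_window.
apply: (le_trans (@Lnorm_sum_le _ _ _ mu p _ (index_enum _) (fun r : 'I_m => class_average m' f x n r) p1' _)).
  by move=> r; exact: measurable_class_average.
apply: (@le_trans _ _ (\sum_(r < m) jet_norm m' f p)%E).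
  by apply: lee_sum => r _; exact: Lnorm_class_average.
elim: m => [|k IH]; first by rewrite big_ord0 mul0e.
rewrite big_ord_recr -natr1 EFinD ge0_muleDl ?lee_fin// mul1e.
exact: leeD.
Qed.

End bounds.

End interpolant_sobolev.

(** * Completing a finite set to a system of nodes *)

Section nodes.
Context (R : realType).
Variables (m' : nat) (e : seq R).
Let m := m'.+1.

(** Beyond the points of [e] there remain at least [2m + 1] integers on
    either side, so that the first [2m] nodes are auxiliary. *)
Definition node_range : nat := ((\max_(y <- e) (Num.truncn `|y|).+1) + (m + m).+1)%N.
Let L := node_range.

Definition far z := all (fun y => 1 <= `|z - y|) e.

Definition node_list : seq R :=
  sort <=%R (undup (e ++ [seq z <- [seq k%:R - L%:R | k <- iota 0 (L + L).+1] | far z])).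

(** Past the end of the list the nodes continue with the next integers. *)
Definition node i :=
  if (i < size node_list)%N then node_list`_i else L%:R + (i - size node_list).+1%:R.

Let node_bound y : y \in e -> `|y| + (m + m).+1%:R < L%:R.
Proof.
move=> ye; rewrite /L /node_range natrD ltrD2r.
apply: (@lt_le_trans _ _ (Num.truncn `|y|).+1%:R).
  by have /andP[_] := truncn_itv (normr_ge0 y).
by rewrite ler_nat; exact: (@leq_bigmax_seq _ _ xpredT (fun y => (Num.truncn `|y|).+1)).
Qed.

Let mem_node_list z : z \in node_list =
  (z \in e) || far z && (z \in [seq k%:R - L%:R | k <- iota 0 (L + L).+1]).
Proof. by rewrite mem_sort mem_undup mem_cat mem_filter. Qed.

Let node_list_sorted : sorted <%R node_list.
Proof. by rewrite lt_sorted_uniq_le sort_uniq undup_uniq sort_sorted//; exact: le_total. Qed.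

Let node_list_bound z : z \in node_list -> - L%:R <= z <= L%:R.
Proof.
rewrite mem_node_list => /orP[/node_bound|/andP[_ /mapP[k]]].
  have : 0 <= (m + m).+1%:R :> R by [].
  by rewrite -ler_norml; lra.
rewrite mem_iota add0n ltnS => /andP[_ kL] ->.
have : k%:R <= (L + L)%:R :> R by rewrite ler_nat.
have : 0 <= k%:R :> R by [].
by rewrite natrD => ? ?; apply/andP; split; lra.
Qed.

Let far_out z : L%:R <= `|z| -> far z.
Proof.
move=> Lz; apply/allP => y ye; have := node_bound ye.
have : 1 <= (m + m).+1%:R :> R by rewrite ler1n.
have := lerB_dist z y; lra.
Qed.

Lemma grid_lt i : node i < node i.+1.
Proof.
rewrite /node; case: (ltnP i.+1) => [iS|Si].
  by rewrite ltnW// sorted_ltn_nth ?inE//; [exact: lt_trans|exact: ltnW].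
case: ifP => [iS|/negbT]; last rewrite -leqNgt => Si'.
  have /andP[_ h] := node_list_bound (mem_nth 0 iS).
  by apply: (le_lt_trans h); rewrite ltrDl ltr0n.
by rewrite ltrD2l ltr_nat ltnS ltn_sub2r// ltnS.
Qed.

Lemma node_cases i : node i \in e \/ far (node i).
Proof.
rewrite /node; case: ifP => [iS|_].
  have := mem_nth 0 iS; rewrite mem_node_list => /orP[->|/andP[-> _]]; [by left|by right].
right; apply: far_out; rewrite ger0_norm ?addr_ge0//.
by rewrite lerDl.
Qed.

Lemma node_exists y : y \in e -> exists2 i, (i < size node_list)%N & node i = y.
Proof.
move=> ye; have yS : y \in node_list by rewrite mem_node_list ye.
by exists (index y node_list); rewrite ?index_mem// /node index_mem yS nth_index.
Qed.

Let node_int k : far (k%:R - L%:R) -> exists i, node i = k%:R - L%:R.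
Proof.
move=> fk; have [kL|Lk] := leqP k (L + L).
  have zS : k%:R - L%:R \in node_list.
    rewrite mem_node_list fk; apply/orP; right; apply/mapP; exists k => //.
    by rewrite mem_iota add0n ltnS.
  by exists (index (k%:R - L%:R) node_list); rewrite /node index_mem zS nth_index.
exists (size node_list + (k - (L + L)).-1)%N; rewrite /node ltnNge leq_addr addKn/=.
have kLL : (0 < k - (L + L))%N by rewrite subn_gt0.
rewrite prednK// natrB ?(ltnW Lk)// natrD; lra.
Qed.

Lemma grid_unbounded t : exists i, t < node i.
Proof.
have /andP[_ h] := truncn_itv (normr_ge0 t).
exists (size node_list + Num.truncn `|t|)%N; rewrite /node ltnNge leq_addr addKn/=.
apply: (le_lt_trans (ler_norm t)); apply: (lt_le_trans h).
by rewrite lerDr.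
Qed.

Let node_le0 i : - L%:R <= node i.
Proof.
rewrite /node; case: ifP => [iS|_]; first by have /andP[] := node_list_bound (mem_nth 0 iS).
by rewrite (@le_trans _ _ 0)// ?oppr_le0// addr_ge0.
Qed.

Let node_mono i k : (node i < node k) = (i < k)%N.
Proof.
apply/idP/idP => [|ik]; last by apply: nodes_lt => //; exact: grid_lt.
apply: contraTT; rewrite -leqNgt -leNgt => ki; apply: nodes_le => //; exact: grid_lt.
Qed.

(** Among the integers in a gap longer than 3, one is at distance more than
    1 from both ends. Either it is far from [e], hence a node, or a point of
    [e] near it is one. *)
Lemma grid_gap i : node i.+1 - node i <= 3.
Proof.
set t := node i; rewrite leNgt; apply/negP => gap.
have between z : (exists k, node k = z) -> t < z -> z < t + 3 -> False.
  move=> [k <-]; rewrite /t node_mono => ik h.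
  have : node k < node i.+1 by rewrite /t in h gap; lra.
  by rewrite node_mono ltnS leqNgt ik.
have tL : 0 <= t + L%:R by have := node_le0 i; rewrite -/t; lra.
have /andP[k1 k2] := truncn_itv tL; set k := Num.truncn _ in k1 k2.
(* The integer in ]t + 1, t + 2], expressed as a natural number minus [L]. *)
pose z := k.+2%:R - L%:R : R.
have kz : k.+2%:R = k%:R + 2 :> R by rewrite -addn2 natrD.
have kz' : k.+1%:R = k%:R + 1 :> R by rewrite -addn1 natrD.
have z1 : t + 1 < z by rewrite /z kz; rewrite kz' in k2; lra.
have z2 : z <= t + 2 by rewrite /z kz; lra.
have [fz|/allPn[y ye]] := boolP (far z).
  by apply: (between z); [exact: node_int|lra|lra].
rewrite -ltNge ltr_norml => /andP[y1 y2].
have [j _ jy] := node_exists ye.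
by apply: (between y); [exists j|lra|lra].
Qed.

Lemma grid_sep i j : (i < j)%N -> (node i \in e) != (node j \in e) -> 1 <= node j - node i.
Proof.
move=> ij; have nij : node i < node j by rewrite node_mono.
rewrite -[X in _ <= X]ger0_norm; last by rewrite subr_ge0 ltW.
case: (node_cases i) => [ie|/allP fi].
  rewrite ie; case: (node_cases j) => [->//|/allP fj _]; exact: fj.
case: (node_cases j) => [je _|/allP fj]; first by rewrite distrC; exact: fi.
case: (boolP (node i \in e)) => [ie _|ni]; first exact: fj.
by case: (boolP (node j \in e)) => // je _; rewrite distrC; exact: fi.
Qed.

(** The leftmost integers are all nodes, so the [i]-th node is at most the
    [i]-th of them, which lies to the left of [e]. *)
Lemma grid_first i : (i < m + m)%N -> (node i \in e) = false.
Proof.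
have left_ k : (k <= m + m)%N -> node k <= k%:R - L%:R.
  have fl j : (j <= m + m)%N -> far (j%:R - L%:R).
    move=> km; apply/allP => y ye; have := node_bound ye.
    have : j%:R <= (m + m)%:R :> R by rewrite ler_nat.
    rewrite -natr1 => h1 h2.
    have := ler_norm (- y); rewrite normrN => h3.
    have := ler_norm (- (j%:R - L%:R - y)); rewrite normrN => h4.
    lra.
  elim: k => [|j IH] im.
    have [k <-] := node_int (fl 0%N im); apply: nodes_le => //; exact: grid_lt.
  have [k kE] := node_int (fl _ im); rewrite -kE.
  apply: nodes_le; first exact: grid_lt.
  rewrite -node_mono kE; apply: (le_lt_trans (IH (ltnW im))).
  by rewrite ltrD2r ltr_nat.
move=> im; apply/negP => /node_bound.
have := left_ i (ltnW im); have := ler_norm (- node i); rewrite normrN.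
have : i%:R <= (m + m)%:R :> R by rewrite ler_nat ltnW.
rewrite -[(_.+1)%:R]natr1; lra.
Qed.

Lemma grid_last i : (size node_list <= i)%N -> (node i \in e) = false.
Proof.
move=> Si; rewrite /node ltnNge Si/=; apply/negP => /node_bound.
rewrite ger0_norm ?addr_ge0//.
have : 0 <= (m + m).+1%:R :> R by [].
have : 0 <= (i - size node_list).+1%:R :> R by [].
lra.
Qed.

Lemma node_systemP :
  node_system m' node (fun j => node j \in e) (size node_list).
Proof.
split; [exact: grid_lt|exact: grid_gap|exact: grid_unbounded|exact: grid_sep|
        exact: grid_first|exact: grid_last].
Qed.

Definition finite_extension (h : R -> R) : R -> R :=
  interpolant node m' (size node_list) (node_values node (fun j => node j \in e) h).

Lemma finite_extension_interp h y : y \in e -> finite_extension h y = h y.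
Proof.
move=> ye; have [i iS iy] := node_exists ye.
rewrite -{1}iy /finite_extension interpolantP ?(ltnW iS)//; last 2 first.
- exact: grid_lt.
- by move=> j jm; rewrite /node_values grid_first// ltn_addl.
by rewrite /node_values iy ye.
Qed.

Lemma finite_extension_linear a h1 h2 :
  finite_extension (fun u => a * h1 u + h2 u) =
  (fun t => a * finite_extension h1 t + finite_extension h2 t).
Proof.
apply/funext => t; rewrite /finite_extension /interpolant !fct_sumE mulr_sumr -big_split/=.
apply: eq_bigr => i _; rewrite !(pieceE _ (fun j => grid_lt j)).
set y1 := node_values _ _ h1; set y2 := node_values _ _ h2.
have -> : node_values node (fun j => node j \in e) (fun u => a * h1 u + h2 u) =
    (fun j => a * y1 j + y2 j).
  by apply/funext => j; rewrite /y1 /y2 /node_values; case: ifP => // _; rewrite mulr0 addr0.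
rewrite ddiffD ddiffZ.
set d1 := ddiff _ y1 _ _; set d2 := ddiff _ y2 _ _.
set q := horner _; set c := cutoff _ _ _; set w := node _ - _.
change (w * (a * d1 + d2) * q t * c t = a * (w * d1 * q t * c t) + w * d2 * q t * c t).
ring.
Qed.

Lemma eq_finite_extension h1 h2 : {in e, h1 =1 h2} ->
  finite_extension h1 = finite_extension h2.
Proof.
move=> h; rewrite /finite_extension; congr interpolant; apply/funext => j.
by rewrite /node_values; case: ifP => // /h.
Qed.

Lemma smooth_finite_extension h : smooth (finite_extension h).
Proof. apply: smooth_interpolant; exact: grid_lt. Qed.

End nodes.

(** * Sobolev functions and jets *)

Lemma powR_modulus (R : realType) (M r e : R) : 0 <= M -> 0 < r -> 0 < e ->
  exists2 d : R, 0 < d & forall x, 0 <= x -> x < d -> M * x `^ r < e.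
Proof.
move=> M0 r0 e0; have M1 : 0 < M + 1 by rewrite ltr_pwDr.
have q0 : 0 < e / (M + 1) by rewrite divr_gt0.
exists ((e / (M + 1)) `^ r^-1); first by rewrite powR_gt0.
move=> x x0 xd; have h : x `^ r < e / (M + 1).
  have := gt0_ltr_powR r0 x0 (powR_ge0 _ _) xd.
  by rewrite -powRrM mulVf ?gt_eqF// powRr1// ltW.
apply: (@le_lt_trans _ _ ((M + 1) * x `^ r)).
  by rewrite ler_wpM2r ?powR_ge0// lerDl.
by rewrite mulrC -ltr_pdivlMr.
Qed.

Section sobolev_jets_of_functions.
Context (R : realType).
Local Notation mu := (@lebesgue_measure R).
Local Notation locint := (locally_integrable [set: R]).
Variables (p : \bar R).
Hypothesis p1 : (1 < p)%E.
Local Notation "'N[ g ]" := (Lnorm mu p (EFin \o g)) (at level 0).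

Lemma Lfun_measurable (g : R -> R) : g \in Lfun mu p ->
  measurable_fun setT g /\ ('N[g] < +oo)%E.
Proof. by move=> /andP[/set_mem mg /set_mem ng]; split. Qed.

Lemma measurable_Lfun (g : R -> R) : measurable_fun setT g -> ('N[g] < +oo)%E ->
  g \in Lfun mu p.
Proof. by move=> mg ng; apply/andP; split; apply/mem_set. Qed.

Lemma Lnorm_locint (g : R -> R) : measurable_fun setT g -> ('N[g] < +oo)%E -> locint g.
Proof.
move=> mg ng; split => //; first exact: openT.
move=> A _ cA; have [r r0 hr] := integral_Lnorm_le mu p1.
have mA : measurable A by exact: compact_measurable.
apply: (le_lt_trans (hr g A mA mg)).
apply: lte_mul_pinfty; [exact: Lnorm_ge0| |].
  by rewrite ge0_fin_numE//; exact: Lnorm_ge0.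
apply: poweR_lty; exact: compact_finite_measure.
Qed.

Lemma absolutely_continuous_continuous (f : R -> R) :
  absolutely_continuous f -> continuous f.
Proof.
move=> acf t; apply/cvgrPdist_lt => e e0.
have [d d0 hd] := acf e e0.
have small a b : a < b -> b - a < d -> `|f b - f a| < e.
  move=> ab bad; have := hd 1%N (fun=> a) (fun=> b); rewrite !big_ord1; apply => //.
  by apply/trivIsetP => i j _ _; rewrite !ord1.
near=> u.
have : `|t - u| < d by near: u; apply: (@cvgr_dist_lt _ _ _ (nbhs t) _ id t cvg_id).
have [tu|ut|->] := ltgtP t u.
- rewrite distrC (gtr0_norm (x := u - t)) ?subr_gt0// distrC; exact: small.
- rewrite (gtr0_norm (x := t - u)) ?subr_gt0//; exact: small.
- by rewrite !subrr normr0.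
Unshelve. all: by end_near. Qed.

Variable m' : nat.
Let m := m'.+1.

(** Below the top order the fundamental theorem of calculus applies; at the
    top order a weak derivative of a continuous function integrates back to
    it. *)
Lemma sobolev_jetP (F : R -> R) : sobolev m p F -> sobolev_jet m' (sobolev_derivative m F).
Proof.
move=> [[dF acF [g wg _]] LF].
have cF k : (k <= m')%N -> continuous (derive1n k F).
  rewrite leq_eqVlt => /predU1P[->|km]; first exact: absolutely_continuous_continuous.
  by apply: derivable_continuousT => t; exact: dF.
have SE k : (k <= m')%N -> sobolev_derivative m F k = derive1n k F.
  by move=> km; rewrite /sobolev_derivative ltnS km.
have wF : is_weak_derivative (derive1n m' F) (sobolev_derivative m F m).
  rewrite /sobolev_derivative ltnn /=; apply: (xgetPex (cst 0)); by exists g.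
split.
- by move=> k t km; exact: dF.
- by move=> k km; rewrite (SE 0%N)// SE.
- move=> k km; have [mg ng] := Lfun_measurable (LF k km); exact: Lnorm_locint.
- move=> k a b km ab; move: (km); rewrite leq_eqVlt => /predU1P[kE|km'].
    rewrite kE SE//; exact: (weak_derivative_primitive (cF m' (leqnn _)) wF ab).
  rewrite !SE// derive1nS; apply/esym; apply: FTC2_derive1 => //.
    by move=> t; exact: dF.
  by have := cF k.+1 km'; rewrite derive1nS.
Qed.

Lemma sobolev_norm_fin (F : R -> R) : sobolev m p F ->
  (jet_norm m' (sobolev_derivative m F) p < +oo)%E.
Proof.
move=> [_ LF]; apply: lte_sum_pinfty => k _.
by have [] := Lfun_measurable (LF k (ltn_ord k)).
Qed.

(** The sum of the increments is at most the integral of [|f m|] over the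
    union of the intervals, and Hoelder bounds it by a power of their total
    length. *)
Lemma jet_absolutely_continuous (f : nat -> R -> R) : sobolev_jet m' f ->
  ('N[f m] < +oo)%E -> absolutely_continuous (f m').
Proof.
move=> jf nf e e0; have lf : locint (f m) by exact: (jet_locint jf).
have [mf _ _] := lf.
have [r r0 hr] := integral_Lnorm_le mu p1.
have N0 : (0 <= 'N[f m])%E by exact: Lnorm_ge0.
have Nfin : 'N[f m] \is a fin_num by rewrite ge0_fin_numE.
have [|d d0 hd] := @powR_modulus R (fine 'N[f m]) r e _ r0 e0; first exact: fine_ge0.
exists d => // n a b ab tab sd.
have mo i : measurable `]a i, b i[%classic by exact: measurable_itv.
have incr i : (`|f m' (b i) - f m' (a i)|%:E <= \int[mu]_(x in `]a i, b i[) `|f m x|%:E)%E.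
  rewrite (jet_primitive jf (leqnn m') (ltW (ab i))).
  apply: (@le_trans _ _ (\int[mu]_(x in `[a i, b i]) `|f m x|)%:E).
    by rewrite lee_fin le_norm_integral.
  have lnf := locint_norm lf.
  rewrite /Rintegral fineK; last first.
    by apply: integrable_fin_num => //; exact: locint_integrable.
  rewrite (@integral_itv_bndoo R (a i) (b i) (fun x => `|f m x|%:E) true false)//.
  by apply/measurable_EFinP; apply: measurable_funTS; exact: measurableT_comp.
rewrite -lte_fin -sumEFin; apply: (@le_lt_trans _ _ (\sum_(i < n) \int[mu]_(x in `]a i, b i[) `|f m x|%:E)%E).
  by apply: lee_sum => i _; exact: incr.
rewrite -ge0_integral_bigsetU//=; last 3 first.
- exact: index_enum_uniq.
- apply: sub_trivIset tab => i _; exact: I.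
- apply/measurable_EFinP; apply: measurable_funTS; exact: measurableT_comp.
apply: (le_lt_trans (hr _ _ _ mf)); first exact: bigsetU_measurable.
rewrite measure_bigsetU_ord//.
have -> : (\sum_(i < n) mu `]a i, b i[ = (\sum_(i < n) (b i - a i))%:E)%E.
  rewrite -sumEFin; apply: eq_bigr => i _.
  by rewrite lebesgue_measure_itv/= lte_fin ab EFinB.
rewrite -[X in (X * _)%E](fineK Nfin) poweR_EFin -EFinM lte_fin; apply: hd => //.
by apply: sumr_ge0 => i _; rewrite subr_ge0 ltW.
Qed.

(** The weak derivative chosen in [sobolev_derivative] agrees almost
    everywhere with the top function of the jet, so the norms coincide. *)
Lemma sobolev_of_jet (f : nat -> R -> R) : sobolev_jet m' f ->
  (jet_norm m' f p < +oo)%E ->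
  sobolev m p (f 0%N) /\ (sobolev_norm m p (f 0%N) <= jet_norm m' f p)%E.
Proof.
move=> jf nf.
have p1' : (1 <= p)%E by exact: ltW.
have nfs s : (s <= m)%N -> ('N[f s] < +oo)%E.
  move=> sm; apply: le_lt_trans nf; rewrite /jet_norm.
  rewrite (bigD1 (Ordinal (sm : (s < m.+1)%N)))//=; apply: leeDl.
  by apply: sume_ge0 => i _; exact: Lnorm_ge0.
have mf s : (s <= m)%N -> measurable_fun setT (f s) by move=> sm; exact: measurable_jet sm.
have wf : is_weak_derivative (f m') (f m).
  apply: primitive_weak_derivative; first exact: (jet_locint jf).
  by move=> a b; exact: (jet_primitive jf).
have cf : continuous (f m').
  apply: (primitive_continuous (jet_locint jf (leqnn m))) => a b; exact: (jet_primitive jf).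
have SE k : (k <= m')%N -> sobolev_derivative m (f 0%N) k = f k.
  by move=> km; rewrite /sobolev_derivative ltnS km (jet_derive jf).
have wS : is_weak_derivative (f m') (sobolev_derivative m (f 0%N) m).
  rewrite /sobolev_derivative ltnn /= (jet_derive jf)//; apply: (xgetPex (cst 0)); by exists (f m).
have [_ lS _] := wS.
have aeS : \forall x \ae mu, sobolev_derivative m (f 0%N) m x = f m x.
  apply: primitive_ae_unique => //; first exact: (jet_locint jf).
  move=> a b ab; rewrite -(weak_derivative_primitive cf wS ab).
  exact: (jet_primitive jf).
have mS : measurable_fun setT (sobolev_derivative m (f 0%N) m) by case: lS.
have NS : ('N[sobolev_derivative m (f 0%N) m] <= 'N[f m])%E.
  apply: le_Lnorm_ae => //; first exact: mf.
  by apply: (@filterS _ _ (ae_filter_ringOfSetsType mu)) aeS => x ->.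
split; last first.
  apply: lee_sum => k _; have := ltn_ord k; rewrite ltnS leq_eqVlt => /predU1P[->//|km].
  by rewrite SE// -ltnS.
split; last first.
  move=> k; rewrite leq_eqVlt => /predU1P[->|km].
    by apply: measurable_Lfun => //; exact: le_lt_trans (nfs m _).
  by rewrite SE; [apply: measurable_Lfun; [apply: mf|apply: nfs]; exact: ltnW|].
split.
- by move=> k x km; exact: (jet_derivable jf).
- rewrite /= (jet_derive jf)//; apply: jet_absolutely_continuous => //; exact: nfs.
- exists (f m); first by rewrite /= (jet_derive jf).
  by apply: measurable_Lfun; [exact: mf|exact: nfs].
Qed.

End sobolev_jets_of_functions.

(** * Limits along an ultrafilter *)

Section ultralimits.
Context (R : realType) (I : Type) (U : set_system I) {UU : UltraFilter U}.
Implicit Types (phi : I -> R).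

Definition ulim phi : R := lim (phi @ U).

(** Bounded families converge along an ultrafilter: a cluster point exists
    by compactness, and an ultrafilter converges to its cluster points. *)
Lemma ulim_cvg phi (M : R) : (forall i, `|phi i| <= M) -> phi @ U --> ulim phi.
Proof.
move=> hM; suff : cvg (phi @ U) by [].
have UM : (phi @ U) `[- M, M].
  rewrite /fmap/=; have -> : phi @^-1` `[- M, M] = setT.
    by apply/seteqP; split => // i _; rewrite /preimage/= in_itv/= -ler_norml.
  exact: filterT.
have [x [_ cx]] := segment_compact (fmap_proper_filter phi _) UM.
apply/cvg_ex; exists x => V Vx /=.
have [//|UnV] := @in_ultra_setVsetC I U (phi @^-1` V) UU.
by have [y []] := cx (~` V) V UnV Vx.
Qed.

Lemma ulimE phi l : phi @ U --> l -> ulim phi = l.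
Proof. by move=> h; apply: cvg_lim. Qed.

Lemma norm_ulim_le phi (M : R) : (forall i, `|phi i| <= M) -> `|ulim phi| <= M.
Proof.
move=> hM; have cphi := ulim_cvg hM.
rewrite ler_norml; apply/andP; split.
  by apply: limr_ge; [exact: cphi|near=> i; have := hM i; rewrite ler_norml => /andP[]].
by apply: limr_le; [exact: cphi|near=> i; have := hM i; rewrite ler_norml => /andP[]].
Unshelve. all: by end_near. Qed.

End ultralimits.

(** * Weak limits in L_p *)

Section charge_density.
Context d (T : measurableType d) (R : realType).
Variable mu : {sigma_finite_measure set T -> \bar R}.
Variables (D : set T) (n : set T -> R).
Hypothesis mD : measurable D.
Hypothesis Doo : (mu D < +oo)%E.
Hypothesis nD : forall A B, measurable A -> measurable B -> A `<=` D -> B `<=` D ->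
  [disjoint A & B] -> n (A `|` B) = n A + n B.
Hypothesis nac : forall e, 0 < e -> exists2 d : R, 0 < d &
  forall A, measurable A -> A `<=` D -> (mu A < d%:E)%E -> `|n A| < e.

Definition charge_on (A : set T) : \bar R := (n (A `&` D))%:E.

Let n0 : n set0 = 0.
Proof.
have := @nD set0 set0 measurable0 measurable0 (@sub0set _ _) (@sub0set _ _).
rewrite setU0 disj_set2E set0I eqxx => /(_ isT) h.
by apply: (addrI (n set0)); rewrite addr0.
Qed.

Let charge_on0 : charge_on set0 = 0%E.
Proof. by rewrite /charge_on set0I n0. Qed.

Let charge_on_fin A : measurable A -> charge_on A \is a fin_num.
Proof. by []. Qed.

(** A finitely additive, uniformly absolutely continuous set function on a
    set of finite measure is countably additive, because the measure of the
    tails tends to 0. *)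
Let charge_on_sigma_additive : semi_sigma_additive charge_on.
Proof.
move=> F mF tF mUF.
pose tl k := (\bigcup_(i >= k) F i) `&` D.
have mtl k : measurable (tl k).
  by apply: measurableI => //; apply: bigcup_measurable => i _.
have tlD k : tl k `<=` D by move=> t [].
have tlS k : tl k = (F k `&` D) `|` tl k.+1.
  rewrite /tl -setIUl; congr (_ `&` D); apply/seteqP; split => [t [i /= ki Fi]|t [Fk|[i /= ki Fi]]].
  - move: ki; rewrite leq_eqVlt => /predU1P[->|ki]; [by left|by right; exists i].
  - by exists k => /=.
  - by exists i => //=; exact: ltnW.
have dis k : [disjoint (F k `&` D) & tl k.+1].
  rewrite disj_set2E; apply/eqP/seteqP; split => // t [[Fk _] [[i /= ki Fi] _]].
  have /trivIsetP/(_ k i Logic.I Logic.I) := tF; rewrite lt_eqF// => /(_ isT)/seteqP[/(_ t) + _].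
  exact.
have sumE k : n (tl 0%N) = \sum_(0 <= i < k) n (F i `&` D) + n (tl k).
  elim: k => [|k IH]; first by rewrite big_nil add0r.
  rewrite big_nat_recr//= -addrA -nD//; first by rewrite -tlS.
  exact: measurableI.
have tl0 : tl 0%N = (\bigcup_i F i) `&` D.
  by congr (_ `&` D); apply/seteqP; split => t [i _ Fi]; exists i.
have mutl : mu (tl k) @[k --> \oo] --> 0%E.
  have -> : 0%E = mu (\bigcap_k tl k).
    rewrite (_ : \bigcap_k tl k = set0) ?measure0//.
    apply/seteqP; split => // t h; have [[i _ Fi] _] := h 0%N Logic.I.
    have [[j /= ij Fj] _] := h i.+1 Logic.I.
    have /trivIsetP/(_ i j Logic.I Logic.I) := tF; rewrite lt_eqF// => /(_ isT)/seteqP[/(_ t) + _].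
    exact.
  apply: nonincreasing_cvg_mu => //.
  - apply: le_lt_trans Doo; apply: le_measure; rewrite ?inE//.
  - exact: bigcapT_measurable.
  - move=> k l kl; apply/subsetPset => t [[i /= li Fi] Dt]; split => //.
    by exists i => //=; exact: leq_trans li.
rewrite /charge_on -tl0.
have -> : (fun k => \sum_(0 <= i < k) (n (F i `&` D))%:E)%E =
   (fun k => (n (tl 0%N) - n (tl k))%:E).
  by apply/funext => k; rewrite sumEFin (sumE k) addrK.
apply/fine_cvgP; split; first by near=> k.
apply/cvgrPdist_lt => e e0.
have [dl dl0 hdl] := nac e0.
near=> k; rewrite /= opprB addrC subrK; apply: hdl => //.
near: k; have /fine_cvgP[ff fc] := mutl.
have /cvgrPdist_lt/(_ _ dl0) := fc.
apply: filterS2 ff => k fk; rewrite sub0r normrN ger0_norm ?fine_ge0// => h.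
by rewrite -(fineK fk) lte_fin.
Unshelve. all: by end_near. Qed.

HB.instance Definition _ := isCharge.Build _ _ _ charge_on
  charge_on0 charge_on_fin charge_on_sigma_additive.

Lemma charge_density : exists g : T -> R, [/\ measurable_fun setT g,
  mu.-integrable setT (EFin \o g) &
  forall A, measurable A -> A `<=` D -> \int[mu]_(x in A) g x = n A].
Proof.
pose nu : {charge set T -> \bar R} := charge_on.
have dom : nu `<< mu.
  apply/null_content_dominatesP => A mA muA0; rewrite /nu/= /charge_on; congr EFin.
  apply/eqP; rewrite -normr_eq0; apply/negP => /negP ne.
  have e0 : 0 < `|n (A `&` D)| by rewrite lt_neqAle eq_sym ne normr_ge0.
  have [dl dl0 hdl] := nac e0.
  have := hdl (A `&` D); rewrite ltxx => h; apply: notF; apply: h.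
  - exact: measurableI.
  - by move=> t [].
  - apply: (@le_lt_trans _ _ (mu A)); last by rewrite muA0 lte_fin.
    by apply: le_measure; rewrite ?inE//; exact: measurableI.
pose G := Radon_Nikodym nu mu.
have GE : EFin \o (fine \o G) = G.
  by apply/funext => t /=; rewrite fineK//; exact: Radon_Nikodym_fin_num.
have iG : mu.-integrable setT G by exact: Radon_Nikodym_integrable.
exists (fine \o G); split.
- by apply/measurable_EFinP; rewrite GE; exact: measurable_int iG.
- by rewrite GE.
- move=> A mA AD; rewrite /Rintegral.
  have -> : (\int[mu]_(x in A) ((fine \o G) x)%:E = \int[mu]_(x in A) G x)%E.
    by apply: eq_integral => x _; rewrite -[in RHS]GE.
  rewrite -Radon_Nikodym_integral// /nu/= /charge_on/=; congr n.
  exact/setIidPl.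
Qed.

End charge_density.

(** For finite [p], integrate [|h|^p] over the increasing sets where [|h| <=
    |h_ n|]; for [p = +oo], a countable union of null sets is null. *)
Lemma Lnorm_nondecreasing_le d (T : measurableType d) (R : realType)
    (mu : {measure set T -> \bar R}) (p M : \bar R) (h_ : nat -> T -> R) (h : T -> R) :
  (1 < p)%E -> (0 <= M)%E -> (forall n, measurable_fun setT (h_ n)) -> measurable_fun setT h ->
  (forall n, ('N[mu]_p[EFin \o h_ n] <= M)%E) ->
  (forall n t, `|h_ n t| <= `|h_ n.+1 t|) -> (forall t, exists n, `|h t| <= `|h_ n t|) ->
  ('N[mu]_p[EFin \o h] <= M)%E.
Proof.
move=> p1 M0 mh_ mh hM hmono hcov.
case: p p1 hM => [p||//] p1 hM; last first.
  apply/(Lnormy_ae mu h M0).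
  have : \forall x \ae mu, forall n, (`|h_ n x|%:E <= M)%E.
    by apply/ae_foralln => n; apply/(Lnormy_ae mu (h_ n) M0).
  apply: filterS => x hx; have [n hn] := hcov x.
  by apply: le_trans (hx n); rewrite lee_fin.
have p0 : 0 < p.
  by move: p1; rewrite lte_fin; apply: lt_trans; exact: ltr01.
apply: (le_Lnorm_powR p0 M0).
have mnh (g : T -> R) : measurable_fun setT g -> measurable_fun setT (fun t => `|g t|).
  by move=> mg; exact: measurableT_comp.
pose B n : set T := [set t | `|h t| <= `|h_ n t|].
have mB n : measurable (B n).
  rewrite -[B n]setTI.
  by apply: (measurable_fun_le measurableT (mnh _ mh) (mnh _ (mh_ n))).
have BT : \bigcup_n B n = setT.
  by apply/seteqP; split => // t _; have [n hn] := hcov t; exists n.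
have mf : measurable_fun setT (fun x => (`|h x| `^ p)%:E).
  exact: measurable_normr_powR.
have cvB := @ge0_nondecreasing_set_cvg_integral _ _ R B (fun x => (`|h x| `^ p)%:E) mu.
have {}cvB : (\int[mu]_(x in B i) (`|h x| `^ p)%:E)%E @[i --> \oo] --> (\int[mu]_x (`|h x| `^ p)%:E)%E.
  rewrite -BT; apply: cvB => //.
  - apply/nondecreasing_seqP => n; apply/subsetPset => t; rewrite /B/= => h1.
    exact: le_trans (hmono n t).
  - by move=> i; exact: measurable_funTS.
rewrite -(cvg_lim (@ereal_hausdorff R) cvB); apply: lime_le; first by apply/cvg_ex; eexists; exact: cvB.
near=> n; apply: (@le_trans _ _ (\int[mu]_x (`|h_ n x| `^ p)%:E)%E); last first.
  exact: Lnorm_powR_le.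
have mf_ : measurable_fun setT (fun x => (`|h_ n x| `^ p)%:E).
  exact: measurable_normr_powR.
apply: (@le_trans _ _ (\int[mu]_(x in B n) (`|h_ n x| `^ p)%:E)%E).
  apply: ge0_le_integral => //.
  - exact: measurable_funTS.
  - exact: measurable_funTS.
  - by move=> x Bx; rewrite lee_fin ge0_ler_powR ?nnegrE// ltW.
exact: ge0_subset_integral.
Unshelve. all: by end_near. Qed.

Section weak_limit.
Context (R : realType) (I : Type) (U : set_system I) {UU : UltraFilter U}.
Local Notation mu := (@lebesgue_measure R).
Variables (p : \bar R) (w : I -> R -> R) (M : R).
Hypothesis p1 : (1 < p)%E.
Hypothesis M0 : 0 <= M.
Hypothesis mw : forall i, measurable_fun setT (w i).
Hypothesis wM : forall i, ('N[mu]_p[EFin \o w i] <= M%:E)%E.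

(** The weak limit of the functions [w i], seen through its integrals. *)
Definition limit_charge (B : set R) : R := ulim U (fun i => \int[mu]_(x in B) w i x).

Let ball_ (k : nat) : set R := `]- k%:R, k%:R[%classic.
Let shell k : set R := ball_ k.+1 `\` ball_ k.

Let ballE k t : ball_ k t = (`|t| < k%:R).
Proof. by rewrite /ball_/= in_itv/= ltr_norml. Qed.

Let shellE k t : shell k t <-> Num.truncn `|t| = k.
Proof.
rewrite /shell /setD/= !ballE; split => [[h1 h2]|<-].
  by apply: truncn_def; rewrite h1 andbT leNgt; exact/negP.
have /andP[h1 h2] := truncn_itv (normr_ge0 t); split => //.
by apply/negP; rewrite -leNgt.
Qed.

Let mball k : measurable (ball_ k). Proof. exact: measurable_itv. Qed.

Let mshell k : measurable (shell k). Proof. exact: measurableD. Qed.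

Let ball_fin k : (mu (ball_ k) < +oo)%E.
Proof.
by rewrite /ball_ lebesgue_measure_itv/=; case: ifP => _; rewrite ?ltry.
Qed.

Let sub_fin k B : measurable B -> B `<=` ball_ k -> (mu B < +oo)%E.
Proof.
move=> mB Bk; apply: le_lt_trans (ball_fin k); apply: le_measure => //; rewrite inE//.
exact: mball.
Qed.

Let shell_ball k : shell k `<=` ball_ k.+1.
Proof. by move=> t []. Qed.

Let shell_fin k : (mu (shell k) < +oo)%E.
Proof. by apply: (@sub_fin k.+1). Qed.

Let rP := cid2 (integral_Lnorm_le mu p1).
Let r := s2val rP.
Let r0 : 0 < r := s2valP rP.

Lemma weak_int_le i B : measurable B -> (mu B < +oo)%E ->
  (\int[mu]_(x in B) `|w i x|%:E <= (M * fine (mu B) `^ r)%:E)%E.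
Proof.
move=> mB Boo; have := s2valP' rP (w i) B mB (mw i); rewrite /= -/r => h.
have Bfin : mu B \is a fin_num by rewrite ge0_fin_numE.
apply: (le_trans h); rewrite -[in X in (X <= _)%E](fineK Bfin) poweR_EFin EFinM.
by apply: lee_wpmul2r; rewrite ?lee_fin ?powR_ge0.
Qed.

Lemma weak_integrable i B : measurable B -> (mu B < +oo)%E ->
  mu.-integrable B (EFin \o w i).
Proof.
move=> mB Boo; apply/integrableP; split.
  by apply/measurable_EFinP; apply: measurable_funTS; exact: mw.
by apply: (le_lt_trans (weak_int_le i mB Boo)); rewrite ltry.
Qed.

Let int_le i B : measurable B -> (mu B < +oo)%E ->
  `|\int[mu]_(x in B) w i x| <= M * fine (mu B) `^ r.
Proof.
move=> mB Boo; have iB := weak_integrable i mB Boo.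
rewrite -lee_fin; apply: le_trans (weak_int_le i mB Boo).
rewrite EFin_normr_Rintegral//; apply: le_abse_integral => //.
exact: measurable_int iB.
Qed.

Lemma limit_charge_cvg B : measurable B -> (mu B < +oo)%E ->
  (fun i => \int[mu]_(x in B) w i x) @ U --> limit_charge B.
Proof. by move=> mB Boo; apply: (@ulim_cvg _ _ _ _ _ (M * fine (mu B) `^ r)) => i; exact: int_le. Qed.

Lemma limit_charge_le B : measurable B -> (mu B < +oo)%E ->
  `|limit_charge B| <= M * fine (mu B) `^ r.
Proof. by move=> mB Boo; apply: norm_ulim_le => i; exact: int_le. Qed.

Lemma limit_chargeU A B : measurable A -> measurable B -> (mu A < +oo)%E -> (mu B < +oo)%E ->
  [disjoint A & B] -> limit_charge (A `|` B) = limit_charge A + limit_charge B.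
Proof.
move=> mA mB Aoo Boo AB; have mAB : measurable (A `|` B) by exact: measurableU.
have ABoo : (mu (A `|` B) < +oo)%E.
  by apply: (le_lt_trans (measureU2 mu mA mB)); exact: lte_add_pinfty.
apply: ulimE.
have -> : (fun i => \int[mu]_(x in A `|` B) w i x) =
   (fun i => \int[mu]_(x in A) w i x + \int[mu]_(x in B) w i x).
  by apply/funext => i; rewrite Rintegral_setU//; exact: weak_integrable.
by apply: cvgD; exact: limit_charge_cvg.
Qed.

Let shell_density k : exists g : R -> R, [/\ measurable_fun setT g,
  mu.-integrable setT (EFin \o g) &
  forall A, measurable A -> A `<=` shell k -> \int[mu]_(x in A) g x = limit_charge A].
Proof.
have subfin A : measurable A -> A `<=` shell k -> (mu A < +oo)%E.
  by move=> mA Ak; apply: (@sub_fin k.+1) => // t /Ak /shell_ball.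
apply: (@charge_density _ _ R mu (shell k) limit_charge (mshell k) (shell_fin k)).
- by move=> A B mA mB Ak Bk AB; apply: limit_chargeU => //; exact: subfin.
- move=> e e0; have [dl dl0 hdl] := powR_modulus M0 r0 e0.
  exists dl => // A mA Ak Adl; have Aoo := subfin A mA Ak.
  apply: (le_lt_trans (limit_charge_le mA Aoo)); apply: hdl; first exact: fine_ge0.
  by rewrite -lte_fin fineK// ge0_fin_numE.
Qed.

Let gk := projT1 (choice shell_density).

(** The density exists on each shell [k <= |t| < k + 1], which has finite
    measure. The densities are assembled according to the shell of [t]. *)
Definition weak_limit t := gk (Num.truncn `|t|) t.

Let gkP k := projT2 (choice shell_density) k.

Lemma measurable_weak_limit : measurable_fun setT weak_limit.
Proof.
move=> _ Y mY; rewrite setTI.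
have -> : weak_limit @^-1` Y = \bigcup_k (shell k `&` gk k @^-1` Y).
  apply/seteqP; split => [t Yt|t [k _ [/shellE kt Yt]]].
    by exists (Num.truncn `|t|) => //; split => //; exact/shellE.
  by rewrite /preimage/= /weak_limit kt.
apply: bigcupT_measurable => k; apply: measurableI => //.
by have [mg _ _] := gkP k; rewrite -[X in measurable X]setTI; exact: mg.
Qed.

(** By induction on [k], one shell being added at each step. *)
Lemma weak_limitP k B : measurable B -> B `<=` ball_ k ->
  mu.-integrable B (EFin \o weak_limit) /\ \int[mu]_(x in B) weak_limit x = limit_charge B.
Proof.
elim: k B => [|k IH] B mB Bk.
  have -> : B = set0.
    by apply/seteqP; split => // t /Bk; rewrite ballE normr_lt0.
  split; first exact: integrable_set0.
  rewrite Rintegral_set0; apply/esym/ulimE.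
  have -> : (fun i => \int[mu]_(x in set0) w i x) = cst 0.
    by apply/funext => i; rewrite Rintegral_set0.
  exact: cvg_cst.
have BE : B = (B `&` ball_ k) `|` (B `&` shell k).
  rewrite -setIUr; apply/esym/setIidPl => t /Bk tk; rewrite /shell.
  by have [bk|nbk] := pselect (ball_ k t); [left|right].
have dis : [disjoint B `&` ball_ k & B `&` shell k].
  by rewrite disj_set2E; apply/eqP/seteqP; split => // t [[_ ?] [_ [_]]].
have m1 : measurable (B `&` ball_ k) by exact: measurableI.
have m2 : measurable (B `&` shell k) by exact: measurableI.
have [i1 e1] := IH _ m1 (@subIsetr _ _ _).
have [mg ig eg] := gkP k.
have onshell : {in B `&` shell k, weak_limit =1 gk k}.
  by move=> t /set_mem[_ /shellE kt]; rewrite /weak_limit kt.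
have i2 : mu.-integrable (B `&` shell k) (EFin \o weak_limit).
  apply: (@eq_integrable _ _ _ mu _ m2 (EFin \o gk k)).
    by move=> t tB; rewrite /= onshell.
  by apply: integrableS ig.
have e2 : \int[mu]_(x in B `&` shell k) weak_limit x = limit_charge (B `&` shell k).
  rewrite -eg//; first exact: eq_Rintegral.
have iB : mu.-integrable B (EFin \o weak_limit).
  apply/integrableP; split.
    by apply/measurable_EFinP; apply: measurable_funTS; exact: measurable_weak_limit.
  have mn : measurable_fun setT (fun x => `|(EFin \o weak_limit) x|)%E.
    by apply: measurableT_comp => //; apply/measurable_EFinP; exact: measurable_weak_limit.
  rewrite BE ge0_integral_setU//; last exact: measurable_funTS.
  by apply: lte_add_pinfty; [have /integrableP[] := i1|have /integrableP[] := i2].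
split => //; rewrite BE Rintegral_setU -?BE// e1 e2 -limit_chargeU -?BE//.
  by apply: (@sub_fin k) => // t [].
by apply: (@sub_fin k.+1) => // t [_ /shell_ball].
Qed.

Let code : Type := (nat * int * bool)%type.
Let sgn (b : bool) (x : R) := if b then - x else x.
Let level (c : code) : set R := shell c.1.1 `&`
  [set t | expR c.1.2%:~R <= sgn c.2 (weak_limit t) < expR (c.1.2 + 1)%:~R].

Let sgnE b (x : R) : sgn b x = (-1) ^+ b * x.
Proof. by case: b; rewrite /sgn ?expr1 ?mulN1r// expr0 mul1r. Qed.

Let norm_sgn b x : `|sgn b x| = `|x|.
Proof. by case: b; rewrite /sgn ?normrN. Qed.

Let mlevel c : measurable (level c).
Proof.
have ms : measurable_fun setT (fun t => sgn c.2 (weak_limit t)).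
  have -> : (fun t => sgn c.2 (weak_limit t)) = (fun t => (-1) ^+ c.2 * weak_limit t).
    by apply/funext => t; rewrite sgnE.
  by apply: measurable_funM; [exact: measurable_cst|exact: measurable_weak_limit].
have -> : level c = shell c.1.1 `&`
   ((fun t => sgn c.2 (weak_limit t)) @^-1` `[expR c.1.2%:~R, expR (c.1.2 + 1)%:~R[).
  by apply/seteqP; split => t [h1 /=]; rewrite ?in_itv/= => h2; split; rewrite //= in_itv.
apply: measurableI => //; rewrite -[X in measurable X]setTI; apply: ms => //.
Qed.

Let level_fin c : (mu (level c) < +oo)%E.
Proof. by apply: (@sub_fin c.1.1.+1) => // t [/shell_ball]. Qed.

Let sgn_pos b (x : R) : 0 < sgn b x -> b = (x < 0).
Proof. by case: b; rewrite /sgn ?oppr_gt0; [move=> ->|move=> /ltW; rewrite leNgt => /negbTE]. Qed.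

Let levelE c t : level c t ->
  c = (Num.truncn `|t|, Num.floor (ln `|weak_limit t|), weak_limit t < 0).
Proof.
case: c => -[k j] b [/= /shellE <- /andP[h1 h2]].
have s0 : 0 < sgn b (weak_limit t) by apply: lt_le_trans h1; exact: expR_gt0.
congr (_, _, _); last exact: sgn_pos.
apply/esym/floor_def; rewrite -(norm_sgn b) (gtr0_norm s0).
by rewrite -[X in X <= _]expRK -[X in _ < X]expRK ler_ln ?posrE ?expR_gt0// ltr_ln ?posrE ?expR_gt0// h1.
Qed.

Let level_exists t : weak_limit t != 0 -> exists c, level c t.
Proof.
move=> gt; have n0 : 0 < `|weak_limit t| by rewrite normr_gt0.
exists (Num.truncn `|t|, Num.floor (ln `|weak_limit t|), weak_limit t < 0).
split; first exact/shellE.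
have sE : sgn (weak_limit t < 0) (weak_limit t) = `|weak_limit t|.
  by rewrite /sgn; case: ltrP => h; [rewrite ltr0_norm|rewrite ger0_norm].
rewrite /= sE -[X in _ <= X < _]lnK ?posrE// ler_expR ltr_expR; exact: floor_itv.
Qed.

Let level_average c : \forall i \near U,
  ((expR (c.1.2 - 1)%:~R)%:E * mu (level c) <= \int[mu]_(x in level c) `|w i x|%:E)%E.
Proof.
set E := level c; have mE : measurable E by exact: mlevel.
have Eoo : (mu E < +oo)%E := level_fin c.
have Efin : mu E \is a fin_num by rewrite ge0_fin_numE.
have [mu0|mu0] := eqVneq (mu E) 0%E.
  by apply: nearW => i; rewrite mu0 mule0; apply: integral_ge0.
have fE : 0 < fine (mu E) by rewrite fine_gt0// lt_neqAle eq_sym mu0 measure_ge0.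
have [ig eg] : mu.-integrable E (EFin \o weak_limit) /\ \int[mu]_(x in E) weak_limit x = limit_charge E.
  by apply: (@weak_limitP c.1.1.+1) => // t [/shell_ball].
have big : expR c.1.2%:~R * fine (mu E) <= `|limit_charge E|.
  have -> : `|limit_charge E| = `|(-1) ^+ c.2 * \int[mu]_(x in E) weak_limit x|.
    by rewrite eg normrM normrX normrN1 expr1n mul1r.
  rewrite -RintegralZl// -(Rintegral_cst mu mE).
  apply: le_trans (ler_norm _); apply: le_Rintegral => //.
  - by apply/integrableP; split; [exact/measurable_EFinP|rewrite integral_cst// lte_mul_pinfty].
  - have -> : EFin \o (fun x => (-1) ^+ c.2 * weak_limit x) =
      (fun x => (((-1) ^+ c.2)%:E * (EFin \o weak_limit) x)%E) by [].
    exact: integrableZl.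
  - by move=> x [_ /andP[h _]]; rewrite -sgnE.
have lt_big : expR (c.1.2 - 1)%:~R * fine (mu E) < `|limit_charge E|.
  apply: lt_le_trans big; rewrite ltr_pM2r// ltr_expR ltr_int; lia.
have FU : Filter U by typeclasses eauto.
have cN : (fun i => `|\int[mu]_(x in E) w i x|) @ U --> `|limit_charge E|.
  by apply: cvg_norm; exact: limit_charge_cvg.
have := @cvgr_gt R I U FU (fun i => `|\int[mu]_(x in E) w i x|) _ cN _ lt_big.
apply: filterS => i /ltW hi.
rewrite -[mu E]fineK// -EFinM.
have iw := weak_integrable i mE Eoo.
apply: (@le_trans _ _ `|\int[mu]_(x in E) w i x|%:E); first by rewrite lee_fin.
rewrite EFin_normr_Rintegral//; apply: le_abse_integral => //.
exact: measurable_int iw.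
Qed.

(** Up to the factor [e], the limit is constant on the level sets [e^j <=
    +-g < e^(j+1)] within a shell. On finitely many of them at once, the
    averages of some [w i] nearly reach those of the limit, so the averaging
    inequality bounds the limit restricted to these sets. The second factor
    [e] pays for the word nearly. *)
Lemma Lnorm_weak_limit : ('N[mu]_p[EFin \o weak_limit] <= (expR 2 * M)%:E)%E.
Proof.
have e2 : 0 < expR 2 :> R by exact: expR_gt0.
have p1' : (1 <= p)%E by exact: ltW.
pose F n (c : code) := (pickle c < n)%N.
pose h_ n t := if `[< exists2 c, F n c & level c t >] then (expR 2)^-1 * weak_limit t else 0.
pose h t := (expR 2)^-1 * weak_limit t.
have mh : measurable_fun setT h.
  by apply: measurable_funM; [exact: measurable_cst|exact: measurable_weak_limit].
have near_all n : \forall i \near U, forall c, F n c ->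
    ((expR (c.1.2 - 1)%:~R)%:E * mu (level c) <= \int[mu]_(x in level c) `|w i x|%:E)%E.
  elim: n => [|n IH]; first by apply: nearW => i c.
  case E : (@pickle_inv code n) => [c|].
    have Ec := pickle_invK (T := code) n; rewrite E /= in Ec.
    apply: filterS2 IH (level_average c) => i h1 h2 c'; rewrite /F ltnS leq_eqVlt => /predU1P[|]; last exact: h1.
    by rewrite -[n]Ec => /(pcan_inj pickleK) ->.
  apply: filterS IH => i h1 c'; rewrite /F ltnS leq_eqVlt => /predU1P[cn|]; last exact: h1.
  by move: E; rewrite -cn pickleK_inv.
have mh_ n : measurable_fun setT (h_ n).
  pose B : set R := \bigcup_(c in [set c : code | F n c]) level c.
  have mB : measurable B.
    have -> : B = \bigcup_(c in [set: code]) (if F n c then level c else set0).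
      apply/seteqP; split => t [c Fc Lc]; exists c => //; first by rewrite Fc.
        by move: Lc; case: ifP.
      by move: Lc; case: ifP.
    apply: countable_bigcupT_measurable; first exact: countableP.
    by move=> c; case: ifP.
  have -> : h_ n = (fun t => \1_B t * h t).
    apply/funext => t; rewrite /h_ indicE; case: asboolP => [[c Fc Lc]|nB].
      by rewrite mem_set ?mul1r//; exists c.
    by rewrite memNset ?mul0r// => -[c Fc Lc]; apply: nB; exists c.
  by apply: measurable_funM => //; exact: measurable_indic.
have Nh : ('N[mu]_p[EFin \o h] <= M%:E)%E.
  apply: (@Lnorm_nondecreasing_le _ _ R mu p M%:E h_ h p1 _ mh_ mh).
  - by rewrite lee_fin.
  - move=> n; have [i hi] := filter_ex (near_all n).
    apply: le_trans (wM i).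
    pose J c := if F n c then level c else set0.
    have tJ : trivIset setT J.
      apply/trivIsetP => c c' _ _ cc; apply/seteqP; split => // t [].
      rewrite /J; case: ifP => // _ /levelE ec; case: ifP => // _ /levelE ec'.
      by move: cc; rewrite {1}ec ec' eqxx.
    apply: (@Lnorm_average_countable _ _ R code mu p J J (fun c => expR (c.1.2 - 1)%:~R)) => //.
    + by move=> c; rewrite /J; case: ifP => _; [exact: mlevel|exact: measurable0].
    + by move=> c; rewrite /J; case: ifP => _; [exact: mlevel|exact: measurable0].
    + by move=> c; rewrite /J; case: ifP => _; [exact: level_fin|rewrite measure0].
    + exact: mw.
    + exact: mh_.
    + move=> c; rewrite /J; case: ifP => [/hi//|_].
      by rewrite measure0 mule0 integral_set0.
    + move=> c t; rewrite /J; case: ifP => // Fc [_ /andP[h1 h2]].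
      have s0 : 0 < sgn c.2 (weak_limit t) by apply: lt_le_trans h1; exact: expR_gt0.
      rewrite /h_; case: asboolP => _; last by rewrite normr0 expR_ge0.
      rewrite normrM -[`|weak_limit t|](norm_sgn c.2) (gtr0_norm s0) gtr0_norm ?invr_gt0//.
      rewrite mulrC ler_pdivrMr// -expRD; apply: (le_trans (ltW h2)).
      by rewrite ler_expR !intrD; lra.
    + move=> t nJ; rewrite /h_; case: asboolP => // -[c Fc Lc].
      by case: (nJ c); rewrite /J Fc.
  - move=> n t; rewrite /h_; case: asboolP => [[c Fc Lc]|_].
      by case: asboolP => // -[]; exists c => //; exact: ltnW.
    by rewrite normr0.
  - move=> t; have [g0|g0] := eqVneq (weak_limit t) 0.
      by exists 0%N; rewrite /h g0 mulr0 normr0.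
    have [c Lc] := level_exists g0; exists (pickle c).+1.
    by rewrite /h_; case: asboolP => // -[]; exists c => //; rewrite /F ltnS.
have -> : weak_limit = (fun t => expR 2 * h t).
  by apply/funext => t; rewrite /h mulrA mulfV ?mul1r// gt_eqF.
apply: (le_trans (LnormZ_le mu p1' (ltW e2) mh)).
by rewrite EFinM; apply: lee_wpmul2l => //; rewrite lee_fin ltW.
Qed.

End weak_limit.

(** * Limits of bounded families of smooth functions *)

Lemma smooth_increment (R : realType) (f : R -> R) (x t : R) : smooth f ->
  exists2 c, `|c - t| <= `|x - t| & f x - f t = derive1 f c * (x - t).
Proof.
move=> sf; have df (y : R) : is_derive y 1 f (derive1 f y) by exact: (derivable_is_derive (sf 0%N y)).
have cf a b : {within `[a, b], continuous f}.
  by apply: continuous_subspaceT; exact: smooth_continuous.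
have [tx|/ltW xt] := leP t x.
  have [c] := @MVT_segment R f _ t x tx (fun y _ => df y) (cf _ _).
  rewrite in_itv/= => /andP[tc cx] e; exists c => //.
  by rewrite !ger0_norm ?subr_ge0// lerD2r.
have [c] := @MVT_segment R f _ x t xt (fun y _ => df y) (cf _ _).
rewrite in_itv/= => /andP[xc ct] e; exists c.
  by rewrite !ler0_norm ?subr_le0// lerN2 lerD2r.
by rewrite -[LHS]opprB e -mulrN opprB.
Qed.

Section jet_limit.
Context (R : realType) (I : Type) (U : set_system I) {UU : UltraFilter U}.
Local Notation mu := (@lebesgue_measure R).
Variables (p : \bar R) (m' : nat) (u : I -> R -> R) (A : R -> R) (M : R).
Let m := m'.+1.
Hypothesis p1 : (1 < p)%E.
Hypothesis M0 : 0 <= M.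
Hypothesis su : forall i, smooth (u i).
Hypothesis mA : measurable_fun setT A.
Hypothesis uA : forall i s t, (s < m)%N -> `|derive1n s (u i) t| <= A t.
Hypothesis NA : ('N[mu]_p[EFin \o A] <= M%:E)%E.
Hypothesis Nu : forall i, ('N[mu]_p[EFin \o derive1n m (u i)] <= M%:E)%E.

Let p1' : (1 <= p)%E. Proof. exact: ltW. Qed.

Let cu i s : continuous (derive1n s (u i)).
Proof. by apply: smooth_continuous; exact: smooth_derive1n. Qed.

Let mu_ i s : measurable_fun setT (derive1n s (u i)).
Proof. exact: continuous_measurable_fun. Qed.

Let Nus i s : (s <= m)%N -> ('N[mu]_p[EFin \o derive1n s (u i)] <= M%:E)%E.
Proof.
rewrite leq_eqVlt => /predU1P[->//|sm]; apply: le_trans NA.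
apply: le_Lnorm; [exact: p1'|exact: mu_|exact: mA|move=> t].
exact: (le_trans (@uA i s t sm) (ler_norm _)).
Qed.

Let u_increment i s a b : a <= b ->
  derive1n s (u i) b - derive1n s (u i) a = \int[mu]_(t in `[a, b]) derive1n s.+1 (u i) t.
Proof.
move=> ab; have ss := smooth_derive1n s (su i).
rewrite derive1nS (FTC2_derive1 _ _ ab)//.
  by move=> t; exact: (ss 0%N).
by have := @cu i s.+1; rewrite derive1nS.
Qed.

Let rP := cid2 (integral_Lnorm_le mu p1).
Let r := s2val rP.
Let r0 : 0 < r := s2valP rP.

Let u_holder i s x y : (s < m)%N ->
  `|derive1n s (u i) y - derive1n s (u i) x| <= M * `|y - x| `^ r.
Proof.
move=> sm; wlog xy : x y / x <= y.
  move=> H; have [xy|/ltW yx] := leP x y; first exact: H.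
  by rewrite distrC [`|y - x|]distrC; exact: H.
have lu : locally_integrable setT (derive1n s.+1 (u i)) by exact: continuous_locint.
rewrite u_increment//; apply: (le_trans (le_norm_integral x y lu)).
have mI : measurable `[x, y]%classic by exact: measurable_itv.
have := s2valP' rP (derive1n s.+1 (u i)) _ mI (mu_ i s.+1); rewrite /= -/r => h.
rewrite -lee_fin /Rintegral fineK; last first.
  by apply: integrable_fin_num => //; apply: locint_integrable; exact: locint_norm.
apply: (le_trans h).
have -> : mu `[x, y]%classic = (y - x)%:E.
  rewrite lebesgue_measure_itv/= lte_fin; move: xy; rewrite le_eqVlt => /predU1P[->|->].
    by rewrite ltxx subrr.
  by rewrite -EFinB.
rewrite poweR_EFin EFinM ger0_norm ?subr_ge0//.
by apply: lee_wpmul2r; [rewrite lee_fin powR_ge0|exact: (@Nus i s.+1 sm)].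
Qed.

Let v s t := ulim U (fun i => derive1n s (u i) t).

Let v_cvg s t : (s < m)%N -> (fun i => derive1n s (u i) t) @ U --> v s t.
Proof. by move=> sm; apply: (@ulim_cvg _ _ _ _ _ (A t)) => i; exact: uA. Qed.

Let v_le s t : (s < m)%N -> `|v s t| <= A t.
Proof. by move=> sm; apply: norm_ulim_le => i; exact: uA. Qed.

Let v_derive s (t : R) : (s < m')%N -> is_derive t 1 (v s) (v s.+1 t).
Proof.
move=> sm; apply: is_derive_approx => e e0.
have [d d0 hd] := powR_modulus M0 r0 e0; exists d => // x xt.
have sm1 : (s < m)%N by exact: ltnW.
have cv : (fun i => derive1n s (u i) x - derive1n s (u i) t - (x - t) * derive1n s.+1 (u i) t) @ U -->
    v s x - v s t - (x - t) * v s.+1 t.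
  apply: cvgB; first by apply: cvgB; exact: v_cvg.
  by apply: cvgMr; exact: v_cvg.
(* It suffices to bound the difference quotients uniformly in [i]. *)
rewrite -(ulimE cv); apply: norm_ulim_le => i.
have [c ct ->] := smooth_increment x t (smooth_derive1n s (su i)).
rewrite -derive1nS mulrC -mulrBr normrM mulrC ler_wpM2r//.
have sm2 : (s.+1 < m)%N by [].
apply: (le_trans (u_holder i t c sm2)); apply: ltW; apply: hd; first exact: normr_ge0.
exact: le_lt_trans ct xt.
Qed.

Let g := @weak_limit _ _ U _ _ (fun i => derive1n m (u i)) M p1 M0 (fun i => @mu_ i m) Nu.

Definition limit_jet s : R -> R := if (s < m)%N then v s else g.

Let top_integral a b : a <= b -> v m' b - v m' a = \int[mu]_(t in `[a, b]) g t.
Proof.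
move=> ab.
have cv : (fun i => derive1n m' (u i) b - derive1n m' (u i) a) @ U --> v m' b - v m' a.
  by apply: cvgB; exact: v_cvg.
have mI : measurable `[a, b]%classic by exact: measurable_itv.
pose k := (Num.truncn (`|a| + `|b|)).+1.
have abk : `[a, b]%classic `<=` `]- k%:R, k%:R[%classic.
  move=> t /=; rewrite !in_itv/= -ltr_norml => /andP[ta tb].
  have /andP[_ h] := truncn_itv (addr_ge0 (normr_ge0 a) (normr_ge0 b)).
  apply: le_lt_trans h; rewrite ler_norml.
  have := ler_norm b; have := ler_norm (- a); rewrite normrN.
  have := normr_ge0 a; have := normr_ge0 b; move: ta tb; lra.
have [_ ->] := @weak_limitP _ _ U _ _ (fun i => derive1n m (u i)) M p1 M0
  (fun i => @mu_ i m) Nu k _ mI abk.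
rewrite -(ulimE cv); congr ulim; apply/funext => i; exact: u_increment.
Qed.

Let mg : measurable_fun setT g.
Proof. exact: measurable_weak_limit. Qed.

Let Ng : ('N[mu]_p[EFin \o g] <= (expR 2 * M)%:E)%E.
Proof. exact: Lnorm_weak_limit. Qed.

Let lg : locally_integrable setT g.
Proof. by apply: (Lnorm_locint p1 mg); apply: le_lt_trans Ng _; rewrite ltry. Qed.

Let cv s : (s < m)%N -> continuous (v s).
Proof.
rewrite ltnS leq_eqVlt => /predU1P[->|sm]; last first.
  apply: derivable_continuousT => t; have h := v_derive t sm; exact: (@ex_derive _ _ _ _ _ _ _ h).
by apply: (primitive_continuous lg) => a b; exact: top_integral.
Qed.

Let derive_v s : (s < m')%N -> derive1 (v s) = v s.+1.
Proof.
move=> sm; apply/funext => t; rewrite derive1E; have h := v_derive t sm.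
exact: (@derive_val _ _ _ _ _ _ _ h).
Qed.

Let derive1n_v s : (s <= m')%N -> derive1n s (v 0%N) = v s.
Proof.
elim: s => [//|s IH] sm; rewrite derive1nS IH ?(ltnW sm)//; exact: derive_v.
Qed.

(** Uniform Hoelder continuity of the derivatives of order up to [m - 1]
    makes difference quotients converge uniformly in the family, so limit
    and derivation commute. *)
Lemma limit_jetP : sobolev_jet m' limit_jet.
Proof.
have lE s : (s < m)%N -> limit_jet s = v s by rewrite /limit_jet => ->.
have lm : limit_jet m = g by rewrite /limit_jet ltnn.
split.
- move=> k t km; rewrite lE// derive1n_v ?(ltnW km)//.
  have h := v_derive t km; exact: (@ex_derive _ _ _ _ _ _ _ h).
- by move=> k km; rewrite !lE// derive1n_v.
- move=> k; rewrite leq_eqVlt => /predU1P[->|km]; first by rewrite lm.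
  by rewrite lE//; apply: continuous_locint; exact: cv.
- move=> k a b; rewrite leq_eqVlt => /predU1P[->|km] ab.
    by rewrite lm lE//; exact: top_integral.
  rewrite (lE k (ltnW km)) (lE k.+1 km).
  have <- := derive_v km; apply/esym; apply: FTC2_derive1 ab.
    by move=> t; have h := v_derive t km; exact: (@ex_derive _ _ _ _ _ _ _ h).
  by rewrite derive_v; [exact: cv|exact: km].
Qed.

Lemma limit_jetE t : limit_jet 0%N t = ulim U (fun i => u i t).
Proof. by []. Qed.

Lemma jet_norm_limit :
  (jet_norm m' limit_jet p <= (m%:R * M + expR 2 * M)%:E)%E.
Proof.
rewrite /jet_norm big_ord_recr EFinD; apply: leeD; last first.
  by rewrite /limit_jet /= ltnn.
apply: (@le_trans _ _ (\sum_(s < m) M%:E)%E); last first.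
  by rewrite sumEFin sumr_const card_ord mulr_natl.
apply: lee_sum => s _; apply: le_trans NA; rewrite /limit_jet /= ltn_ord.
apply: le_Lnorm; [exact: p1'| |exact: mA|move=> t].
  by apply: continuous_measurable_fun; apply: cv.
exact: (le_trans (v_le t (ltn_ord s)) (ler_norm _)).
Qed.

End jet_limit.

(** * The extension operator *)

Section constants.
Context (R : realType).
Variables (m' : nat) (K : R).
Let m := m'.+1.

(** The window of radius [6m] consists of [12m + 1] unit cells. *)
Definition lower_const : R := interpolant_const m' K * ((6 * m + 6 * m).+1)%:R.

Definition extension_const : R :=
  m%:R * (lower_const + top_const m' K) + expR 2 * (lower_const + top_const m' K).

Hypothesis K0 : 0 <= K.

Lemma interpolant_const_ge0 : 0 <= interpolant_const m' K.
Proof. by rewrite /interpolant_const !(mulr_ge0, addr_ge0, exprn_ge0). Qed.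

Lemma lower_const_ge0 : 0 <= lower_const.
Proof. by rewrite mulr_ge0// interpolant_const_ge0. Qed.

Lemma top_const_ge0 : 0 <= top_const m' K.
Proof.
apply: mulr_ge0; last by rewrite addr_ge0// mulr_ge0// exprn_ge0.
by rewrite mulr_ge0// mulr_ge0// exprn_ge0.
Qed.

Lemma extension_const_ge0 : 0 <= extension_const.
Proof.
have h := addr_ge0 lower_const_ge0 top_const_ge0.
by rewrite /extension_const addr_ge0// mulr_ge0// expR_ge0.
Qed.

End constants.

Section extension.
Context (R : realType).
Local Notation mu := (@lebesgue_measure R).

(** Linear in [f], and defined on the whole line so that finite sets of reals
    can serve as nodes. *)
Definition zero_extension (E : set R) (f : E -> R) (x : R) : R :=
  if pselect (E x) is left Ex then f (SigSub (mem_set Ex)) else 0.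

Lemma zero_extensionE (E : set R) (f : E -> R) (x : E) : zero_extension f (val x) = f x.
Proof.
rewrite /zero_extension; case: pselect => [Ex|[]]; last exact: set_mem (valP x).
by congr f; apply: val_inj.
Qed.

Lemma zero_extension_linear (E : set R) (a : R) (f g : E -> R) :
  zero_extension (a *: f + g) = (fun x => a * zero_extension f x + zero_extension g x).
Proof.
by apply/funext => x; rewrite /zero_extension; case: pselect => // _; rewrite mulr0 addr0.
Qed.

(** Sequences ordered by inclusion serve as finite sets; the filter
    expresses that a set is large enough. *)
Definition finite_subsets_filter : set_system (seq R) :=
  filter_from [set: seq R] (fun s0 => [set s : seq R | {subset s0 <= s}]).

Lemma finite_subsets_filter_proper : ProperFilter finite_subsets_filter.
Proof.
apply: filter_from_proper; last by move=> s _; exists s.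
apply: filter_from_filter; first by exists [::].
move=> s t _ _; exists (s ++ t) => // w h; split => x xs; apply: h; rewrite mem_cat xs ?orbT//.
Qed.

Definition subset_ultrafilter : set_system (seq R) :=
  sval (cid (ultraFilterLemma finite_subsets_filter_proper)).

Lemma subset_ultrafilter_ultra : UltraFilter subset_ultrafilter.
Proof. by have [] := svalP (cid (ultraFilterLemma finite_subsets_filter_proper)). Qed.
#[local] Existing Instance subset_ultrafilter_ultra.

Lemma subset_ultrafilter_mem x : \forall s \near subset_ultrafilter, x \in s.
Proof.
have [_ h] := svalP (cid (ultraFilterLemma finite_subsets_filter_proper)).
by apply: h; exists [:: x] => // s hs /=; apply: hs; rewrite mem_head.
Qed.

Variables (m' : nat) (E : set R).
Let m := m'.+1.

Definition points_in (s : seq R) : seq R := [seq x <- s | `[< E x >]].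

Definition approx_extension (s : seq R) (h : R -> R) : R -> R :=
  finite_extension m' (points_in s) h.

Definition extension (f : E -> R) (t : R) : R :=
  ulim subset_ultrafilter (fun s => approx_extension s (zero_extension f) t).

(** The interpolants depend on [F] only through its restriction to [E],
    although their bounds are those of [F] on the whole line. *)
Lemma approx_extension_restriction (F : R -> R) s :
  approx_extension s (zero_extension (restriction (E := E) F)) = approx_extension s F.
Proof.
apply: eq_finite_extension => x; rewrite mem_filter => /andP[/asboolP Ex _].
by rewrite -[x]/(val (SigSub (mem_set Ex) : E)) zero_extensionE.
Qed.

Variable p : \bar R.
Hypothesis p1 : (1 < p)%E.

Variable K : R.
Hypothesis hK : forall r u, (r <= m)%N -> `|(@step R)^`(r) u| <= K.

Section of_function.
Variable F : R -> R.
Let K0 : 0 <= K.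
Proof. by apply: le_trans (@hK 0%N 0 isT); exact: normr_ge0. Qed.
Let lower0 : 0 <= lower_const m' K := lower_const_ge0 m' K0.
Let top0 : 0 <= top_const m' K := top_const_ge0 m' K0.
Hypothesis SF : sobolev m p F.
Let f := sobolev_derivative m F.
Let jf : sobolev_jet m' f := sobolev_jetP p1 SF.
Let u s := approx_extension s F.
Let N := fine (jet_norm m' f p).

Let NE : jet_norm m' f p = N%:E.
Proof.
rewrite fineK// ge0_fin_numE; first exact: (sobolev_norm_fin SF).
by apply: sume_ge0 => s _; exact: Lnorm_ge0.
Qed.

Let N0 : 0 <= N.
Proof. by rewrite -lee_fin -NE; apply: sume_ge0 => s _; exact: Lnorm_ge0. Qed.

Let A t := interpolant_const m' K * window_integral m' f (6 * m) t.

Let mA : measurable_fun setT A.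
Proof. by apply: measurable_funM; [exact: measurable_cst|exact: measurable_window]. Qed.

Let uA s k (t : R) : (k < m)%N -> `|derive1n k (u s) t| <= A t.
Proof. by move=> km; exact: (interpolant_lo (node_systemP m' (points_in s)) jf hK t km). Qed.

Let M := (lower_const m' K + top_const m' K) * N.

Let M0 : 0 <= M.
Proof. exact: (mulr_ge0 (addr_ge0 lower0 top0) N0). Qed.

Let NA : ('N[mu]_p[EFin \o A] <= M%:E)%E.
Proof.
have mW := @measurable_window R m' f (6 * m).
apply: (le_trans (LnormZ_le mu (ltW p1) (interpolant_const_ge0 m' K0) mW)).
apply: (@le_trans _ _ ((interpolant_const m' K)%:E * (((6 * m + 6 * m).+1)%:R%:E * N%:E))%E).
  rewrite -NE; apply: lee_wpmul2l; first by rewrite lee_fin interpolant_const_ge0.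
  exact: Lnorm_window.
by rewrite -!EFinM lee_fin mulrA; apply: ler_wpM2r; [exact: N0|rewrite lerDl].
Qed.

Let Nu s : ('N[mu]_p[EFin \o derive1n m (u s)] <= M%:E)%E.
Proof.
apply: (le_trans (Lnorm_interpolant_hi (node_systemP m' (points_in s)) jf hK p1)).
by rewrite NE -EFinM lee_fin; apply: ler_wpM2r; [exact: N0|rewrite lerDr].
Qed.

Let su s : smooth (u s). Proof. exact: smooth_finite_extension. Qed.

Let extE : extension (restriction (E := E) F) =
  limit_jet (U := subset_ultrafilter) p1 M0 su Nu 0.
Proof.
apply/funext => t; rewrite limit_jetE /extension; congr ulim; apply/funext => s.
by rewrite approx_extension_restriction.
Qed.

(** The existence of the limit is what makes the extension additive. *)
Lemma extension_cvg t :
  (fun s => approx_extension s (zero_extension (restriction (E := E) F)) t) @ subset_ultrafilter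
  --> extension (restriction (E := E) F) t.
Proof.
apply: (@ulim_cvg _ _ _ _ _ (A t)) => s; rewrite approx_extension_restriction.
exact: (@uA s 0%N t isT).
Qed.

Lemma extension_sobolev : sobolev m p (extension (restriction (E := E) F)) /\
  (sobolev_norm m p (extension (restriction (E := E) F)) <=
    (extension_const m' K)%:E * sobolev_norm m p F)%E.
Proof.
have jl := limit_jetP (UU := subset_ultrafilter_ultra) p1 M0 su mA uA NA Nu.
have nl := jet_norm_limit (UU := subset_ultrafilter_ultra) p1 M0 su mA uA NA Nu.
have [|S1 S2] := sobolev_of_jet p1 jl; first by apply: le_lt_trans nl _; rewrite ltry.
rewrite extE; split => //; apply: (le_trans S2); apply: (le_trans nl).
have -> : sobolev_norm m p F = N%:E by rewrite -NE.
rewrite -EFinM lee_fin.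
have -> : extension_const m' K * N = m%:R * M + expR 2 * M by rewrite /extension_const /M mulrDl -!mulrA.
exact: lexx.
Qed.

End of_function.
End extension.

Section extension_operator.
Context (R : realType).
#[local] Existing Instance subset_ultrafilter_ultra.
Variables (m' : nat) (E : set R) (p : \bar R).
Let m := m'.+1.
Hypothesis p1 : (1 < p)%E.
Variable K : R.
Hypothesis hK : forall r u, (r <= m)%N -> `|(@step R)^`(r) u| <= K.
Let T := @extension R m' E.
Let C := extension_const m' K + 1.

Let C0 : 0 < C.
Proof. by rewrite ltr_wpDl//; apply: extension_const_ge0; apply: le_trans (@hK 0%N 0 isT); exact: normr_ge0. Qed.

Lemma extension_linear : linear_on_trace m p T.
Proof.
move=> a f g [F SF fF] [G SG gG]; apply/funext => t.
change (T (a *: f + g) t = a * T f t + T g t).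
have cf := @extension_cvg R m' E p p1 K hK _ SF t; have cg := @extension_cvg R m' E p p1 K hK _ SG t.
rewrite fF in cf; rewrite gG in cg.
apply: ulimE; rewrite zero_extension_linear.
have -> : (fun s => approx_extension m' E s
      (fun x => a * zero_extension f x + zero_extension g x) t) =
    (fun s => a * approx_extension m' E s (zero_extension f) t +
       approx_extension m' E s (zero_extension g) t).
  by apply/funext => s; rewrite /approx_extension finite_extension_linear.
by apply: cvgD; [apply: cvgMr; exact: cf|exact: cg].
Qed.

(** The approximations at [x] are eventually equal to [f x]. *)
Lemma extension_restriction (f : E -> R) : restriction (T f) = f.
Proof.
apply/funext => x; rewrite -[RHS](zero_extensionE f); apply: ulimE.
apply: cvg_near_cst; have := subset_ultrafilter_mem (val x); apply: filterS => s xs.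
rewrite /approx_extension finite_extension_interp// mem_filter xs andbT.
by apply/asboolP; exact: set_mem (valP x).
Qed.

Lemma extension_operatorP : extension_operator m p T.
Proof.
move=> f [F SF <-]; split; last exact: extension_restriction.
by have [] := extension_sobolev E p1 hK SF.
Qed.

Lemma extension_norm_le (F : R -> R) : sobolev m p F ->
  (sobolev_norm m p (T (restriction (E := E) F)) <= C%:E * sobolev_norm m p F)%E.
Proof.
move=> SF; have [_ h] := extension_sobolev E p1 hK SF.
apply: (le_trans h); apply: lee_wpmul2r; last by rewrite lee_fin lerDl.
by apply: sume_ge0 => k _; exact: Lnorm_ge0.
Qed.

(** A trace norm below [d] comes with an extension of [g - f] of norm below
    [d], so linearity reduces continuity to the bound. *)
Lemma extension_continuous : continuous_on_trace m p T.
Proof.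
move=> f tf e e0; exists (e / C).
  exact: divr_gt0.
move=> g tg /ereal_inf_lt[_ [F [SF FE] <-] Fe].
have -> : T g - T f = T (restriction (E := E) F).
  have -> : restriction (E := E) F = (-1) *: f + g by rewrite FE scaleN1r addrC.
  by rewrite (extension_linear _ tf tg) scaleN1r addrC.
apply: (le_lt_trans (extension_norm_le SF)).
by rewrite -lte_pdivlMl// muleC -EFinM mulrC in Fe *.
Qed.

Lemma extension_operator_norm : (operator_norm m p T <= C%:E)%E.
Proof.
apply: ge_ereal_sup => _ [f [tf f1] <-].
have : (C^-1%:E * sobolev_norm m p (T f) <= trace_norm m p f)%E.
  apply: le_ereal_inf_tmp => _ [F [SF <-] <-].
  by rewrite lee_pdivrMl//; exact: extension_norm_le.
move=> h; have := le_trans h f1; rewrite lee_pdivrMl// mule1; exact.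
Qed.

End extension_operator.

Theorem theorem1p6 (R : realType) :
  exists C : nat -> R,
    forall (E : set R) (p : \bar R) (m : nat),
      closed E -> (1 < p)%E -> (0 < m)%N ->
      exists T : (E -> R) -> (R -> R),
        [/\ linear_on_trace m p T,
            extension_operator m p T,
            continuous_on_trace m p T &
            (operator_norm m p T <= (C m)%:E)%E].
Proof.
pose K m := cid2 (step_uniform_bound R m).
exists (fun m => extension_const m.-1 (s2val (K m)) + 1) => E p [//|m'] _ p1 _.
have hK' := s2valP' (K m'.+1).
exists (@extension R m' E); split.
- exact: (extension_linear p1 hK').
- exact: (extension_operatorP p1 hK').
- exact: (extension_continuous p1 hK').
- exact: (extension_operator_norm E p1 hK').
Qed.
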